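(* Let $f\in L^1(\mathbb{R})$ be nonnegative with $\int_{\mathbb{R}} f(t)\,dt\neq 0$. Suppose that at least one of the following holds: (1) $f$ has compact support; (2) for some $M>0$ the integral $\int_{\mathbb{R}}|f(x)|e^{M|x|}\,dx$ is finite; (3) $\widehat{f}$ is analytic in a neighborhood of the real line (i.e. it extends to a holomorphic function on an open subset of $\mathbb{C}$ containing $\mathbb{R}$); (4) the measure $f\,dx$ has divergent logarithmic integral. Then $f$ is determined up to translations by its $3$-deck: for every nonnegative $g\in L^1(\mathbb{R})$ with $N_g=N_f$ almost everywhere on $\mathbb{R}^2$, there exists $a\in\mathbb{R}$ such that $g(x)=f(x-a)$ for almost every $x\in\mathbb{R}$.
   Context: For nonnegative $f\in L^1(\mathbb{R})$, the $3$-deck of $f$ is the function on $\mathbb{R}^2$ given by $N_f(x_1,x_2)=\int_{\mathbb{R}} f(t)f(t+x_1)f(t+x_2)\,dt$ (defined almost everywhere). The Fourier transform is $\widehat{f}(\xi)=\int_{\mathbb{R}} f(t)e^{-2\pi i t\xi}\,dt$. A measure $\mu$ on $\mathbb{R}$ has divergent logarithmic integral if at least one of the two integrals $$\int_{-\infty}^0 \frac{-\log|\mu|((-\infty,x])}{1+x^2}\,dx,\qquad \int_0^\infty \frac{-\log|\mu|([x,\infty))}{1+x^2}\,dx$$ is divergent, where $|\mu|$ is the total variation measure (with $-\log 0=+\infty$). *)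

(* Defs.v *)
From HB Require Import structures.
From mathcomp Require Import all_boot all_order all_algebra.
From mathcomp Require Import complex.
From mathcomp Require Import all_classical all_reals all_analysis.

Set Implicit Arguments.
Unset Strict Implicit.
Unset Printing Implicit Defensive.

Import Order.TTheory GRing.Theory Num.Theory.
Import numFieldNormedType.Exports.

Local Open Scope classical_set_scope.
Local Open Scope complex_scope.
Local Open Scope ring_scope.

Notation leb := lebesgue_measure.

(* The integrand is a.e. nonnegative whenever f is, so the extended integral is
   defined for all (x1, x2); for f in L^1 it is finite for almost all of them. *)
Definition deck3 (R : realType) (f : R -> R) (x : R * R) : \bar R :=
  (\int[leb]_t (f t * f (t + x.1) * f (t + x.2))%:E)%E.

Definition cis (R : realType) (theta : R) : R[i] := cos theta +i* sin theta.

Definition complex_integral (R : realType) (h : R -> R[i]) : R[i] :=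
  Rintegral leb setT (fun t => complex.Re (h t)) +i*
  Rintegral leb setT (fun t => complex.Im (h t)).

Definition fourier (R : realType) (f : R -> R) (xi : R) : R[i] :=
  complex_integral (fun t => (f t)%:C * cis (- (2 * pi * t * xi))).

(* The topology and normed structure on the complex field R[i] over itself are
   carried by the alias R[i]^o; derivable F z 1 is complex differentiability,
   the limit being taken over complex increments. *)
Definition holomorphic_on (R : realType) (U : set R[i]^o)
    (F : R[i]^o -> R[i]^o) : Prop :=
  forall z, U z -> derivable F z 1.

Definition analytic_near_real_line (R : realType) (h : R -> R[i]) : Prop :=
  exists (U : set R[i]^o) (F : R[i]^o -> R[i]^o),
    [/\ open U, forall x : R, U x%:C, holomorphic_on U F &
        forall x : R, F x%:C = h x].

(* Supports of L^1 classes are taken up to null sets. *)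
Definition compactly_supported (R : realType) (f : R -> R) : Prop :=
  exists K : set R, compact K /\ {ae leb, forall x : R, ~ K x -> f x = 0}.

(* charge_variation does not depend on the Hahn decomposition. *)
Definition charge_total_variation d (T : measurableType d) (R : realType)
    (nu : {charge set T -> \bar R}) : set T -> \bar R :=
  charge_variation (svalP (cid (svalP (cid (Hahn_decomposition nu))))).

(* Charges are finite, so the negative parts of both integrands are integrable
   and each integral is either finite or +oo. *)
Definition divergent_log_integral (R : realType)
    (nu : {charge set (measurableTypeR R) -> \bar R}) : Prop :=
  (\int[leb]_(x in `]-oo, 0%R])
     (- lne (charge_total_variation nu `]-oo, x]) *
      ((1 + x ^+ 2)^-1)%:E) = +oo \/
   \int[leb]_(x in `[0%R, +oo[)
     (- lne (charge_total_variation nu `[x, +oo[) *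
      ((1 + x ^+ 2)^-1)%:E) = +oo)%E.

(* Main.v *)
(* Write f^ for the Fourier transform. Integrating the deck against the
   characters exp(i(a x1 + b x2)) gives f^(a) f^(b) f^(-a-b), so N_g = N_f says
   that f and g have the same bispectrum. At b = -a this yields |g^| = |f^|, and
   near 0 the ratio g^/f^ is then a local character exp(i alpha x). If f^ does
   not vanish on any interval, the identity for g^ spreads from x - a to x through
   a point a with f^(a) <> 0, so g^ = exp(i alpha .) f^ everywhere and g is a
   translate of f.

   In cases (1), (2) and (4), f^ has no gap by a theorem of Levinson: if f^
   vanishes on an interval of length 2a, the Cauchy transform of (a modulation
   of) f is O(exp(-a |Im w|)); together with the decay of the tail of f this
   makes it small far to the right on a horizontal line, and a divergent
   logarithmic integral forces it to be 0 by Jensen's inequality, hence f = 0.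
   In case (3) a gap would propagate along the real line by the identity theorem,
   although f^(0) is the integral of f. *)

Require Import Defs.
From mathcomp Require Import all_boot all_order all_algebra.
From mathcomp Require Import complex.
From mathcomp Require Import all_classical all_reals all_analysis.
From mathcomp Require Import measurable_realfun.
From mathcomp Require Import zify ring lra.
Set Implicit Arguments.
Unset Strict Implicit.
Unset Printing Implicit Defensive.
Import Order.TTheory GRing.Theory Num.Theory.
Import numFieldNormedType.Exports.
Import ComplexField.Normc.

Local Open Scope classical_set_scope.
Local Open Scope complex_scope.
Local Open Scope ring_scope.

Local Notation Re := complex.Re (only parsing).
Local Notation Im := complex.Im (only parsing).
Local Notation integrableR f :=
  (leb.-integrable setT (fun t => (f t)%:E)) (only parsing).

(** * Integrals over the line and complex modulus *)

(** The obstacle in the Levinson step is the real axis: the gap makes the Cauchy transform small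
    only at a height comparable with the distance X, while Jensen's inequality needs smallness on a
    line of fixed height. Cutting the measure at X costs only the tail mass and leaves a function
    analytic across the axis on a disc of radius X/2, so smallness far above and below can be
    carried to the line. A conformal map of the disc onto the half-plane sends the arc at angle 2^-k
    from 1 to distance of order 2^k, and that arc has measure of order 2^-k. Hence everything runs
    on the sums of -ln(tail at 2^k) / 2^k; an exponential moment bounds their terms below, up to a
    summable error. Complex analysis enters in a reduced form. The maximum principle is used only at
    the centre of a disc, for uniform limits of polynomials. The identity theorem rests on one fact:
    a function vanishing on one side of a square vanishes at its centre, by Goursat's theorem
    applied to a product of four rotated copies. *)

Section change_of_variables.
Variable R : realType.
Implicit Types (phi : R -> R) (f : R -> \bar R) (A : set R) (a : R).

(** Lebesgue measure is unique given its values on half-open intervals. The instances used are the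
    translations and the reflection. *)
Lemma preimage_lebesgue_measure phi :
    measurable_fun setT (phi : measurableTypeR R -> measurableTypeR R) ->
    (forall x y, x < y -> leb (phi @^-1` `]x, y]) = (y - x)%:E) ->
  forall A, measurable A -> leb (phi @^-1` A) = leb A.
Proof.
move=> mphi phiE A mA.
have := @lebesgue_measure_unique R
  (pushforward leb (phi : measurableTypeR R -> measurableTypeR R)).
move=> /(_ mphi) /(_ _ A mA) -> //.
move=> X /ocitvP[->|[[x y] /= xy ->]].
  by rewrite !measure0.
by rewrite /pushforward phiE// lebesgue_measure_itv/= lte_fin xy EFinB.
Qed.

Lemma ge0_integral_comp phi f :
    measurable_fun setT (phi : measurableTypeR R -> measurableTypeR R) ->
    (forall x y, x < y -> leb (phi @^-1` `]x, y]) = (y - x)%:E) ->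
  measurable_fun setT f -> (forall x, 0 <= f x)%E ->
  (\int[leb]_x f (phi x) = \int[leb]_x f x)%E.
Proof.
move=> mphi phiE mf f0.
have := @ge0_integral_pushforward _ _ _ _ R _ mphi leb setT f measurableT mf.
rewrite preimage_setT => <-; last by move=> x _; exact: f0.
apply: eq_measure_integral => A mA _; exact: preimage_lebesgue_measure.
Qed.

Lemma integral_comp phi f :
    measurable_fun setT (phi : measurableTypeR R -> measurableTypeR R) ->
    (forall x y, x < y -> leb (phi @^-1` `]x, y]) = (y - x)%:E) ->
  measurable_fun setT f ->
  (\int[leb]_x f (phi x) = \int[leb]_x f x)%E.
Proof.
move=> mphi phiE mf; rewrite integralE [RHS]integralE; congr (_ - _)%E.
  rewrite -(ge0_integral_comp (f := f^\+%E) mphi phiE)//; first by rewrite funepos.unlock.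
  exact: measurable_funepos.
rewrite -(ge0_integral_comp (f := f^\-%E) mphi phiE)//; first by rewrite funeneg.unlock.
exact: measurable_funeneg.
Qed.

Lemma ae_comp phi (P : R -> Prop) :
    measurable_fun setT (phi : measurableTypeR R -> measurableTypeR R) ->
    (forall x y, x < y -> leb (phi @^-1` `]x, y]) = (y - x)%:E) ->
  {ae leb, forall x, P x} -> {ae leb, forall x, P (phi x)}.
Proof.
move=> mphi phiE [N [mN N0 PN]]; exists (phi @^-1` N); split.
- by rewrite -[X in measurable X]setTI; exact: mphi.
- by rewrite (preimage_lebesgue_measure mphi phiE).
- by move=> x Px; exact: PN.
Qed.

Lemma measurable_shiftr a : measurable_fun setT
  (fun x : measurableTypeR R => (x + a : measurableTypeR R)).
Proof. exact: measurable_funD. Qed.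

Lemma measurable_oppr : measurable_fun setT
  (fun x : measurableTypeR R => (- x : measurableTypeR R)).
Proof. exact: measurable_funN. Qed.

Lemma shift_itv a (x y : R) : x < y ->
  leb ((fun z => z + a) @^-1` `]x, y]) = (y - x)%:E.
Proof.
move=> xy; have -> : (fun z => z + a) @^-1` `]x, y] = `](x - a), (y - a)]%classic.
  by apply/seteqP; split => z /=; rewrite !in_itv/= ltrBlDr lerBrDr.
rewrite lebesgue_measure_itv/= lte_fin ltrD2r xy -EFinB; congr EFin; ring.
Qed.

Lemma oppr_itv (x y : R) : x < y ->
  leb ((fun z => - z) @^-1` `]x, y]) = (y - x)%:E.
Proof.
move=> xy; have -> : (fun z => - z) @^-1` `]x, y] = `[(- y), (- x)[%classic.
  by apply/seteqP; split => z /=; rewrite !in_itv/= lerNl ltrNr andbC.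
rewrite lebesgue_measure_itv/= lte_fin ltrN2 xy -EFinB; congr EFin; ring.
Qed.

Lemma integral_shift a f : measurable_fun setT f ->
  (\int[leb]_x f (x + a)%R = \int[leb]_x f x)%E.
Proof. exact: integral_comp (measurable_shiftr a) (shift_itv a). Qed.

Lemma integral_oppr f : measurable_fun setT f ->
  (\int[leb]_x f (- x)%R = \int[leb]_x f x)%E.
Proof. exact: integral_comp measurable_oppr oppr_itv. Qed.

Lemma ae_shift a (P : R -> Prop) :
  {ae leb, forall x, P x} -> {ae leb, forall x, P (x + a)}.
Proof. exact: ae_comp (measurable_shiftr a) (shift_itv a). Qed.

Lemma integrable_shift a f : leb.-integrable setT f ->
  leb.-integrable setT (fun x => f (x + a)).
Proof.
move=> /integrableP[mf If]; apply/integrableP; split.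
  exact: (measurableT_comp mf (measurable_shiftr a)).
by rewrite (integral_shift a (f := fun x => `|f x|%E)) //; exact: measurableT_comp.
Qed.

Lemma integrable_oppr f : leb.-integrable setT f ->
  leb.-integrable setT (fun x => f (- x)).
Proof.
move=> /integrableP[mf If]; apply/integrableP; split.
  exact: (measurableT_comp mf measurable_oppr).
by rewrite (integral_oppr (f := fun x => `|f x|%E)) //; exact: measurableT_comp.
Qed.

End change_of_variables.

(** * Modulus and unit complex numbers *)

Section complex_modulus.
Variable R : realType.
Implicit Types (z w : R[i]) (x y : R).

Lemma normc_ge0 z : 0 <= normc z.
Proof. by case: z => a b /=; exact: sqrtr_ge0. Qed.

Lemma normc_real x : normc x%:C = `|x|.
Proof. by rewrite /= expr0n addr0 sqrtr_sqr. Qed.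

Lemma sqr_normc z : normc z ^+ 2 = Re z ^+ 2 + Im z ^+ 2.
Proof. by case: z => a b /=; rewrite sqr_sqrtr// addr_ge0// sqr_ge0. Qed.

Lemma normc_Re z : `|Re z| <= normc z.
Proof.
rewrite -(@ler_pXn2r _ 2) ?nnegrE ?normc_ge0 ?normr_ge0//.
by rewrite sqr_normc real_normK ?num_real// lerDl sqr_ge0.
Qed.

Lemma normc_Im z : `|Im z| <= normc z.
Proof.
rewrite -(@ler_pXn2r _ 2) ?nnegrE ?normc_ge0 ?normr_ge0//.
by rewrite sqr_normc real_normK ?num_real// lerDr sqr_ge0.
Qed.

Lemma normc_le z : normc z <= `|Re z| + `|Im z|.
Proof.
rewrite -(@ler_pXn2r _ 2) ?nnegrE ?normc_ge0 ?addr_ge0//.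
rewrite sqr_normc sqrrD !real_normK ?num_real//.
by rewrite addrAC lerDl mulrn_wge0// mulr_ge0.
Qed.

Lemma normc_eq0 z : (normc z == 0) = (z == 0).
Proof. by apply/eqP/eqP => [/eq0_normc//|->]; exact: normc0. Qed.

Lemma normc_gt0 z : (0 < normc z) = (z != 0).
Proof. by rewrite lt_neqAle eq_sym normc_eq0 normc_ge0 andbT. Qed.

Lemma normcX z n : normc (z ^+ n) = normc z ^+ n.
Proof. by elim: n => [|n IH]; rewrite ?expr0 ?normc1// !exprS normcM IH. Qed.

Lemma normc_sum (I : Type) (s : seq I) (P : pred I) (F : I -> R[i]) :
  normc (\sum_(i <- s | P i) F i) <= \sum_(i <- s | P i) normc (F i).
Proof.
elim/big_ind2: _ => //; first by rewrite normc0.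
by move=> x1 x2 y1 y2 h1 h2; rewrite (le_trans (le_normcD _ _))// lerD.
Qed.

Lemma normc_prod (I : Type) (s : seq I) (P : pred I) (F : I -> R[i]) :
  normc (\prod_(i <- s | P i) F i) = \prod_(i <- s | P i) normc (F i).
Proof. by apply: (big_morph _ (@normcM R)); exact: normc1. Qed.

Lemma normc_conjc z : normc (conjc z) = normc z.
Proof. by case: z => a b /=; rewrite sqrrN. Qed.

Lemma conjcM z w : conjc (z * w) = conjc z * conjc w.
Proof. exact: rmorphM. Qed.

Lemma le_normcB z w : normc z - normc w <= normc (z - w).
Proof. by rewrite lerBlDr -[X in normc X <= _](subrK w) le_normcD. Qed.

Lemma normc_cis x : normc (cis x) = 1.
Proof. by rewrite /= cos2Dsin2 sqrtr1. Qed.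

Lemma cisD x y : cis (x + y) = cis x * cis y.
Proof. by apply/eqP; rewrite eq_complex /= cosD sinD addrC eqxx [X in _ == X]addrC eqxx. Qed.

Lemma cis0 : cis (0 : R) = 1.
Proof. by rewrite /cis cos0 sin0. Qed.

Lemma cisN x : cis (- x) = conjc (cis x).
Proof. by rewrite /cis cosN sinN. Qed.

Lemma cis_eq0 x : (cis x == 0) = false.
Proof. by rewrite -normc_eq0 normc_cis oner_eq0. Qed.

Lemma mulcJ z : z * conjc z = (normc z ^+ 2)%:C.
Proof.
rewrite sqr_normc; case: z => a b; rewrite /= /real_complex_def.
by congr (_ +i* _); ring.
Qed.

End complex_modulus.

(** * Integrals of complex-valued functions *)

Section complex_integral.
Variable R : realType.
Implicit Types (h k : R -> R[i]) (f m : R -> R) (c : R[i]).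

Definition cmeasurable d (T : measurableType d) (k : T -> R[i]) :=
  measurable_fun setT (fun t => Re (k t)) /\
  measurable_fun setT (fun t => Im (k t)).

Lemma cmeasurable_cst d (T : measurableType d) c : cmeasurable (fun _ : T => c).
Proof. by split; exact: measurable_cst. Qed.

Lemma cmeasurable_real d (T : measurableType d) (f : T -> R) :
  measurable_fun setT f -> cmeasurable (fun t => (f t)%:C).
Proof. by move=> mf; split => //=; exact: measurable_cst. Qed.

Lemma cmeasurableD d (T : measurableType d) (h k : T -> R[i]) :
  cmeasurable h -> cmeasurable k -> cmeasurable (fun t => h t + k t).
Proof.
move=> [h1 h2] [k1 k2]; split.
  rewrite (_ : (fun t => _) = (fun t => Re (h t) + Re (k t))).
    exact: measurable_funD.
  by apply/funext => t; case: (h t) (k t) => a b [].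
rewrite (_ : (fun t => _) = (fun t => Im (h t) + Im (k t))).
  exact: measurable_funD.
by apply/funext => t; case: (h t) (k t) => a b [].
Qed.

Lemma cmeasurableM d (T : measurableType d) (h k : T -> R[i]) :
  cmeasurable h -> cmeasurable k -> cmeasurable (fun t => h t * k t).
Proof.
move=> [h1 h2] [k1 k2]; split.
  rewrite (_ : (fun t => _) = (fun t => Re (h t) * Re (k t)
     - Im (h t) * Im (k t))).
    by apply: measurable_funB; exact: measurable_funM.
  by apply/funext => t; case: (h t) (k t) => a b [].
rewrite (_ : (fun t => _) = (fun t => Re (h t) * Im (k t)
   + Im (h t) * Re (k t))).
  by apply: measurable_funD; exact: measurable_funM.
by apply/funext => t; case: (h t) (k t) => a b [].
Qed.

Lemma cmeasurableX d (T : measurableType d) (h : T -> R[i]) n :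
  cmeasurable h -> cmeasurable (fun t => h t ^+ n).
Proof.
move=> mh; elim: n => [|n IH].
  by under eq_fun do rewrite expr0; exact: cmeasurable_cst.
by under eq_fun do rewrite exprS; exact: cmeasurableM.
Qed.

Lemma cmeasurable_cis d (T : measurableType d) (f : T -> R) :
  measurable_fun setT f -> cmeasurable (fun t => cis (f t)).
Proof.
move=> mf; split => /=.
  by apply: measurableT_comp => //; apply: continuous_measurable_fun; exact: continuous_cos.
by apply: measurableT_comp => //; apply: continuous_measurable_fun; exact: continuous_sin.
Qed.

Lemma measurable_fun_inv d (T : measurableType d) (f : T -> R) :
  measurable_fun setT f -> (forall t, 0 <= f t) ->
  measurable_fun setT (fun t => (f t)^-1).
Proof.
move=> mf f0; under eq_fun do rewrite -powR_inv1//.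
exact: (measurableT_comp (measurable_powR _)).
Qed.

Lemma cmeasurableV d (T : measurableType d) (h : T -> R[i]) :
  cmeasurable h -> cmeasurable (fun t => (h t)^-1).
Proof.
move=> [h1 h2].
have mn : measurable_fun setT
    (fun t => (Re (h t) ^+ 2 + Im (h t) ^+ 2)^-1).
  apply: measurable_fun_inv => [|t]; last by rewrite addr_ge0 ?sqr_ge0.
  by apply: measurable_funD; exact: measurable_funX.
split.
  rewrite (_ : (fun t => _) = (fun t => Re (h t) *
     (Re (h t) ^+ 2 + Im (h t) ^+ 2)^-1)).
    exact: measurable_funM.
  by apply/funext => t; case: (h t) => a b.
rewrite (_ : (fun t => _) = (fun t => - (Im (h t) *
   (Re (h t) ^+ 2 + Im (h t) ^+ 2)^-1))).
  by apply: measurable_funN; exact: measurable_funM.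
by apply/funext => t; case: (h t).
Qed.

Definition cintegrable h :=
  leb.-integrable setT (fun t => (Re (h t))%:E) /\
  leb.-integrable setT (fun t => (Im (h t))%:E).

Lemma cintegrable_cmeasurable h : cintegrable h -> cmeasurable h.
Proof.
by move=> [/measurable_int h1 /measurable_int h2]; split; apply/measurable_EFinP.
Qed.

Lemma cintegrable_le h m : cmeasurable h ->
    leb.-integrable setT (fun t => (m t)%:E) ->
    (forall t, normc (h t) <= m t) -> cintegrable h.
Proof.
move=> [h1 h2] im hm; split.
  apply: le_integrable im => //; first exact/measurable_EFinP.
  move=> t _ /=; rewrite lee_fin (le_trans (normc_Re _))//.
  by rewrite (le_trans (hm t))// ler_norm.
apply: le_integrable im => //; first exact/measurable_EFinP.
move=> t _ /=; rewrite lee_fin (le_trans (normc_Im _))//.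
by rewrite (le_trans (hm t))// ler_norm.
Qed.

Lemma cintegrable_normc h : cintegrable h ->
  leb.-integrable setT (fun t => (normc (h t))%:E).
Proof.
move=> [h1 h2].
have i12 := integrableD measurableT (integrable_abse h1) (integrable_abse h2).
apply: le_integrable i12 => //.
  have [m1 m2] : cmeasurable h by exact: cintegrable_cmeasurable.
  apply/measurable_EFinP.
  rewrite (_ : (fun t => _) = (fun t =>
    Num.sqrt (Re (h t) ^+ 2 + Im (h t) ^+ 2))); last first.
    by apply/funext => t; case: (h t).
  apply: (@measurableT_comp _ _ _ _ _ _ (@Num.sqrt R)) => //.
    by apply: continuous_measurable_fun; exact: sqrt_continuous.
  by apply: measurable_funD; exact: measurable_funX.
move=> t _ /=; rewrite lee_fin ger0_norm ?normc_ge0//.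
by rewrite ger0_norm ?addr_ge0// normc_le.
Qed.

Lemma cintegrableM h k (B : R) : cintegrable h -> cmeasurable k ->
  (forall t, normc (k t) <= B) -> cintegrable (fun t => h t * k t).
Proof.
move=> ih mk kB.
have in_ := integrableZr measurableT B (cintegrable_normc ih).
apply: (@cintegrable_le _ (fun t => normc (h t) * B)).
- by apply: cmeasurableM => //; exact: cintegrable_cmeasurable.
- by [].
- by move=> t; rewrite normcM ler_wpM2l// normc_ge0.
Qed.

Lemma cintegrable_real f : integrableR f ->
  cintegrable (fun t => (f t)%:C).
Proof. by move=> If; split => //=; exact: integrable0. Qed.

Lemma cintegrableD h k : cintegrable h -> cintegrable k ->
  cintegrable (fun t => h t + k t).
Proof.
move=> [h1 h2] [k1 k2]; split.
  rewrite (_ : (fun t => _) = ((fun t => (Re (h t))%:E) \+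
    (fun t => (Re (k t))%:E))%E); first exact: integrableD.
  by apply/funext => t /=; case: (h t) (k t) => a b [].
rewrite (_ : (fun t => _) = ((fun t => (Im (h t))%:E) \+
  (fun t => (Im (k t))%:E))%E); first exact: integrableD.
by apply/funext => t /=; case: (h t) (k t) => a b [].
Qed.

Lemma cintegrableZ c h : cintegrable h -> cintegrable (fun t => c * h t).
Proof.
move=> ih; under eq_fun do rewrite mulrC.
apply: (@cintegrableM _ _ (normc c)) => //; exact: cmeasurable_cst.
Qed.

Lemma complex_integralD h k : cintegrable h -> cintegrable k ->
  complex_integral (fun t => h t + k t) = complex_integral h + complex_integral k.
Proof.
move=> [h1 h2] [k1 k2]; rewrite /complex_integral /=.
congr (_ +i* _).
  rewrite -RintegralD//; apply: eq_Rintegral => t _.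
  by case: (h t) (k t) => a b [].
rewrite -RintegralD//; apply: eq_Rintegral => t _.
by case: (h t) (k t) => a b [].
Qed.

Lemma complex_integralZ c h : cintegrable h ->
  complex_integral (fun t => c * h t) = c * complex_integral h.
Proof.
move=> [h1 h2]; case: c => a b; rewrite /complex_integral /=.
have i1 r : leb.-integrable setT (fun t => (r * Re (h t))%:E).
  by under eq_fun do rewrite EFinM; apply: integrableZl.
have i2 r : leb.-integrable setT (fun t => (r * Im (h t))%:E).
  by under eq_fun do rewrite EFinM; apply: integrableZl.
congr (_ +i* _).
  rewrite -!RintegralZl// -RintegralB//; [|exact: i1|exact: i2].
  apply: eq_Rintegral => t _.
  by case: (h t).
rewrite -!RintegralZl// -RintegralD//; [|exact: i2|exact: i1].
apply: eq_Rintegral => t _.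
by case: (h t).
Qed.

Lemma complex_integral0 : complex_integral (fun _ : R => 0 : R[i]) = 0.
Proof. by rewrite /complex_integral /= /Rintegral integral0. Qed.

Lemma cintegrable0 : cintegrable (fun=> 0).
Proof. by split; exact: integrable0. Qed.

Lemma cintegrable_sum (I : Type) (s : seq I) (F : I -> R -> R[i]) :
  (forall i, cintegrable (F i)) -> cintegrable (fun t => \sum_(i <- s) F i t).
Proof.
move=> iF; elim: s => [|i s IH].
  by under eq_fun do rewrite big_nil; exact: cintegrable0.
by under eq_fun do rewrite big_cons; exact: cintegrableD.
Qed.

Lemma complex_integral_sum (I : Type) (s : seq I) (F : I -> R -> R[i]) :
    (forall i, cintegrable (F i)) ->
  complex_integral (fun t => \sum_(i <- s) F i t) =
  \sum_(i <- s) complex_integral (F i).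
Proof.
move=> iF; elim: s => [|i s IH].
  by under eq_fun do rewrite big_nil; rewrite complex_integral0 big_nil.
under eq_fun do rewrite big_cons.
rewrite complex_integralD//; first by rewrite IH big_cons.
exact: cintegrable_sum.
Qed.

(** The factor 2 comes from bounding the real and imaginary parts separately; the later estimates
    are insensitive to such constants. *)
Lemma complex_integral_le h m : cintegrable h ->
    leb.-integrable setT (fun t => (m t)%:E) ->
    (forall t, normc (h t) <= m t) ->
  normc (complex_integral h) <= 2 * Rintegral leb setT m.
Proof.
move=> [h1 h2] im hm; apply: le_trans (normc_le _) _ => /=.
have aux (u : R -> R) : leb.-integrable setT (fun t => (u t)%:E) ->
    (forall t, `|u t| <= m t) ->
    `|Rintegral leb setT u| <= Rintegral leb setT m.
  move=> iu um; apply: le_trans (le_normr_Rintegral measurableT iu) _.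
  by apply: le_Rintegral => //; exact: integrable_norm.
rewrite mulr_natl mulr2n lerD// aux// => t.
  by rewrite (le_trans (normc_Re _)).
by rewrite (le_trans (normc_Im _)).
Qed.

End complex_integral.

(** * Maximum principle at the center of the disc *)

Section disc_algebra.
Variable R : realType.
Implicit Types (F G : R[i] -> R[i]) (p : {poly R[i]}) (z : R[i]).

(** Averaging [p] over the two square roots of w leaves its even part evaluated at w. This keeps the
    bound on the circle and the value at 0 while the size halves, until only the constant is
    left. *)
Lemma poly_center p (B : R) :
  (forall z, normc z = 1 -> normc p.[z] <= B) -> normc p.[0] <= B.
Proof.
move: {2}(size p) (leqnn (size p)) => n; elim/ltn_ind: n p => n IH p pn pB.
have [p1|p1] := leqP (size p) 1.
  have e z : p.[z] = p`_0 by rewrite {1}(size1_polyC p1) hornerC.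
  by rewrite e -(e 1) pB// normc1.
have -> : p.[0] = (even_poly p).[0].
  by rewrite !horner_coef0 coef_even_poly.
apply: (IH (uphalf (size p))) => //.
- by apply: leq_trans pn; lia.
- exact: size_even_poly.
move=> w w1; have [z zw] : exists z, z ^+ 2 = w by exists (sqrtc w); exact: sqr_sqrtc.
have z1 : normc z = 1.
  apply/eqP; rewrite -(@eqrXn2 _ 2)// ?normc_ge0// expr1n -normcX zw.
  exact/eqP.
have -> : (even_poly p).[w] = (p.[z] + p.[- z]) / 2.
  have E x : p.[x] = (even_poly p).[x ^+ 2] + (odd_poly p).[x ^+ 2] * x.
    by rewrite -{1}(poly_even_odd p) !hornerE !horner_comp !hornerE.
  by rewrite !E -zw sqrrN; field.
rewrite normcM normcV.
have -> : normc (2 : R[i]) = 2.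
  by rewrite (_ : 2 = (2%:R)%:C) ?normc_real ?ger0_norm// rmorph_nat.
rewrite ler_pdivrMr// mulr_natr mulr2n (le_trans (le_normcD _ _))// lerD ?pB//.
by rewrite normcN.
Qed.

(* The uniform closure of the polynomials on the closed unit disc; for these the
   maximum principle at 0 follows by averaging over roots of unity. *)
Definition pdisc F := forall e : R, 0 < e -> exists p, forall z,
  normc z <= 1 -> normc (F z - p.[z]) <= e.

Lemma pdisc_center F (B : R) : pdisc F ->
  (forall z, normc z = 1 -> normc (F z) <= B) -> normc (F 0) <= B.
Proof.
move=> pF FB; apply/ler_addgt0Pr => e e0.
have [p pe] := pF (e / 2) (divr_gt0 e0 (ltr0n _ 2)).
have pB : normc p.[0] <= B + e / 2.
  apply: poly_center => z z1.
  rewrite (_ : p.[z] = F z - (F z - p.[z])); last by rewrite subKr.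
  rewrite (le_trans (le_normcD _ _))// lerD ?FB// normcN pe//.
  by rewrite z1.
rewrite (_ : F 0 = p.[0] + (F 0 - p.[0])); last by rewrite addrC subrK.
rewrite (le_trans (le_normcD _ _))// [in leRHS](splitr e) addrA lerD// pe//.
by rewrite normc0.
Qed.

Lemma pdisc_bounded F : pdisc F ->
  exists2 M, 0 <= M & forall z, normc z <= 1 -> normc (F z) <= M.
Proof.
move=> pF; have [p pe] := pF 1 ltr01.
exists (1 + \sum_(i < size p) normc p`_i).
  by rewrite addr_ge0// sumr_ge0// => i _; exact: normc_ge0.
move=> z z1; rewrite (_ : F z = (F z - p.[z]) + p.[z]); last by rewrite subrK.
rewrite (le_trans (le_normcD _ _))// lerD ?pe// horner_coef.
rewrite (le_trans (normc_sum _ _ _))// ler_sum// => i _.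
by rewrite normcM normcX ler_piMr ?normc_ge0// exprn_ile1// normc_ge0.
Qed.

Lemma pdisc_ext F G : (forall z, normc z <= 1 -> F z = G z) ->
  pdisc F -> pdisc G.
Proof.
by move=> FG pF e e0; have [p pe] := pF e e0; exists p => z z1; rewrite -FG// pe.
Qed.

Lemma pdisc_poly p : pdisc (horner p).
Proof. by move=> e e0; exists p => z _; rewrite subrr normc0 ltW. Qed.

Lemma pdisc_mul F G : pdisc F -> pdisc G -> pdisc (fun z => F z * G z).
Proof.
move=> pF pG e e0.
have [M M0 FM] := pdisc_bounded pF; have [N N0 GN] := pdisc_bounded pG.
have e10 : 0 < e / (2 * (N + 1)) by rewrite divr_gt0// mulr_gt0// ltr_wpDl.
(* The tolerance for [q] depends on a bound for [p], so [q] is chosen after [p]. *)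
have [p pe] := pF _ e10; have [P P0 pP] := pdisc_bounded (pdisc_poly p).
have e20 : 0 < e / (2 * (P + 1)) by rewrite divr_gt0// mulr_gt0// ltr_wpDl.
have [q qe] := pG _ e20.
exists (p * q) => z z1; rewrite hornerM.
rewrite (_ : _ - _ = (F z - p.[z]) * G z + p.[z] * (G z - q.[z])); last by ring.
have aux (x : R) : 0 <= x -> e / (2 * (x + 1)) * x <= e / 2.
  move=> x0; have x1 : x + 1 != 0 by rewrite gt_eqF// ltr_wpDl.
  rewrite (_ : _ * x = e / 2 * (x / (x + 1))); last by field.
  rewrite ler_piMr ?divr_ge0 ?ltW// ltr_pdivrMr ?mul1r ?ltrDl//.
  by rewrite ltr_wpDl.
rewrite (le_trans (le_normcD _ _))// !normcM (splitr e) lerD//.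
  by rewrite (le_trans _ (aux N N0))// ler_pM ?normc_ge0// ?pe// GN.
by rewrite (le_trans _ (aux P P0))// mulrC ler_pM ?normc_ge0// ?pP// qe.
Qed.

Lemma pdisc_prod (I : Type) (s : seq I) (F : I -> R[i] -> R[i]) :
  (forall i, pdisc (F i)) -> pdisc (fun z => \prod_(i <- s) F i z).
Proof.
move=> pF; elim: s => [|i s IH].
  by apply: (pdisc_ext _ (pdisc_poly 1)) => z _; rewrite hornerC big_nil.
by under eq_fun do rewrite big_cons; exact: pdisc_mul.
Qed.

Lemma pdisc_scale F (c : R[i]) : normc c <= 1 -> pdisc F ->
  pdisc (fun z => F (c * z)).
Proof.
move=> c1 pF e e0; have [p pe] := pF e e0; exists (p \Po (c *: 'X)) => z z1.
rewrite horner_comp !hornerE; apply: pe.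
by rewrite normcM mulr_ile1 ?normc_ge0.
Qed.

(** The kernel is a geometric series, uniformly convergent because [b t * z] has modulus at most
    [q < 1]; its partial sums integrate to polynomials in z. The truncated Cauchy transform and the
    one carried to the disc are both brought to this form. *)
Lemma pdisc_cauchy (a b : R -> R[i]) (q : R) : cintegrable a -> cmeasurable b ->
  (forall t, normc (b t) <= q) -> q < 1 ->
  pdisc (fun z => complex_integral (fun t => a t / (1 - b t * z))).
Proof.
move=> ia mb bq q1 e e0.
have q0 : 0 <= q by rewrite (le_trans (normc_ge0 (b 0))).
set A := Rintegral leb setT (fun t => normc (a t)).
have A0 : 0 <= A by apply: Rintegral_ge0 => t _; exact: normc_ge0.
have [N Ne] : exists N, 2 * (A * (q ^+ N / (1 - q))) <= e.
  have : (fun N => 2 * (A * (q ^+ N / (1 - q)))) @ \oo --> (2 * (A * (0 / (1 - q)))).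
    apply: cvgMr; apply: cvgMr; apply: cvgMl; apply: cvg_expr.
    by rewrite ger0_norm.
  rewrite mul0r !mulr0 => /cvgrPdist_le/(_ _ e0) [N _ /(_ N (leqnn N))].
  rewrite sub0r normrN => h; exists N; exact: le_trans (ler_norm _) h.
exists (\poly_(m < N) complex_integral (fun t => a t * b t ^+ m)) => z z1.
have ineq t : normc (b t * z) <= q.
  rewrite normcM (le_trans (ler_pM _ _ (bq t) z1)) ?normc_ge0//.
  by rewrite mulr1.
have nz t : 1 - b t * z != 0.
  rewrite -normc_gt0 (lt_le_trans _ (le_normcB _ _))// normc1 subr_gt0.
  exact: le_lt_trans (ineq t) q1.
have bnd t : normc (1 - b t * z)^-1 <= (1 - q)^-1.
  rewrite normcV lef_pV2 ?posrE ?normc_gt0 ?subr_gt0//.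
  by rewrite (le_trans _ (le_normcB _ _))// normc1 lerD2l lerN2.
have m1 : cmeasurable (fun t => (1 - b t * z)^-1).
  apply: cmeasurableV; under eq_fun do rewrite -mulrN.
  by apply: cmeasurableD; [|apply: cmeasurableM => //]; exact: cmeasurable_cst.
have iab m : cintegrable (fun t => a t * b t ^+ m).
  apply: (@cintegrableM _ _ _ 1) => //; first exact: cmeasurableX.
  by move=> t; rewrite normcX exprn_ile1 ?normc_ge0// (le_trans (bq t))// ltW.
rewrite horner_poly.
have -> : \sum_(i < N) complex_integral (fun t => a t * b t ^+ i) * z ^+ i =
    complex_integral (fun t => \sum_(i < N) (z ^+ i * (a t * b t ^+ i))).
  rewrite complex_integral_sum; last by move=> i; exact: cintegrableZ.
  by apply: eq_bigr => i _; rewrite complex_integralZ// mulrC.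
have i2 : cintegrable (fun t => \sum_(i < N) (z ^+ i * (a t * b t ^+ i))).
  by apply: cintegrable_sum => i; exact: cintegrableZ.
have i1 : cintegrable (fun t => a t / (1 - b t * z)).
  exact: (cintegrableM ia m1 bnd).
have -> : complex_integral (fun t => a t / (1 - b t * z)) -
    complex_integral (fun t => \sum_(i < N) (z ^+ i * (a t * b t ^+ i))) =
    complex_integral (fun t => a t * ((b t * z) ^+ N / (1 - b t * z))).
  rewrite -[X in _ - X]mul1r -mulNr -complex_integralZ// -complex_integralD//.
    congr complex_integral; apply/funext => t; rewrite mulN1r.
    have -> : \sum_(i < N) z ^+ i * (a t * b t ^+ i) =
        a t * \sum_(i < N) (b t * z) ^+ i.
      by rewrite mulr_sumr; apply: eq_bigr => i _; rewrite exprMn; ring.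
    rewrite -mulrBr; congr (_ * _); apply: (mulIf (nz t)).
    rewrite mulrBl mulVf// divfK//.
    rewrite -[RHS](subrK 1) subrX1.
    ring.
  exact: cintegrableZ.
apply: le_trans (complex_integral_le (m := fun t => normc (a t) * (q ^+ N / (1 - q))) _ _ _) _.
- apply: (@cintegrableM _ _ _ (1 / (1 - q))) => //.
    apply: cmeasurableM => //; apply: cmeasurableX; apply: cmeasurableM => //.
  move=> t; rewrite normcM ler_pM ?normc_ge0// normcX exprn_ile1 ?normc_ge0//.
  by rewrite (le_trans (ineq t))// ltW.
- by under eq_fun do rewrite EFinM; apply: integrableZr => //; exact: cintegrable_normc.
- move=> t; rewrite normcM ler_wpM2l ?normc_ge0// normcM ler_pM ?normc_ge0//.
  by rewrite normcX lerXn2r ?nnegrE ?normc_ge0.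
- by rewrite RintegralZr//; exact: cintegrable_normc.
Qed.

End disc_algebra.

(** * Jensen's inequality by rotations of the disc *)

Section rotations.
Variable R : realType.
Implicit Types (F : R[i] -> R[i]) (z : R[i]).

Lemma cis_period (x : R) : cis (x + 2 * pi) = cis x.
Proof. by rewrite cisD {2}/cis mulr_natl cos2pi sin2pi -[X in _ * X]/(1 : R[i]) mulr1. Qed.

(** Angles are measured clockwise from 1 to match [halfplane], which sends cis(-x) for small x > 0
    far to the right. *)
Lemma unit_cisN z : normc z = 1 -> exists2 t : R, 0 <= t & z = cis (- t).
Proof.
case: z => a b z1; have /eqP : normc (a +i* b) ^+ 2 = 1 by rewrite z1 expr1n.
rewrite sqr_normc /= => /eqP ab1.
have a1 : -1 <= a <= 1.
  have b2 := sqr_ge0 b; apply/andP; split; nra.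
have [b0|b0] := leP b 0.
  exists (acos a); first by rewrite acos_ge0.
  rewrite /cis cosN sinN acosK ?in_itv//= sin_acos//.
  by rewrite -ab1 addrAC subrr add0r sqrtr_sqr ler0_norm// opprK.
exists (2 * pi - acos a).
  by rewrite subr_ge0 (le_trans (acos_lepi _))// ler_peMl ?pi_ge0// ler1n.
rewrite opprB -cis_period subrK /cis acosK ?in_itv//= sin_acos//.
by rewrite -ab1 addrAC subrr add0r sqrtr_sqr gtr0_norm.
Qed.

(** The offset [t] is below one spacing, so the sample points with 2^m <= j < 2^(m+1) all lie in the
    dyadic arc k = K - 1 - m and supply its 2^m factors. The point j = 0 and those with j >= 2^K are
    only bounded by 1. *)
Lemma rotation_prod_bound (u : R -> R) (s K : nat) (b : nat -> R) (t : R) :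
    0 <= t < 2 * pi / 2 ^+ (s + K) ->
    (forall x, 0 <= u x) -> (forall x, u x <= 1) ->
    (forall k x, (k < K)%N -> 2 * pi / 2 ^+ (s + k.+1) <= x ->
       x <= 2 * pi / 2 ^+ (s + k) -> u x <= expR (- b k)) ->
  \prod_(j < 2 ^ (s + K)) u (t + 2 * pi * j%:R / 2 ^+ (s + K)) <=
  expR (- 2 ^+ (s + K) * \sum_(k < K) b k / 2 ^+ (s + k.+1)).
Proof.
move=> /andP[t0 tlt] u0 u1 ub.
set n := (2 ^ (s + K))%N; set v := fun j : nat => u (t + 2 * pi * j%:R / 2 ^+ (s + K)).
have v0 j : 0 <= v j by exact: u0.
have v1 j : v j <= 1 by exact: u1.
have P1 (r : seq nat) : \prod_(j <- r) v j <= 1.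
  by apply: prodr_ile1 => j _; rewrite v0 v1.
have P0 (r : seq nat) : 0 <= \prod_(j <- r) v j.
  by apply: prodr_ge0 => j _; exact: v0.
have step m : (m <= K)%N -> \prod_(1 <= j < 2 ^ m) v j <=
    expR (- 2 ^+ (s + K) * \sum_(K - m <= k < K) b k / 2 ^+ (s + k.+1)).
  elim: m => [|m IH] mK.
    by rewrite expn0 big_geq// subn0 big_geq// mulr0 expR0.
  have h1 : (1 <= 2 ^ m)%N by rewrite expn_gt0.
  have h2 : (2 ^ m <= 2 ^ m.+1)%N by rewrite leq_exp2l.
  rewrite (big_cat_nat h1 h2)/=.
  have -> : \sum_(K - m.+1 <= k < K) b k / 2 ^+ (s + k.+1) =
      b (K - m.+1)%N / 2 ^+ (s + (K - m)) + \sum_(K - m <= k < K) b k / 2 ^+ (s + k.+1).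
    by rewrite big_ltn ?subnSK//; clear -mK; lia.
  rewrite mulrDr expRD mulrC ler_pM ?P0//; last exact/IH/ltnW.
  have -> : - 2 ^+ (s + K) * (b (K - m.+1)%N / 2 ^+ (s + (K - m))) =
      (2 ^ m)%:R * (- b (K - m.+1)%N).
    have -> : (2 : R) ^+ (s + K) = 2 ^+ (s + (K - m)) * 2 ^+ m.
      by rewrite -exprD; congr (_ ^+ _); clear -mK; lia.
    have : (2 : R) ^+ (s + (K - m)) != 0 by rewrite expf_neq0.
    by move=> ?; rewrite natrX; field.
  have -> : expR ((2 ^ m)%:R * - b (K - m.+1)%N) =
     \prod_(2 ^ m <= j < 2 ^ m.+1) expR (- b (K - m.+1)%N).
    by rewrite prodr_const_nat -expRM_natl expnS mul2n -addnn addnK.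
  rewrite big_nat_cond [leRHS]big_nat_cond; apply: ler_prod => j; rewrite andbT => /andP[j1 j2].
  rewrite v0 /=; apply: ub; first by clear -mK; lia.
    have -> : (s + (K - m.+1).+1 = s + K - m)%N by clear -mK; lia.
    rewrite (_ : _ / _ = 2 * pi * (2 ^ m)%:R / 2 ^+ (s + K)); last first.
      have -> : (s + K = s + K - m + m)%N by clear -mK; lia.
      have n1 : (2 : R) ^+ (s + K - m) != 0 by rewrite expf_neq0.
      have n2 : (2 : R) ^+ m != 0 by rewrite expf_neq0.
      by rewrite addnK natrX exprD; field; rewrite ?n1 ?n2.
    rewrite ler_wpDl// ler_pM2r ?invr_gt0 ?exprn_gt0//.
    by rewrite ler_pM2l ?mulr_gt0 ?pi_gt0// ler_nat.
  have -> : (s + (K - m.+1) = s + K - m.+1)%N by clear -mK; lia.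
  rewrite [leRHS](_ : _ / _ = 2 * pi * (2 ^ m.+1)%:R / 2 ^+ (s + K)); last first.
    have -> : (s + K = s + K - m.+1 + m.+1)%N by clear -mK; lia.
    have n1 : (2 : R) ^+ (s + K - m.+1) != 0 by rewrite expf_neq0.
    have n2 : (2 : R) ^+ m.+1 != 0 by rewrite expf_neq0.
    rewrite addnK natrX (exprD _ (s + K - m.+1)); field.
    by rewrite ?n1 ?n2.
  apply: (@le_trans _ _ (2 * pi * j.+1%:R / 2 ^+ (s + K))).
    rewrite -(nat1r j) (mulrDr (2 * pi)) mulr1 mulrDl lerD2r; exact: ltW.
  rewrite ler_pM2r ?invr_gt0 ?exprn_gt0//.
  by rewrite ler_pM2l ?mulr_gt0 ?pi_gt0// ler_nat.
rewrite -(big_mkord xpredT v).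
have h2 : (2 ^ K <= 2 ^ (s + K))%N by rewrite leq_exp2l// leq_addl.
rewrite (big_cat_nat (leq0n _) h2)/=.
rewrite -[leRHS]mulr1 ler_pM ?P0//.
rewrite big_ltn ?expn_gt0// -[leRHS]mul1r ler_pM ?P0//.
have := step K (leqnn K); rewrite subnn big_mkord; exact.
Qed.

(* Rotating by the 2^(s+K)-th roots of unity turns the mean of log |F| over the
   circle into a finite product, in which the arc at dyadic distance k from 1
   contributes 2^(K-1-k) factors. *)
Lemma pdisc_jensen F (s K : nat) (b : nat -> R) : pdisc F ->
    (forall z, normc z = 1 -> normc (F z) <= 1) ->
    (forall k x, (k < K)%N -> 2 * pi / 2 ^+ (s + k.+1) <= x ->
       x <= 2 * pi / 2 ^+ (s + k) -> normc (F (cis (- x))) <= expR (- b k)) ->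
  normc (F 0) <= expR (- \sum_(k < K) b k / 2 ^+ (s + k.+1)).
Proof.
move=> pF F1 Fb; set n := (2 ^ (s + K))%N; set S := \sum_(_ < _) _.
have n0 : (0 < n)%N by rewrite expn_gt0.
have nR : n%:R = (2 : R) ^+ (s + K) by rewrite natrX.
pose u x := normc (F (cis (- x))).
have u0 x : 0 <= u x by exact: normc_ge0.
have u1 x : u x <= 1 by rewrite F1// normc_cis.
have up x : u (x + 2 * pi) = u x.
  by rewrite /u -(cis_period (- (x + _))) opprD subrK.
pose w := 2 * pi / 2 ^+ (s + K) : R.
have w0 : 0 < w by rewrite divr_gt0 ?exprn_gt0// mulr_gt0// pi_gt0.
pose E x := \prod_(j < n) u (x + 2 * pi * j%:R / 2 ^+ (s + K)).
have nw : w * n%:R = 2 * pi by rewrite nR divfK// expf_neq0.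
(* Turning by one spacing permutes the sample points cyclically, so offsets in [0, w) suffice. *)
have Ew x : E (x + w) = E x.
  rewrite /E -!(big_mkord xpredT (fun j => u (_ + 2 * pi * j%:R / 2 ^+ (s + K)))).
  rewrite -[in RHS](prednK n0) big_nat_recl// -{1}(prednK n0) big_nat_recr//=.
  rewrite [LHS]mulrC; congr (_ * _).
    rewrite -[RHS]up; congr u; rewrite mulr0 mul0r addr0 -addrA; congr (_ + _).
    have nE : n%:R = 1 + n.-1%:R :> R by rewrite nat1r prednK.
    rewrite -[RHS]nw nE (mulrDr w) mulr1.
    by congr (_ + _); rewrite /w; ring.
  apply: eq_bigr => j _; congr u.
  by rewrite -addrA; congr (_ + _); rewrite -(nat1r j) (mulrDr (2 * pi)) (mulrDl (2 * pi * 1)) mulr1.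
have En x m : E (x + w * m%:R) = E x.
  elim: m => [|m IH]; first by rewrite mulr0 addr0.
  by rewrite -(nat1r m) (mulrDr w) mulr1 [w + _]addrC addrA Ew IH.
have Eb x : 0 <= x -> E x <= expR (- (n%:R * S)).
  move=> x0; pose m := Num.truncn (x / w).
  have /andP[mx xm] : m%:R <= x / w < m.+1%:R.
    by apply: Num.Theory.truncn_itv; rewrite divr_ge0// ltW.
  have h : 0 <= x - w * m%:R < 2 * pi / 2 ^+ (s + K).
    rewrite subr_ge0 mulrC -ler_pdivlMr// mx/= ltrBlDr -/w.
    by rewrite -{1}(mul1r w) -mulrDl nat1r -ltr_pdivrMr.
  have := @rotation_prod_bound u s K b _ h u0 u1 Fb.
  by rewrite -[in E x](subrK (w * m%:R) x) En nR [- 2 ^+ _ * _]mulNr.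
(* At 0 all n rotated factors equal [F 0], so an n-th root ends the proof. *)
have : normc (\prod_(j < n) F (cis (- (2 * pi * j%:R / 2 ^+ (s + K))) * 0))
   <= expR (- (n%:R * S)).
  apply: (@pdisc_center _ (fun z =>
    \prod_(j < n) F (cis (- (2 * pi * j%:R / 2 ^+ (s + K))) * z))).
    by apply: pdisc_prod => j; apply: pdisc_scale => //; rewrite normc_cis.
  move=> z /unit_cisN[t t0 ->]; rewrite normc_prod.
  apply: le_trans (Eb t t0); rewrite le_eqVlt; apply/orP; left; apply/eqP.
  by apply: eq_bigr => j _; rewrite -cisD -opprD addrC.
under eq_bigr do rewrite mulr0.
rewrite prodr_const card_ord normcX -mulrN expRM_natl.
by rewrite ler_pXn2r ?nnegrE ?normc_ge0 ?expR_ge0.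
Qed.

End rotations.

(** * Differentiation under the integral and vanishing Poisson integrals *)

Section parameter_integrals.
Variable R : realType.

(** Differentiation under the integral sign and the mean value theorem. The parameter is the centre
    of a Poisson kernel in one use, a frequency inside a gap in the other. *)
Lemma Rintegral_param_cst (f df : R -> R -> R) (u v : R) (G : R -> R) :
    (forall s, u < s < v -> leb.-integrable setT (fun t => (f s t)%:E)) ->
    (forall s t, u < s < v -> is_derive s 1 (f ^~ t) (df s t)) ->
    leb.-integrable setT (fun t => (G t)%:E) ->
    (forall s t, u < s < v -> `|df s t| <= G t) ->
    (forall s, u < s < v -> Rintegral leb setT (df s) = 0) ->
  forall x y, u < x < v -> u < y < v ->
    Rintegral leb setT (f x) = Rintegral leb setT (f y).
Proof.
move=> If Df IG dfG df0 x y xuv yuv.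
pose F s := Rintegral leb setT (f s).
have FD s : u < s < v -> is_derive s 1 F 0.
  move=> suv.
  have Is : `]u, v[%classic s by rewrite /= in_itv.
  have If' z : `]u, v[%classic z -> leb.-integrable setT (EFin \o f z).
    by rewrite /= in_itv /= => /If.
  have d1 z t : `]u, v[%classic z -> setT t -> derivable (f ^~ t) z 1.
    by rewrite /= in_itv /= => /(Df z t)[].
  have G0 t : 0 <= `|G t| by [].
  have IG' : leb.-integrable setT (EFin \o (fun t => `|G t|)).
    exact: integrable_norm IG.
  have dE z t : `]u, v[%classic z -> partial1of2 f z t = df z t.
    by rewrite /= in_itv /= partial1of2E => /(Df z t)[].
  have Gub z t : `]u, v[%classic z -> setT t -> `|partial1of2 f z t| <= `|G t|.
    move=> zI _; have zuv : u < z < v by move: zI; rewrite /= in_itv.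
    by rewrite dE// (le_trans (dfG _ _ zuv))// ler_norm.
  apply: DeriveDef.
    exact: (derivable_under_integral measurableT Is If' d1 G0 IG' Gub).
  rewrite -derive1E.
  have -> := differentiation_under_integral measurableT Is If' d1 G0 IG' Gub.
  rewrite -[RHS](df0 s suv); apply: eq_Rintegral => t _; exact: dE.
wlog xy : x y xuv yuv / x < y.
  move=> W; have [xy|yx|->//] := ltgtP x y; first exact: W.
  by apply/esym; exact: W.
apply/eqP; rewrite eq_sym -subr_eq0; apply/eqP.
move: xuv yuv => /andP[ux xv] /andP[uy yv].
have [||c _ ->] := @MVT _ F (cst 0) _ _ xy.
- move=> z; rewrite in_itv/= => /andP[xz zy]; apply: FD.
  by rewrite (lt_trans ux xz) (lt_trans zy yv).
- apply: derivable_within_continuous => z; rewrite in_itv/= => /andP[xz zy].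
  have zuv : u < z < v by rewrite (lt_le_trans ux xz) (le_lt_trans zy yv).
  by have [] := FD z zuv.
- by rewrite mul0r.
Qed.

Lemma cvg_atan_sg (c : R) : (fun n => atan (c * n.+1%:R)) @ \oo --> Num.sg c * (pi / 2).
Proof.
have pos (x : R) : 0 < x -> (fun n => atan (x * n.+1%:R)) @ \oo --> pi / 2.
  move=> x0; apply: (cvg_comp _ _ _ (@cvgy_atan R)).
  apply/cvgryPge => A; near=> n.
  rewrite mulrC -ler_pdivrMr//.
  have : (A / x <= n%:R) by near: n; exact: nbhs_infty_ger.
  by move=> h; rewrite (le_trans h)// ler_nat.
have [c0|c0|->] := ltgtP c 0.
- rewrite ltr0_sg// mulN1r.
  have := pos (- c); rewrite oppr_gt0 => /(_ c0) h.
  rewrite (_ : (fun _ => _) = (fun n => - atan (- c * n.+1%:R))); last first.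
    by apply/funext => n; rewrite mulNr atanN opprK.
  exact: cvgN.
- by rewrite gtr0_sg// mul1r; exact: pos.
- rewrite sgr0 mul0r; under eq_fun do rewrite mul0r atan0.
  exact: cvg_cst.
Unshelve. all: by end_near. Qed.

Lemma measurable_atan : measurable_fun setT (@atan R).
Proof. by apply: continuous_measurable_fun => x; exact: continuous_atan. Qed.

Lemma atan_bound (x : R) : `|atan x| <= pi / 2.
Proof. by rewrite ler_norml ltW ?atan_gtNpi2// ltW// atan_ltpi2. Qed.

Lemma integrableM_bounded (k b : R -> R) (B : R) :
    integrableR k -> measurable_fun setT b ->
    (forall t, `|b t| <= B) -> leb.-integrable setT (fun t => (k t * b t)%:E).
Proof.
move=> ik mb bB.
have ikB : leb.-integrable setT (fun t => (`|k t| * B)%:E).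
  by under eq_fun do rewrite EFinM; apply: integrableZr => //; apply: integrable_norm ik.
apply: le_integrable ikB => //.
  apply/measurable_EFinP; apply: measurable_funM => //.
  by apply/measurable_EFinP; move/measurable_int: ik.
move=> t _ /=; rewrite lee_fin !normrM normr_id ler_wpM2l// (le_trans (bB t))//.
exact: ler_norm.
Qed.

Lemma Rintegral_dct (f_ : nat -> R -> R) (f G : R -> R) :
    (forall n, measurable_fun setT (f_ n)) ->
    (forall t, (fun n => f_ n t) @ \oo --> f t) ->
    leb.-integrable setT (fun t => (G t)%:E) ->
    (forall n t, `|f_ n t| <= G t) ->
  (fun n => Rintegral leb setT (f_ n)) @ \oo --> Rintegral leb setT f.
Proof.
move=> mf ff iG fG.
have mlim : measurable_fun setT f by apply: measurable_fun_cvg mf _ => t _; exact: ff.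
have [|||||int_f _ h] := @dominated_convergence _ _ R leb setT measurableT
  (fun n t => (f_ n t)%:E) (fun t => (f t)%:E) (fun t => (G t)%:E).
- by move=> n; apply/measurable_EFinP; exact: mf.
- by apply/measurable_EFinP; exact: mlim.
- apply: aeW => t _; apply: cvg_EFin; last exact: ff.
  exact: nearW.
- exact: iG.
- by apply: aeW => t n _; rewrite lee_fin.
- by apply: fine_cvg; rewrite fineK//; apply: integrable_fin_num.
Qed.

(** The Poisson kernel of height 1/c is the x-derivative of atan((x - t) c), so the integral of [k]
    against this arctangent does not depend on x. As c grows the arctangent tends to (pi/2) sg(x -
    t), which turns this into constancy of the primitive of [k]; Lebesgue's differentiation theorem
    concludes. *)
Lemma poisson_zero (k : R -> R) : integrableR k ->
    (forall x y : R, 0 < y <= 1 ->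
      Rintegral leb setT (fun t => k t * (y / ((t - x) ^+ 2 + y ^+ 2))) = 0) ->
  {ae leb, forall t, k t = 0}.
Proof.
move=> ik k0.
have atanI x x' (c : R) : 1 <= c ->
    Rintegral leb setT (fun t => k t * atan ((x - t) * c)) =
    Rintegral leb setT (fun t => k t * atan ((x' - t) * c)).
  move=> c1; have c0 : 0 < c by exact: lt_le_trans c1.
  have mat s : measurable_fun setT (fun t : R => atan ((s - t) * c)).
    apply: (measurableT_comp measurable_atan).
    by apply: measurable_funM => //; exact: measurable_funB.
  pose P s t := c^-1 / ((t - s) ^+ 2 + c^-1 ^+ 2).
  have P0 s t : 0 < (t - s) ^+ 2 + c^-1 ^+ 2.
    by rewrite ltr_wpDl ?sqr_ge0// exprn_gt0// invr_gt0.
  have Pc s t : `|P s t| <= c.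
    rewrite ger0_norm; last by rewrite divr_ge0 ?ltW// invr_gt0.
    rewrite ler_pdivrMr// mulrDr (_ : c * c^-1 ^+ 2 = c^-1); last first.
      by field; rewrite gt_eqF.
    by rewrite lerDr mulr_ge0 ?sqr_ge0// ltW.
  pose u := Num.min x x' - 1; pose v := Num.max x x' + 1.
  apply: (@Rintegral_param_cst (fun s t => k t * atan ((s - t) * c))
     (fun s t => k t * P s t) u v (fun t => `|k t| * c)).
  - move=> s _; apply: (@integrableM_bounded _ _ (pi / 2)) => // t.
    exact: atan_bound.
  - move=> s t _.
    have -> : P s t = (1 + ((s - t) * c) ^+ 2)^-1 * c.
      rewrite /P; have cn : c != 0 by rewrite gt_eqF.
      have n1 : (1 + ((s - t) * c) ^+ 2) != 0.
        by rewrite gt_eqF// ltr_pwDl// sqr_ge0.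
      have n2 : ((t - s) ^+ 2 + c^-1 ^+ 2) != 0 by rewrite gt_eqF.
      by field; rewrite cn n1 /=.
    have h1 : is_derive s 1 (fun s => (s - t) * c) c.
      by apply: is_derive_eq; rewrite /= scaler0 subr0 add0r /GRing.scale /= mulr1.
    have h2 : is_derive s 1 (fun s => atan ((s - t) * c))
        ((1 + ((s - t) * c) ^+ 2)^-1 * c).
      exact: (@is_derive1_comp _ (@atan R) (fun s => (s - t) * c)).
    exact: (@is_deriveZ _ _ _ _ (k t)).
  - by under eq_fun do rewrite EFinM; apply: integrableZr => //; apply: integrable_norm ik.
  - by move=> s t _; rewrite normrM ler_wpM2l.
  - by move=> s _; apply: k0; rewrite invr_gt0 c0 invf_le1.
  - by rewrite /u /v; have [h|h] := leP x x'; apply/andP; split; lra.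
  - by rewrite /u /v; have [h|h] := leP x x'; apply/andP; split; lra.
have sg_lim x : (fun n => Rintegral leb setT (fun t => k t * atan ((x - t) * n.+1%:R)))
    @ \oo --> Rintegral leb setT (fun t => k t * (Num.sg (x - t) * (pi / 2))).
  apply: (@Rintegral_dct _ _ (fun t => `|k t| * (pi / 2))).
  - move=> n; apply: measurable_funM.
      by apply/measurable_EFinP; move/measurable_int: ik.
    apply: (measurableT_comp measurable_atan).
    by apply: measurable_funM => //; exact: measurable_funB.
  - by move=> t; apply: cvgMr; exact: cvg_atan_sg.
  - by under eq_fun do rewrite EFinM; apply: integrableZr => //; apply: integrable_norm ik.
  - by move=> n t; rewrite normrM ler_wpM2l// atan_bound.
have sgI x x' : Rintegral leb setT (fun t => k t * (Num.sg (x - t) * (pi / 2))) =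
                Rintegral leb setT (fun t => k t * (Num.sg (x' - t) * (pi / 2))).
  apply: (cvg_unique (@Rhausdorff R) (sg_lim x)).
  rewrite (_ : (fun n => _) = (fun n : nat =>
    Rintegral leb setT (fun t => k t * atan ((x' - t) * n.+1%:R)))); last first.
    by apply/funext => n; apply: atanI; rewrite ler1n.
  exact: sg_lim.
pose F x := Rintegral leb `]-oo, x] k.
(* Except at t = x, pi times the indicator of ]-oo, x] minus pi/2 equals (pi/2) sg(x - t). *)
have FE x : pi * F x - pi / 2 * Rintegral leb setT k =
    Rintegral leb setT (fun t => k t * (Num.sg (x - t) * (pi / 2))).
  have mI : measurable (`]-oo, x]%classic : set (measurableTypeR R)) by [].
  have ikF : leb.-integrable setT (fun t => ((k \_ `]-oo, x]) t)%:E).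
    have := integrableS measurableT mI (@subsetT _ _) ik.
    move=> /(integrable_mkcond _ mI) h.
    by rewrite -[X in leb.-integrable _ X]/(EFin \o (k \_ `]-oo, x])) -restrict_EFin.
  have i1 (r : R) : leb.-integrable setT (fun t => (r * (k \_ `]-oo, x]) t)%:E).
    by under eq_fun do rewrite EFinM; apply: integrableZl.
  have i2 (r : R) : leb.-integrable setT (fun t => (r * k t)%:E).
    by under eq_fun do rewrite EFinM; apply: integrableZl.
  rewrite /F Rintegral_mkcond -!RintegralZl// -RintegralB//; [|exact: i1|exact: i2].
  congr fine; apply: ae_eq_integral => //.
  - apply/measurable_EFinP; apply: measurable_funB; apply/measurable_EFinP.
      by move/measurable_int: (i1 pi).
    by move/measurable_int: (i2 (pi / 2)).
  - apply/measurable_EFinP; apply: measurable_funM.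
      by apply/measurable_EFinP; move/measurable_int: ik.
    apply: measurable_funM => //.
    apply: (@measurable_fun_cvg _ _ R setT
      (fun (n : nat) (t : R) => atan ((x - t) * n.+1%:R) / (pi / 2))
      (fun t : R => Num.sg (x - t))).
      move=> n; apply: measurable_funM => //.
      apply: (measurableT_comp measurable_atan).
      by apply: measurable_funM => //; exact: measurable_funB.
    move=> t _; rewrite -[X in _ --> X](mulfK (_ : pi / 2 != 0)); last first.
      by rewrite gt_eqF// divr_gt0 ?pi_gt0.
    by apply: cvgMl; exact: cvg_atan_sg.
  - exists [set x]; split => //; first exact: lebesgue_measure_set1.
    move=> t /= h; apply: contrapT => tx; apply: h => _; congr EFin.
    rewrite /restrict; case: ifPn => [/set_mem|/negP tx'].
      rewrite /= in_itv/= => tx'; rewrite gtr0_sg; first by field.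
      by rewrite subr_gt0 lt_neqAle tx' andbT; apply/eqP.
    have {}tx' : x < t.
      by rewrite ltNge; apply/negP => h; apply: tx'; rewrite inE/= in_itv.
    by rewrite ltr0_sg ?subr_lt0// -[point]/(0 : R); field.
have Fcst x : F x = F 0.
  have := sgI x 0; rewrite -!FE => /addIr /mulfI; apply.
  by rewrite gt_eqF// pi_gt0.
have ikI y : leb.-integrable `]-oo, y] (EFin \o k).
  by apply: (integrableS measurableT) => //; exact: ik.
have locf : locally_integrable [set: R] k.
  by apply: open_integrable_locally => //; exact: openT.
have [N [mN N0 kN]] := FTC1Ny ikI locf; exists N; split => // t nk.
apply: kN => -[_ Fk]; apply: nk; apply: etrans (esym Fk) _.
suff -> : (fun x => Rintegral leb `]-oo, x] k) = cst (F 0) by rewrite derive1_cst.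
by apply/funext => y; exact: Fcst.
Qed.

End parameter_integrals.

(** * Cauchy transforms and spectral gaps *)

Section cauchy_transform.
Variable R : realType.
Implicit Types (h : R -> R[i]) (w : R[i]).

Definition cauchy h w := complex_integral (fun t => h t / (t%:C - w)).

Lemma normc_sub_Im (t : R) w : `|Im w| <= normc (t%:C - w).
Proof. by rewrite (le_trans _ (normc_Im _))//; case: w => x y /=; rewrite add0r normrN. Qed.

Lemma cauchy_kernel_neq0 (t : R) w : Im w != 0 -> t%:C - w != 0.
Proof. by move=> w0; rewrite -normc_gt0 (lt_le_trans _ (normc_sub_Im t w))// normr_gt0. Qed.

Lemma cauchy_kernel_le (t : R) w : Im w != 0 ->
  normc (t%:C - w)^-1 <= `|Im w|^-1.
Proof.
move=> w0; rewrite normcV lef_pV2 ?posrE ?normc_gt0 ?cauchy_kernel_neq0 ?normr_gt0//.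
exact: normc_sub_Im.
Qed.

Lemma cauchy_kernel_measurable w : cmeasurable (fun t : R => (t%:C - w)^-1).
Proof.
apply: cmeasurableV; apply: cmeasurableD; last exact: cmeasurable_cst.
exact: cmeasurable_real.
Qed.

Lemma cintegrable_cauchy h w : cintegrable h -> Im w != 0 ->
  cintegrable (fun t => h t / (t%:C - w)).
Proof.
move=> ih w0; apply: (cintegrableM ih (cauchy_kernel_measurable w)) => t.
exact: cauchy_kernel_le.
Qed.

(* [expi_shift w s t] is exp(i s (w - t)). *)
Definition expi_shift w (s t : R) : R[i] :=
  (expR (- (s * Im w)))%:C * cis (s * (Re w - t)).

Lemma expi_shiftE w s t : expi_shift w s t =
  (expR (- (s * Im w)))%:C * cis (s * Re w) * cis (- (s * t)).
Proof. by rewrite /expi_shift mulrBr cisD mulrA. Qed.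

Lemma normc_expi_shift w s t : normc (expi_shift w s t) = expR (- (s * Im w)).
Proof. by rewrite normcM normc_cis mulr1 normc_real gtr0_norm// expR_gt0. Qed.

Lemma measurable_expi_shift w s : cmeasurable (expi_shift w s).
Proof.
apply: cmeasurableM; first exact: cmeasurable_cst.
by apply: cmeasurable_cis; apply: measurable_funM => //; exact: measurable_funB.
Qed.

Lemma cintegrable_expi h w s : cintegrable h -> Im w != 0 ->
  cintegrable (fun t => h t / (t%:C - w) * expi_shift w s t).
Proof.
move=> ih w0.
apply: (cintegrableM (cintegrable_cauchy ih w0) (measurable_expi_shift w s)) => t.
by rewrite normc_expi_shift.
Qed.

(* The zeros are the imaginary part of a real factor, in the shape left by
   computing the real part of a complex product. *)
Lemma is_derive_gap (a b x y t r : R) : is_derive r 1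
  (fun s => a * (expR (- (s * y)) * cos (s * (x - t)) - 0 * sin (s * (x - t))) -
     b * (expR (- (s * y)) * sin (s * (x - t)) + 0 * cos (s * (x - t))))
  (- 0 *
     ((a * (t - x) - b * (0 - y)) *
      (expR (- (r * y)) * cos (r * (x - t)) - 0 * sin (r * (x - t))) -
      (a * (0 - y) + b * (t - x)) *
      (expR (- (r * y)) * sin (r * (x - t)) + 0 * cos (r * (x - t)))) -
     -1 *
     ((a * (t - x) - b * (0 - y)) *
      (expR (- (r * y)) * sin (r * (x - t)) + 0 * cos (r * (x - t))) +
      (a * (0 - y) + b * (t - x)) *
      (expR (- (r * y)) * cos (r * (x - t)) - 0 * sin (r * (x - t))))).
Proof.
have E : is_derive r 1 (fun s => expR (- (s * y))) (expR (- (r * y)) * (- y)).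
  apply: (@is_derive1_comp _ expR (fun s => - (s * y))).
  by apply: is_derive_eq; rewrite /= scaler0 add0r /GRing.scale /= mulr1.
have L : is_derive r 1 (fun s : R => s * (x - t)) (x - t).
  by apply: is_derive_eq; rewrite /= scaler0 add0r /GRing.scale /= mulr1.
have C : is_derive r 1 (fun s => cos (s * (x - t))) (- sin (r * (x - t)) * (x - t)).
  exact: (@is_derive1_comp _ (@cos R) (fun s => s * (x - t))).
have S : is_derive r 1 (fun s => sin (s * (x - t))) (cos (r * (x - t)) * (x - t)).
  exact: (@is_derive1_comp _ (@sin R) (fun s => s * (x - t))).
rewrite (_ : (fun s => _) = (fun s => a * (expR (- (s * y)) * cos (s * (x - t))) -
     b * (expR (- (s * y)) * sin (s * (x - t))))); last by apply/funext => s; ring.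
apply: is_derive_eq; rewrite /GRing.scale /=; ring.
Qed.

(* The integral of h(t) exp(is(w - t)) / (t - w) is constant in s on the gap: its
   derivative in s is, up to a factor, the vanishing Fourier transform of h. *)
Lemma Re_gap_cst h w (u v s : R) : cintegrable h -> Im w != 0 ->
    (forall r, u < r < v -> complex_integral (fun t => h t * cis (- (r * t))) = 0) ->
  u < 0 < v -> u < s < v ->
  Re (cauchy h w) =
  Re (complex_integral (fun t => h t / (t%:C - w) * expi_shift w s t)).
Proof.
move=> ih w0 gap uv0 usv.
pose f s t := Re (h t / (t%:C - w) * expi_shift w s t).
pose c (s : R) : R[i] := - (Complex 0 1) * ((expR (- (s * Im w)))%:C * cis (s * Re w)).
pose df s t := Re (c s * (h t * cis (- (s * t)))).
have cE r t : c r * (h t * cis (- (r * t))) = - (Complex 0 1) * (h t * expi_shift w r t).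
  by rewrite /c expi_shiftE; ring.
have ihs r : cintegrable (fun t => h t * cis (- (r * t))).
  apply: (@cintegrableM _ _ _ 1) => //; last by move=> t; rewrite normc_cis.
  by apply: cmeasurable_cis; apply: measurable_funN; exact: measurable_funM.
have <- : Rintegral leb setT (f 0) = Re (cauchy h w).
  congr fine; apply: eq_integral => t _; rewrite /f expi_shiftE.
  by rewrite !mul0r oppr0 expR0 cis0 !mulr1.
apply: (@Rintegral_param_cst _ f df u v
  (fun t => normc (h t) * expR ((v - u) * `|Im w|))) => //.
- by move=> r _; have [] := cintegrable_expi r ih w0.
- move=> r t _; rewrite /df cE /f.
  have -> : h t = h t / (t%:C - w) * (t%:C - w) by rewrite divfK// cauchy_kernel_neq0.
  rewrite mulfK ?cauchy_kernel_neq0//.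
  case: (h t / _) => a b; rewrite /expi_shift; case: w {w0 ih uv0 usv gap f c df cE ihs} => x y /=.
  exact: is_derive_gap.
- under eq_fun do rewrite EFinM; apply: integrableZr => //; exact: cintegrable_normc.
- move=> r t /andP[ur rv]; rewrite /df cE (le_trans (normc_Re _))//.
  have -> : normc (- (Complex 0 1) * (h t * expi_shift w r t)) = normc (h t * expi_shift w r t).
    by rewrite normcM normcN /= expr0n expr1n add0r sqrtr1 mul1r.
  rewrite normcM normc_expi_shift ler_wpM2l ?normc_ge0// ler_expR.
  rewrite (le_trans (ler_norm _))// normrN normrM ler_wpM2r//.
  by move/andP: uv0 => [u0 v0]; rewrite ler_norml; apply/andP; split; lra.
- move=> r /gap g0.
  rewrite -[LHS]/(Re (complex_integral (fun t => c r * (h t * cis (- (r * t)))))).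
  by rewrite complex_integralZ// g0 mulr0.
Qed.

Lemma cauchy_gap h w (u v s : R) : cintegrable h -> Im w != 0 ->
    (forall r, u < r < v -> complex_integral (fun t => h t * cis (- (r * t))) = 0) ->
  u < 0 < v -> u < s < v ->
  normc (cauchy h w) <=
  2 * Rintegral leb setT (fun t => normc (h t)) * `|Im w|^-1 * expR (- (s * Im w)).
Proof.
move=> ih w0 gap uv0 usv.
have -> : cauchy h w = complex_integral (fun t => h t / (t%:C - w) * expi_shift w s t).
  (* Multiplication by -i turns imaginary parts into real parts, so [Re_gap_cst] yields both
     components. *)
  pose h' t := - (Complex 0 1) * h t.
  have ih' : cintegrable h' by exact: cintegrableZ.
  have gap' r : u < r < v -> complex_integral (fun t => h' t * cis (- (r * t))) = 0.
    move=> /gap g0; under eq_fun do rewrite /h' -mulrA.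
    rewrite complex_integralZ ?g0 ?mulr0//.
    apply: (@cintegrableM _ _ _ 1) => //; last by move=> t; rewrite normc_cis.
    by apply: cmeasurable_cis; apply: measurable_funN; exact: measurable_funM.
  have e1 := Re_gap_cst ih w0 gap uv0 usv.
  have e2 := Re_gap_cst ih' w0 gap' uv0 usv.
  have ReN z : Re (- (Complex 0 1) * z) = Im z.
    by case: z => a b /=; ring.
  move: e2; rewrite /cauchy.
  under eq_fun do rewrite /h' -mulrA.
  under [in RHS]eq_fun do rewrite /h' -!mulrA.
  rewrite !complex_integralZ; last 2 first.
  - by under eq_fun do rewrite mulrA; exact: cintegrable_expi.
  - exact: cintegrable_cauchy.
  rewrite !ReN; under [in RHS]eq_fun do rewrite mulrA.
  move=> e2; apply/eqP; rewrite eq_complex; apply/andP; split; apply/eqP => //.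
rewrite -!mulrA; apply: le_trans (complex_integral_le (m := fun t => normc (h t) *
    (`|Im w|^-1 * expR (- (s * Im w)))) _ _ _) _.
- exact: cintegrable_expi.
- by under eq_fun do rewrite EFinM; apply: integrableZr => //; exact: cintegrable_normc.
- move=> t; rewrite normcM normc_expi_shift normcM -mulrA ler_wpM2l ?normc_ge0//.
  by rewrite ler_wpM2r ?expR_ge0// cauchy_kernel_le.
- by rewrite RintegralZr//; exact: cintegrable_normc.
Qed.

(** The jump of the Cauchy transform between x + iy and x - iy is a multiple of the Poisson integral
    at height y, so [poisson_zero] applies to both components of [h]. *)
Lemma cauchy_eq0 h : cintegrable h ->
    (forall w, 0 < `|Im w| <= 1 -> cauchy h w = 0) ->
  {ae leb, forall t, h t = 0}.
Proof.
move=> ih c0.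
have pois (x y : R) : 0 < y <= 1 ->
    complex_integral (fun t => h t * (y / ((t - x) ^+ 2 + y ^+ 2))%:C) = 0.
  move=> /andP[y0 yle1].
  have y1 : Im (x +i* y) != 0 by rewrite /= gt_eqF.
  have y2 : Im (x -i* y) != 0 by rewrite /= oppr_eq0 gt_eqF.
  have i1 := cintegrable_cauchy ih y1.
  have i2 := cintegrable_cauchy ih y2.
  (* The kernels at w and its conjugate differ by 2iy / |t - w|^2; the factor -i/2 normalizes this
     to the Poisson kernel. *)
  pose c : R[i] := Complex 0 (- 2^-1).
  transitivity (c * cauchy h (x +i* y) + (- c) * cauchy h (x -i* y)); last first.
    by rewrite !c0/= ?normrN ?normr_gt0 ?gtr0_norm ?y0// ?gt_eqF//; ring.
  rewrite /cauchy -!complex_integralZ// -complex_integralD; try exact: cintegrableZ.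
  congr complex_integral; apply/funext => t.
  rewrite !(mulrCA _ (h t)) -mulrDr; congr (_ * _).
  have n0 : (t - x) ^+ 2 + y ^+ 2 != 0 by rewrite gt_eqF// ltr_wpDl ?sqr_ge0// exprn_gt0.
  rewrite /real_complex_def /c /=.
  by congr (_ +i* _); field; rewrite ?sqrrN ?n0.
have hpois (k : R -> R) : integrableR k ->
    (forall x y : R, 0 < y <= 1 ->
      Rintegral leb setT (fun t => k t * (y / ((t - x) ^+ 2 + y ^+ 2))) = 0) ->
    {ae leb, forall t, k t = 0} := @poisson_zero R k.
case: ih => /hpois h1 /hpois h2.
have {}h1 : {ae leb, forall t, Re (h t) = 0}.
  apply: h1 => x y y0; rewrite -[RHS](congr1 (@Re R) (pois x y y0)).
  rewrite /complex_integral /=; congr Rintegral; apply/funext => t.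
  by case: (h t) => a b /=; rewrite mulr0 subr0.
have {}h2 : {ae leb, forall t, Im (h t) = 0}.
  apply: h2 => x y y0; rewrite -[RHS](congr1 (@Im R) (pois x y y0)).
  rewrite /complex_integral /=; congr Rintegral; apply/funext => t.
  by case: (h t) => a b /=; rewrite mulr0 add0r.
have [N1 [mN1 N10 hN1]] := h1; have [N2 [mN2 N20 hN2]] := h2.
exists (N1 `|` N2); split; first exact: measurableU.
  by rewrite null_set_setU.
move=> t ht; apply: contrapT => /not_orP[t1 t2]; apply: ht.
apply/eqP; rewrite eq_complex; apply/andP; split; apply/eqP.
  by apply: contrapT => e; apply: t1; exact: hN1.
by apply: contrapT => e; apply: t2; exact: hN2.
Qed.

(** Here the gap is the whole line, so in [cauchy_gap] the frequency s may be arbitrarily large with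
    the sign of Im w, and the Cauchy transform vanishes. *)
Lemma fourier_eq0 h : cintegrable h ->
    (forall r : R, complex_integral (fun t => h t * cis (- (r * t))) = 0) ->
  {ae leb, forall t, h t = 0}.
Proof.
move=> ih h0; apply: cauchy_eq0 => // w /andP[w0 _].
have wn0 : Im w != 0 by rewrite -normr_gt0.
set A := 2 * Rintegral leb setT (fun t => normc (h t)) * `|Im w|^-1.
have A0 : 0 <= A.
  rewrite mulr_ge0 ?invr_ge0// mulr_ge0//.
  by apply: Rintegral_ge0 => t _; exact: normc_ge0.
apply/eqP; rewrite -normc_eq0; apply/eqP/le_anti; rewrite normc_ge0 andbT.
apply/ler_addgt0Pr => e e0; rewrite add0r.
(* Then exp(n |Im w|) >= 1 + A / e, which brings A exp(-n |Im w|) below [e]. *)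
pose n := A / (e * `|Im w|).
have n0 : 0 <= n by rewrite divr_ge0// mulr_ge0// ltW.
pose s := n * Num.sg (Im w).
have sn : `|s| <= n by rewrite normrM normr_sg wn0 mulr1 ger0_norm.
have := @cauchy_gap h w (- n - 1) (n + 1) s ih wn0 (fun r _ => h0 r).
move: sn; rewrite ler_norml => /andP[s1 s2].
move=> /(_ ltac:(apply/andP; split; lra) ltac:(apply/andP; split; lra)) h1.
apply: (le_trans h1); rewrite -/A.
have -> : s * Im w = n * `|Im w|.
  by rewrite /s -mulrA; congr (_ * _); rewrite [in RHS]normrEsg.
rewrite expRN ler_pdivrMr ?expR_gt0//.
apply: le_trans (_ : e * (1 + n * `|Im w|) <= _); last first.
  by rewrite ler_pM2l// expR_ge1Dx.
rewrite mulrDr mulr1 /n.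
rewrite (_ : e * (A / (e * `|Im w|) * `|Im w|) = A) ?lerDr ?ltW//.
by field; rewrite normr_eq0 wn0 gt_eqF.
Qed.

Lemma cauchyJ h w : cintegrable h -> Im w != 0 ->
  conjc (cauchy h w) = cauchy (fun t => conjc (h t)) (conjc w).
Proof.
move=> ih w0; have [_ i2] := cintegrable_cauchy ih w0.
have E t : conjc (h t) / (t%:C - conjc w) = conjc (h t / (t%:C - w)).
  rewrite rmorphM fmorphV rmorphB; congr (_ / (_ - _)).
  by apply/eqP; rewrite eq_complex /= oppr0 !eqxx.
rewrite /cauchy; under [in RHS]eq_fun do rewrite E.
rewrite /complex_integral /=; congr (_ +i* _).
  by congr Rintegral; apply/funext => t; case: (_ / _).
rewrite -mulN1r -RintegralZl//.
by congr Rintegral; apply/funext => t; case: (_ / _) => a b /=; rewrite mulN1r.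
Qed.

End cauchy_transform.

(** * Truncated Cauchy transforms *)

Section truncated_cauchy.
Variable R : realType.
Implicit Types (h : R -> R[i]) (w z : R[i]).

Definition tail_mass h (x : R) :=
  Rintegral leb setT (fun t => if t <= x then 0 else normc (h t)).

Definition total_mass h := Rintegral leb setT (fun t => normc (h t)).

Definition cutoff (X : R) h (t : R) : R[i] := if t <= X then h t else 0.

Lemma measurable_le (X : R) : measurable_fun setT (fun t : R => t <= X).
Proof. exact: measurable_fun_ler. Qed.

Lemma cutoff_cmeasurable X h : cmeasurable h -> cmeasurable (cutoff X h).
Proof.
move=> [h1 h2]; split.
  rewrite (_ : (fun t => _) = (fun t => if t <= X then Re (h t) else 0)).
    by apply: measurable_fun_ifT => //; exact: measurable_le.
  by apply/funext => t; rewrite /cutoff; case: ifP.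
rewrite (_ : (fun t => _) = (fun t => if t <= X then Im (h t) else 0)).
  by apply: measurable_fun_ifT => //; exact: measurable_le.
by apply/funext => t; rewrite /cutoff; case: ifP.
Qed.

Lemma cutoff_cintegrable X h : cintegrable h -> cintegrable (cutoff X h).
Proof.
move=> ih; apply: (cintegrable_le _ (cintegrable_normc ih)).
  by apply: cutoff_cmeasurable; exact: cintegrable_cmeasurable.
by move=> t; rewrite /cutoff; case: ifP => // _; rewrite normc0 normc_ge0.
Qed.

Lemma tail_integrable X h : cintegrable h ->
  leb.-integrable setT (fun t => (if t <= X then 0 else normc (h t))%:E).
Proof.
move=> ih.
have := cintegrableD ih (cintegrableZ (-1) (cutoff_cintegrable X ih)).
move=> /cintegrable_normc; apply: eq_integrable => // t _; congr EFin.
by rewrite /cutoff; case: ifP => _; rewrite ?mulN1r ?subrr ?normc0// oppr0 addr0.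
Qed.

Lemma tail_mass_ge0 X h : 0 <= tail_mass h X.
Proof. by apply: Rintegral_ge0 => t _; case: ifP => // _; exact: normc_ge0. Qed.

Lemma tail_mass_le X h : cintegrable h -> tail_mass h X <= total_mass h.
Proof.
move=> ih; apply: le_Rintegral => //.
- exact: tail_integrable.
- exact: cintegrable_normc.
- by move=> t _; case: ifP => // _; exact: normc_ge0.
Qed.

Lemma total_mass_ge0 h : 0 <= total_mass h.
Proof. by apply: Rintegral_ge0 => t _; exact: normc_ge0. Qed.

Lemma cauchy_le h w : cintegrable h -> Im w != 0 ->
  normc (cauchy h w) <= 2 * total_mass h / `|Im w|.
Proof.
move=> ih w0; rewrite /cauchy -mulrA.
apply: le_trans (complex_integral_le (m := fun t => normc (h t) * `|Im w|^-1) _ _ _) _.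
- exact: cintegrable_cauchy.
- by under eq_fun do rewrite EFinM; apply: integrableZr => //; exact: cintegrable_normc.
- by move=> t; rewrite normcM ler_wpM2l ?normc_ge0// cauchy_kernel_le.
- by rewrite RintegralZr//; exact: cintegrable_normc.
Qed.

Lemma cauchy_cutoff h X w : cintegrable h -> Im w != 0 ->
  normc (cauchy h w - cauchy (cutoff X h) w) <= 2 * tail_mass h X / `|Im w|.
Proof.
move=> ih w0.
pose g t := h t + (-1) * cutoff X h t.
have ig : cintegrable g.
  by apply: cintegrableD => //; apply: cintegrableZ; exact: cutoff_cintegrable.
have -> : cauchy h w - cauchy (cutoff X h) w = cauchy g w.
  rewrite /cauchy -[X in _ + X = _]mulN1r -complex_integralZ; last first.
    by apply: cintegrable_cauchy => //; exact: cutoff_cintegrable.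
  rewrite -complex_integralD; first last.
  - by apply: cintegrableZ; apply: cintegrable_cauchy => //; exact: cutoff_cintegrable.
  - exact: cintegrable_cauchy.
  by congr complex_integral; apply/funext => t; rewrite /g mulrDl -mulrA.
apply: le_trans (cauchy_le ig w0) _.
rewrite -!mulrA ler_pM2l// ler_wpM2r ?invr_ge0//.
rewrite le_eqVlt; apply/orP; left; apply/eqP; congr Rintegral; apply/funext => t.
by rewrite /g /cutoff; case: ifP => _; rewrite ?mulN1r ?subrr ?normc0// oppr0 addr0.
Qed.

Lemma cutoff_away h X z (d : R) : cintegrable h -> 0 < d -> X + d <= Re z ->
  normc (cauchy (cutoff X h) z) <= 2 * total_mass h / d.
Proof.
move=> ih d0 zX; rewrite -mulrA.
have dist (t : R) : t <= X -> d <= normc (t%:C - z).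
  move=> tX; rewrite (le_trans _ (normc_Re _))//.
  by case: z zX => x y /= zX; rewrite ler_normr; apply/orP; right; lra.
have bd t : normc (cutoff X h t / (t%:C - z)) <= normc (h t) * d^-1.
  rewrite /cutoff; case: ifP => tX; last by rewrite mul0r normc0 mulr_ge0 ?normc_ge0// invr_ge0 ltW.
  have dt := dist _ tX; have t0 : 0 < normc (t%:C - z) by exact: lt_le_trans dt.
  by rewrite normcM normcV ler_wpM2l ?normc_ge0// lef_pV2.
have im : leb.-integrable setT (fun t => (normc (h t) * d^-1)%:E).
  by under eq_fun do rewrite EFinM; apply: integrableZr => //; exact: cintegrable_normc.
apply: le_trans (complex_integral_le (m := fun t => normc (h t) * d^-1) _ im bd) _.
  apply: (cintegrable_le _ im bd); apply: cmeasurableM.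
    by apply: cutoff_cmeasurable; exact: cintegrable_cmeasurable.
  exact: cauchy_kernel_measurable.
by rewrite RintegralZr//; exact: cintegrable_normc.
Qed.

(** The factor 1/(t - w) is taken out of the kernel. The centre is at distance at least 2r from the
    retained support, so the remaining ratio r/(t - w) has modulus at most 1/2; the cutoff in [b]
    extends this bound to t > X, where the numerator vanishes. *)
Lemma cutoff_pdisc h X w (r : R) : cintegrable h -> 0 < r ->
  X + 2 * r <= Re w ->
  pdisc (fun z => cauchy (cutoff X h) (w + r%:C * z)).
Proof.
move=> ih r0 wX.
have dist (t : R) : t <= X -> 2 * r <= normc (t%:C - w).
  move=> tX; rewrite (le_trans _ (normc_Re _))//.
  by case: w wX => x y /= wX; rewrite ler_normr; apply/orP; right; lra.
pose a t := cutoff X h t / (t%:C - w).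
pose b := cutoff X (fun t => r%:C / (t%:C - w)).
have ia : cintegrable a.
  apply: (@cintegrable_le _ _ (fun t => normc (h t) * (2 * r)^-1)).
  - apply: cmeasurableM; last exact: cauchy_kernel_measurable.
    by apply: cutoff_cmeasurable; exact: cintegrable_cmeasurable.
  - by under eq_fun do rewrite EFinM; apply: integrableZr => //; exact: cintegrable_normc.
  - move=> t; rewrite /a /cutoff; case: ifP => tX; last first.
      by rewrite mul0r normc0 mulr_ge0 ?normc_ge0// invr_ge0 mulr_ge0// ltW.
    have dt := dist _ tX; have t0 : 0 < normc (t%:C - w).
      by apply: lt_le_trans dt; rewrite mulr_gt0.
    by rewrite normcM normcV ler_wpM2l ?normc_ge0// lef_pV2// posrE mulr_gt0.
have mb : cmeasurable b.
  apply: cutoff_cmeasurable; apply: cmeasurableM; first exact: cmeasurable_cst.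
  exact: cauchy_kernel_measurable.
have bb t : normc (b t) <= 2^-1.
  rewrite /b /cutoff; case: ifP => tX; last by rewrite normc0 invr_ge0.
  have dt := dist _ tX; have t0 : 0 < normc (t%:C - w).
    by apply: lt_le_trans dt; rewrite mulr_gt0.
  rewrite normcM normcV normc_real gtr0_norm// ler_pdivrMr//; lra.
apply: pdisc_ext (pdisc_cauchy ia mb bb _); last by lra.
move=> z z1; rewrite /cauchy; congr complex_integral; apply/funext => t.
rewrite /a /b /cutoff; case: ifP => tX; last by rewrite !mul0r.
have dt := dist _ tX; have t0 : 0 < normc (t%:C - w).
  by apply: lt_le_trans dt; rewrite mulr_gt0.
have n0 : t%:C - w != 0 by rewrite -normc_gt0.
have n1 : t%:C - (w + r%:C * z) != 0.
  rewrite opprD addrA -normc_gt0 (lt_le_trans _ (le_normcB _ _))// subr_gt0.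
  rewrite normcM normc_real gtr0_norm// (le_lt_trans (y := r))//.
    by rewrite ler_piMr// ltW.
  by rewrite (lt_le_trans _ dt)//; lra.
rewrite -mulrA -invfM; congr (_ / _).
by rewrite mulrBr mulr1 mulrA [_ * (r%:C / _)]mulrC divfK// opprD addrA.
Qed.

End truncated_cauchy.

(** * Decay of the Cauchy transform far to the right *)

Section cauchy_decay.
Variable R : realType.
Implicit Types (h : R -> R[i]) (w z : R[i]).

Lemma cauchy_gap_sym h w (a : R) : cintegrable h -> Im w != 0 -> 0 < a ->
    (forall r, - a < r < a -> complex_integral (fun t => h t * cis (- (r * t))) = 0) ->
  normc (cauchy h w) <=
  2 * total_mass h / `|Im w| * expR (- (a / 2 * `|Im w|)).
Proof.
move=> ih w0 a0 gap.
pose s := a / 2 * Num.sg (Im w).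
have sa : `|s| = a / 2 by rewrite normrM normr_sg w0 mulr1 ger0_norm// divr_ge0// ltW.
have /andP[s1 s2] : - (a / 2) <= s <= a / 2 by rewrite -ler_norml sa.
have := @cauchy_gap _ h w (- a) a s ih w0 gap _ _.
have -> : s * Im w = a / 2 * `|Im w|.
  by rewrite /s -mulrA; congr (_ * _); rewrite [in RHS]normrEsg.
by apply; apply/andP; split; lra.
Qed.

Definition ci : R[i] := Complex 0 1.

Lemma normc_ciX n : normc (ci ^+ n) = 1.
Proof. by rewrite normcX /= expr0n expr1n add0r sqrtr1 expr1n. Qed.

(* The part of the Cauchy transform carried by ]-oo, X] is analytic on the disc of
   radius X/2 around w. Of the four points w + (X/2) i^j z, two opposite ones are far
   from the real axis, where the gap makes it O(tau); the maximum principle for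
   the product of the four rotations turns this into O(sqrt tau) at w. *)
Lemma cauchy_decay h (a eta X tau : R) w : cintegrable h -> 0 < a ->
    (forall r, - a < r < a -> complex_integral (fun t => h t * cis (- (r * t))) = 0) ->
    0 < eta -> 1 <= X -> 2 * X <= Re w ->
    eta <= Im w <= X / 10 ->
    tail_mass h X <= tau -> expR (- (a * X / 8)) <= tau -> tau <= total_mass h + 1 ->
  normc (cauchy h w) <= (total_mass h + 1) * (6 + 2 / eta) * Num.sqrt tau.
Proof.
move=> ih a0 gap eta0 X1 wX /andP[w1 w2] tX eX tauI.
set I := total_mass h in tauI *.
have I0 : 0 <= I by exact: total_mass_ge0.
have tau0 : 0 < tau by apply: lt_le_trans eX; exact: expR_gt0.
set r := X / 2.
have r0 : 0 < r by rewrite /r; lra.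
have T0 := tail_mass_ge0 X h.
pose F z := cauchy (cutoff X h) (w + r%:C * z).
have Fd : pdisc F by apply: cutoff_pdisc => //; rewrite /r; lra.
have Rez z : normc z = 1 -> X + X / 2 <= Re (w + r%:C * z).
  move=> z1; have := normc_Re z; rewrite z1 ler_norml => /andP[+ _].
  case: z {z1} => x y /=; case: (w) wX => p q /= wX hx; rewrite mul0r subr0.
  by rewrite /r; nra.
have Fany z : normc z = 1 -> normc (F z) <= 4 * (I + 1).
  move=> z1; apply: le_trans (cutoff_away ih _ (Rez z z1)) _; first lra.
  by rewrite ler_pdivrMr ?divr_gt0//; [rewrite -/I; nra|lra].
have Fgood z : normc z = 1 -> 2^-1 <= Im z ^+ 2 ->
    normc (F z) <= 8 * (I + 1) * tau.
  move=> z1 zi; set v := w + r%:C * z.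
  (* From |Im z| >= 7/10 one has r |Im z| >= 0.35 X, of which Im w <= X/10 can cancel at most 0.1 X.
     The height X/4 turns the gap factor exp(-(a/2) |Im v|) into the exp(-a X/8) of the
     hypothesis. *)
  have vi : X / 4 <= `|Im v|.
    have vE : Im v = Im w + r * Im z.
      by rewrite /v; case: (w) (z) => p q [x y] /=; ring.
    rewrite vE; have : 7 / 10 <= `|Im z|.
      rewrite -(@ler_pXn2r _ 2) ?nnegrE ?divr_ge0//.
      by rewrite real_normK ?num_real//; lra.
    rewrite ler_normr => /orP[zi'|zi']; rewrite ler_normr; apply/orP.
      by left; have : X * (7 / 10) <= X * Im z; [rewrite ler_wpM2l|rewrite /r]; lra.
    by right; have : X * (7 / 10) <= X * - Im z; [rewrite ler_wpM2l|rewrite /r]; lra.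
  have vp : 0 < `|Im v| by lra.
  have v0 : Im v != 0 by rewrite -normr_gt0.
  rewrite (_ : F z = cauchy h v - (cauchy h v - cauchy (cutoff X h) v)); last by rewrite subKr.
  rewrite (le_trans (le_normcD _ _))// normcN.
  have iv : `|Im v|^-1 <= 4.
    by rewrite -[4]invrK lef_pV2 ?posrE//; lra.
  have e1 : expR (- (a / 2 * `|Im v|)) <= tau.
    by apply: le_trans eX; rewrite ler_expR lerN2; nra.
  have h1 : normc (cauchy h v) <= 8 * I * tau.
    apply: le_trans (cauchy_gap_sym ih v0 a0 gap) _; rewrite -/I.
    apply: ler_pM; rewrite ?expR_ge0 ?mulr_ge0 ?invr_ge0//.
    by rewrite (_ : 8 * I = 2 * I * 4) ?ler_wpM2l ?mulr_ge0//; ring.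
  have h2 : normc (cauchy h v - cauchy (cutoff X h) v) <= 8 * tau.
    apply: le_trans (cauchy_cutoff X ih v0) _.
    apply: (@le_trans _ _ (2 * tail_mass h X * 4)); last by lra.
    by rewrite ler_wpM2l ?mulr_ge0.
  lra.
have F0 : normc (F 0) ^+ 4 <= (4 * (I + 1)) ^+ 2 * (8 * (I + 1) * tau) ^+ 2.
  have := @pdisc_center _ (fun z => \prod_(j < 4) F (ci ^+ j * z))
    ((4 * (I + 1)) ^+ 2 * (8 * (I + 1) * tau) ^+ 2).
  rewrite normc_prod; under eq_bigr do rewrite mulr0.
  rewrite prodr_const card_ord; apply.
    by apply: pdisc_prod => j; apply: pdisc_scale => //; rewrite normc_ciX.
  move=> z z1; rewrite normc_prod !big_ord_recl big_ord0 mulr1.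
  have nj j : normc (ci ^+ j * z) = 1 by rewrite normcM normc_ciX mul1r.
  have sq : Re z ^+ 2 + Im z ^+ 2 = 1.
    by rewrite -sqr_normc z1 expr1n.
  set A := 4 * (I + 1); set B := 8 * (I + 1) * tau.
  have A0 : 0 <= A by rewrite /A; lra.
  have B0 : 0 <= B by rewrite /B; nra.
  have mul4 (y0 y1 y2 y3 : R) :
      normc (F (ci ^+ 0 * z)) <= y0 -> normc (F (ci ^+ 1 * z)) <= y1 ->
      normc (F (ci ^+ 2 * z)) <= y2 -> normc (F (ci ^+ 3 * z)) <= y3 ->
      normc (F (ci ^+ 0 * z)) * (normc (F (ci ^+ 1 * z)) *
        (normc (F (ci ^+ 2 * z)) * normc (F (ci ^+ 3 * z)))) <=
      y0 * (y1 * (y2 * y3)).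
    by move=> *; do 3 (apply: ler_pM => //; rewrite ?mulr_ge0 ?normc_ge0//).
  have [im0 im1 im2 im3] : [/\ Im (ci ^+ 0 * z) = Im z,
      Im (ci ^+ 1 * z) = Re z,
      Im (ci ^+ 2 * z) = - Im z &
      Im (ci ^+ 3 * z) = - Re z].
    by case: (z) => x y; rewrite /ci !exprS !expr0 /=; split; ring.
  have [zi|zr] := leP (2^-1) (Im z ^+ 2).
    rewrite [leRHS](_ : _ * _ = B * (A * (B * A))); last by ring.
    apply: mul4; [|exact: Fany|by apply: Fgood; rewrite ?nj// im2 sqrrN|exact: Fany].
    by apply: Fgood; rewrite ?nj// im0.
  rewrite [leRHS](_ : _ * _ = A * (B * (A * B))); last by ring.
  apply: mul4; [exact: Fany| |exact: Fany|].
    by apply: Fgood; rewrite ?nj// im1; lra.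
  by apply: Fgood; rewrite ?nj// im3 sqrrN; lra.
have Fw : F 0 = cauchy (cutoff X h) w by rewrite /F mulr0 addr0.
set q := Num.sqrt tau.
have q0 : 0 <= q by exact: sqrtr_ge0.
have qq : q ^+ 2 = tau by rewrite sqr_sqrtr// ltW.
(* The geometric mean of 4 (I + 1) and 8 (I + 1) tau is below 6 (I + 1) q; in fourth powers this is
   1024 <= 1296. *)
have h1 : normc (cauchy (cutoff X h) w) <= 6 * (I + 1) * q.
  rewrite -Fw -(@ler_pXn2r _ 4) ?nnegrE ?normc_ge0//; last by nra.
  apply: le_trans F0 _; rewrite -qq.
  have -> : (4 * (I + 1)) ^+ 2 * (8 * (I + 1) * q ^+ 2) ^+ 2 =
    1024 * ((I + 1) ^+ 4 * q ^+ 4) by ring.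
  have -> : (6 * (I + 1) * q) ^+ 4 = 1296 * ((I + 1) ^+ 4 * q ^+ 4) by ring.
  by rewrite ler_wpM2r// ?ler_nat// mulr_ge0 ?exprn_ge0//; lra.
have w0 : 0 < Im w by lra.
have h2 := @cauchy_cutoff _ h X w ih _.
have {}h2 : normc (cauchy h w - cauchy (cutoff X h) w) <= 2 / eta * ((I + 1) * q).
  apply: (le_trans (h2 _)); first by rewrite gt_eqF.
  rewrite gtr0_norm//.
  have tq : tail_mass h X <= (I + 1) * q.
    apply: le_trans tX _; rewrite -qq expr2 ler_wpM2r//.
    rewrite -(@ler_pXn2r _ 2) ?nnegrE//; last by lra.
    by rewrite qq; nra.
  rewrite mulrAC; apply: ler_pM => //; first by rewrite divr_ge0// ltW.
  by rewrite ler_pM2l// lef_pV2// posrE.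
rewrite (_ : cauchy h w = cauchy (cutoff X h) w +
  (cauchy h w - cauchy (cutoff X h) w)); last by rewrite addrC subrK.
rewrite (le_trans (le_normcD _ _))// (le_trans (lerD h1 h2))//.
by rewrite le_eqVlt; apply/orP; left; apply/eqP; ring.
Qed.

End cauchy_decay.

(** * Jensen's inequality in a half-plane *)

Section levinson.
Variable R : realType.
Implicit Types (h : R -> R[i]) (w z : R[i]).

Lemma sin_mvt (x : R) : 0 < x -> exists2 c, 0 < c < x & sin x = cos c * x.
Proof.
move=> x0.
have [c] := @MVT R (@sin R) (@cos R) 0 x x0 (fun y _ => is_derive_sin y)
  (continuous_subspaceT (@continuous_sin R)).
by rewrite in_itv/= sin0 !subr0 => cx e; exists c.
Qed.

Lemma sin_le (x : R) : 0 < x -> sin x <= x.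
Proof. by move=> x0; have [c _ ->] := sin_mvt x0; rewrite ler_piMl ?cos_le1// ltW. Qed.

Lemma cos_ge (x : R) : 0 < x <= 1 -> 1 - x ^+ 2 / 2 <= cos x.
Proof.
move=> /andP[x0 x1]; have x20 : 0 < x / 2 by lra.
have [c /andP[c0 cx] e] := sin_mvt x20.
have s2 : sin (x / 2) ^+ 2 <= (x / 2) ^+ 2.
  rewrite ler_sqr ?nnegrE; [exact: sin_le| |lra].
  by apply: sin_ge0_pi; have := @pi_ge2 R; lra.
have : cos x = 1 - 2 * sin (x / 2) ^+ 2.
  rewrite {1}(_ : x = x / 2 + x / 2); last by lra.
  by rewrite cosD -!expr2 cos2sin2; ring.
by move=> ->; lra.
Qed.

Lemma sin_ge_half (x : R) : 0 < x <= 1 -> x / 2 <= sin x.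
Proof.
move=> /andP[x0 x1]; have [c /andP[c0 cx] ->] := sin_mvt x0.
have := @cos_ge c; rewrite c0 (le_trans (ltW cx) x1) => /(_ isT) h.
have : c ^+ 2 <= 1 by nra.
by move=> ?; rewrite mulrC ler_pM2r//; lra.
Qed.

(* [halfplane x0 eta] maps the unit disc onto Im > eta, sending 0 to x0 + 2 i eta. *)
Definition halfplane (x0 eta : R) z : R[i] :=
  x0 +i* eta + (0 +i* eta) * ((1 + z) / (1 - z)).

(** [D] is |1 - z|^2 at z = r cis(-x); as 1 - r <= x, it lies between x^2/16 and 2 x^2. So the angle
    x goes to distance at least of order 1/x on the right, and the height exceeds eta by at most a
    multiple of eta (1 - r)/x^2. *)
Lemma halfplane_boundary (x0 eta r x : R) : 0 < eta -> 2^-1 <= r < 1 ->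
    0 < x <= 1 -> 1 - r <= x ->
  x0 + eta / (4 * x) <= Re (halfplane x0 eta (r%:C * cis (- x))) /\
  eta <= Im (halfplane x0 eta (r%:C * cis (- x))) <=
    eta + 32 * eta * (1 - r) / x ^+ 2.
Proof.
move=> eta0 /andP[r2 r1] x01 rx; have /andP[x0' x1] := x01.
have s1 := sin_ge_half x01; have s2 := sin_le x0'; have c1 := cos_ge x01.
pose D := (1 - r * cos x) ^+ 2 + (r * sin x) ^+ 2.
have DE : D = (1 - r) ^+ 2 + 2 * r * (1 - cos x).
  rewrite (_ : D = 1 - 2 * r * cos x + r ^+ 2 * (cos x ^+ 2 + sin x ^+ 2)).
    by rewrite cos2Dsin2; ring.
  by rewrite /D; ring.
have D1 : D <= 2 * x ^+ 2 by rewrite DE; nra.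
have D2 : x ^+ 2 / 16 <= D.
  apply: (@le_trans _ _ ((r * sin x) ^+ 2)); last by rewrite /D lerDr sqr_ge0.
  rewrite (_ : _ / 16 = (x / 4) ^+ 2); last by field.
  by rewrite ler_sqr ?nnegrE; nra.
have D0 : 0 < D by nra.
have Dn : D != 0 by rewrite gt_eqF.
have HE : halfplane x0 eta (r%:C * cis (- x)) =
    (x0 + 2 * eta * r * sin x / D) +i* (eta + eta * (1 - r ^+ 2) / D).
  rewrite /halfplane cisN /cis.
  set c := cos x in D DE D1 D2 D0 Dn c1 *; set s := sin x in D DE D1 D2 D0 Dn s1 s2 *.
  have s2E : s ^+ 2 = 1 - c ^+ 2 by rewrite /s /c sin2cos2.
  have DE' : D = 1 - 2 * r * c + r ^+ 2 by rewrite DE; ring.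
  have den : 1 - r%:C * conjc (c +i* s) = (1 - r * c) +i* (r * s) :> R[i].
    by apply/eqP; rewrite eq_complex /=; apply/andP; split; apply/eqP; ring.
  have den0 : (1 - r * c) +i* (r * s) != 0 :> R[i].
    by apply: contra_neq Dn => -[e1 e2]; rewrite /D e1 e2; ring.
  rewrite den mulrA.
  have <- : ((2 * eta * r * s / D) +i* (eta * (1 - r ^+ 2) / D)) *
      ((1 - r * c) +i* (r * s)) =
      (0 +i* eta) * (1 + r%:C * conjc (c +i* s)) :> R[i].
    rewrite DE' in Dn *; apply/eqP; rewrite eq_complex /=; apply/andP; split; apply/eqP.
      by field.
    apply: (mulIf Dn).
    rewrite [RHS](_ : _ = eta * (1 + r * c) * (1 - 2 * r * c + r ^+ 2)); last by ring.
    rewrite [LHS](_ : _ = 2 * eta * r ^+ 2 * s ^+ 2 +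
      eta * (1 - r ^+ 2) * (1 - r * c)); last by field.
    by rewrite s2E; ring.
  by rewrite mulfK.
rewrite HE /=; split.
  rewrite lerD2l ler_pdivlMr// mulrAC ler_pdivrMr ?mulr_gt0//.
  apply: (@le_trans _ _ (eta * (2 * x ^+ 2))); first by rewrite ler_pM2l.
  have : eta * r * sin x * x >= eta / 4 * x ^+ 2.
    rewrite (_ : eta / 4 * x ^+ 2 = eta * 2^-1 * (x / 2) * x); last by field.
    rewrite ler_pM2r// -!mulrA ler_pM2l// ler_pM//; lra.
  by move=> ?; lra.
rewrite lerDl divr_ge0 ?(ltW D0) ?mulr_ge0 ?(ltW eta0)//=; last by nra.
rewrite lerD2l ler_pdivrMr// mulrAC ler_pdivlMr ?exprn_gt0//.
apply: (@le_trans _ _ (32 * eta * (1 - r) * (x ^+ 2 / 16))).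
  rewrite (_ : 32 * eta * _ * _ = eta * (1 - r) * 2 * x ^+ 2); last by field.
  rewrite (_ : eta * (1 - r ^+ 2) = eta * (1 - r) * (1 + r)); last by ring.
  rewrite ler_wpM2r ?sqr_ge0// ler_wpM2l//; last by lra.
  by rewrite mulr_ge0 ?(ltW eta0)//; lra.
by rewrite ler_wpM2l// ?mulr_ge0 ?(ltW eta0)//; lra.
Qed.

Lemma halfplane_Im (x0 eta : R) z : 0 < eta -> normc z < 1 ->
  eta <= Im (halfplane x0 eta z).
Proof.
move=> eta0 z1; have : normc z ^+ 2 < 1 by rewrite expr_lt1 ?normc_ge0.
rewrite sqr_normc /halfplane; case: z {z1} => p q /= pq.
rewrite lerDl; set n := (1 - p) ^+ 2 + _.
have n0 : 0 <= n by rewrite addr_ge0// sqr_ge0.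
rewrite (_ : _ + _ = eta * (1 - (p ^+ 2 + q ^+ 2)) / n); last by ring.
by rewrite divr_ge0// mulr_ge0 ?ltW// subr_gt0.
Qed.

Lemma halfplane0 (x0 eta : R) : halfplane x0 eta 0 = x0 +i* (2 * eta).
Proof.
rewrite /halfplane addr0 subr0 divr1 mulr1.
by apply/eqP; rewrite eq_complex /=; apply/andP; split; apply/eqP; ring.
Qed.

(** With w0 the image of 0, t - halfplane(z) = ((t - w0) - (t - x0) z) / (1 - z). The transform is
    thus 1 - r z times an integral as in [pdisc_cauchy], whose ratio r (t - x0)/(t - w0) has modulus
    at most r because x0 is the real part of w0. *)
Lemma halfplane_pdisc h (x0 eta r : R) : cintegrable h -> 0 < eta -> 0 <= r < 1 ->
  pdisc (fun z => cauchy h (halfplane x0 eta (r%:C * z))).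
Proof.
move=> ih eta0 /andP[r0 r1].
pose w0 : R[i] := x0 +i* (2 * eta).
have Iw0 : Im w0 != 0 by rewrite /= mulf_neq0// gt_eqF.
pose a t := h t / (t%:C - w0).
pose b (t : R) := r%:C * (t - x0)%:C / (t%:C - w0).
have tn (t : R) : `|t - x0| <= normc (t%:C - w0).
  by apply: le_trans (normc_Re _).
have bt t : normc (b t) <= r.
  rewrite /b normcM normcV normcM !normc_real (ger0_norm r0).
  by rewrite ler_pdivrMr ?normc_gt0 ?cauchy_kernel_neq0// ler_wpM2l.
have mb : cmeasurable b.
  apply: cmeasurableM; last exact: cauchy_kernel_measurable.
  apply: cmeasurableM; first exact: cmeasurable_cst.
  by apply: cmeasurable_real; exact: measurable_funB.
have ia : cintegrable a by exact: cintegrable_cauchy.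
have P1 := pdisc_cauchy ia mb bt r1.
have P2 : pdisc (fun z => 1 - r%:C * z).
  apply: pdisc_ext (pdisc_poly (1 - r%:C *: 'X)) => z _.
  by rewrite !hornerE.
apply: pdisc_ext (pdisc_mul P2 P1) => z z1.
have rz : normc (r%:C * z) < 1.
  by rewrite normcM normc_real ger0_norm// (le_lt_trans _ r1)// ler_piMr.
have hI : Im (halfplane x0 eta (r%:C * z)) != 0.
  by rewrite gt_eqF// (lt_le_trans eta0)// halfplane_Im.
rewrite -complex_integralZ; last first.
  apply: (@cintegrableM _ _ _ (1 - r)^-1) => //.
    apply: cmeasurableV; under eq_fun do rewrite -mulrN.
    by apply: cmeasurableD; [|apply: cmeasurableM => //]; exact: cmeasurable_cst.
  move=> t; rewrite normcV lef_pV2 ?posrE ?subr_gt0//.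
    rewrite (le_trans _ (le_normcB _ _))// normc1 lerD2l lerN2 normcM.
    by rewrite -[leRHS]mulr1 ler_pM ?normc_ge0.
  rewrite (lt_le_trans _ (le_normcB _ _))// normc1 subr_gt0 normcM.
  by rewrite (le_lt_trans _ r1)// -[leRHS]mulr1 ler_pM ?normc_ge0.
congr complex_integral; apply/funext => t; rewrite /a.
have n1 : 1 - r%:C * z != 0.
  by rewrite -normc_gt0 (lt_le_trans _ (le_normcB _ _))// normc1 subr_gt0.
have n2 : t%:C - w0 != 0 by exact: cauchy_kernel_neq0.
have n3 : t%:C - halfplane x0 eta (r%:C * z) != 0 by exact: cauchy_kernel_neq0.
have n4 : t%:C - halfplane x0 eta (r%:C * z) =
    ((t%:C - w0) - (t - x0)%:C * (r%:C * z)) / (1 - r%:C * z).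
  apply: (mulIf n1); rewrite divfK//.
  rewrite /halfplane (_ : w0 = x0%:C + (0 +i* eta) *+ 2); last first.
    by rewrite mulr2n; apply/eqP; rewrite eq_complex /=; apply/andP; split; apply/eqP; ring.
  rewrite (_ : x0 +i* eta = x0%:C + (0 +i* eta)); last first.
    by apply/eqP; rewrite eq_complex /=; apply/andP; split; apply/eqP; ring.
  rewrite rmorphB /=; field.
  exact: n1.
have n5 : (t%:C - w0) - (t - x0)%:C * (r%:C * z) != 0.
  by apply: contraNneq n3 => e; rewrite n4 e mul0r.
rewrite n4 /b; field.
have n5' : t%:C - w0 - (t%:C - x0%:C) * (r%:C * z) != 0 by rewrite -rmorphB.
have : [&& 1 - r%:C * z != 0, t%:C - w0 - (t%:C - x0%:C) * (r%:C * z) != 0 &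
  t%:C - w0 != 0] by rewrite n1 n5' n2.
by [].
Qed.

(** Jensen's inequality for the Cauchy transform divided by its bound [C], with w at the centre of
    the disc. The arc k lands at real part at least 2 * 2^k, where [cauchy_decay] gives a multiple
    of sqrt(tau k); the exponent is then a fixed negative multiple of the divergent sum, and K is
    arbitrary. *)
Lemma cauchy_upper_eq0 h (a : R) (tau : nat -> R) : cintegrable h -> 0 < a ->
    (forall r, - a < r < a -> complex_integral (fun t => h t * cis (- (r * t))) = 0) ->
    (forall k, tail_mass h (2 ^+ k) <= tau k) ->
    (forall k, expR (- (a * 2 ^+ k / 8)) <= tau k) ->
    (forall k, tau k <= total_mass h + 1) ->
    (forall B, exists K, B <= \sum_(5 <= k < K) - ln (tau k) / 2 ^+ k) ->
  forall w, 0 < Im w <= 1 -> cauchy h w = 0.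
Proof.
move=> ih a0 gap tau1 tau2 tau3 div w /andP[w0 w1].
set I := total_mass h in tau3 *.
have I0 : 0 <= I by exact: total_mass_ge0.
have tau0 k : 0 < tau k by apply: lt_le_trans (tau2 k); exact: expR_gt0.
pose x0 := Re w; pose eta := Im w / 2.
have eta0 : 0 < eta by rewrite /eta; lra.
have eta1 : eta <= 1 by rewrite /eta; lra.
have wE : halfplane x0 eta 0 = w.
  rewrite halfplane0 /x0 /eta mulrC divfK//; by case: (w).
pose C := (I + 1) * (6 + 2 / eta).
have ie : 0 < eta^-1 by rewrite invr_gt0.
have C0 : 0 < C by rewrite mulr_gt0//; lra.
have bound v : eta <= Im v -> normc (cauchy h v) <= C.
  move=> hv; have v0 : 0 < Im v by exact: lt_le_trans hv.
  apply: le_trans (cauchy_le ih _) _; first by rewrite gt_eqF.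
  rewrite gtr0_norm// -/I.
  have iv : (Im v)^-1 <= eta^-1 by rewrite lef_pV2 ?posrE.
  have := ler_wpM2l (mulr_ge0 (ler0n R 2) I0) iv; rewrite /C; nra.
have pi0 : 0 < pi :> R by exact: pi_gt0.
have A0 : 0 <= 8 * pi * (2 + `|x0|) / eta.
  by rewrite divr_ge0 ?ltW// mulr_gt0 ?mulr_gt0// ltr_pwDl.
(* The dyadic arcs start so close to 1 that x <= 1 and eta / (4 x) >= (2 + |x0|) 2^k on the arc k;
   this leaves a real part of at least 2 * 2^k after the shift by x0. *)
pose s := Num.bound (8 * pi * (2 + `|x0|) / eta + 2 * pi).
have sP : 8 * pi * (2 + `|x0|) / eta + 2 * pi <= 2 ^+ s.
  rewrite ltW// (lt_le_trans (archi_boundP _))//; last by rewrite -natrX ler_nat ltnW// ltn_expl.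
  by rewrite addr_ge0// mulr_ge0// ltW.
have s1 : 8 * pi * (2 + `|x0|) / eta <= 2 ^+ s by lra.
have s2 : 2 * pi <= 2 ^+ s :> R by lra.
have main K : normc (cauchy h w) <=
    C * expR (- (2 ^+ (s + 2))^-1 * \sum_(5 <= k < K) - ln (tau k) / 2 ^+ k).
  pose xm := 2 * pi / 2 ^+ (s + K) : R.
  have xm0 : 0 < xm by rewrite divr_gt0 ?exprn_gt0 ?mulr_gt0.
  have xm1 : xm <= 1.
    rewrite ler_pdivrMr ?exprn_gt0// mul1r (le_trans s2)//.
    by rewrite ler_eXn2l ?leq_addr// ltr1n.
  (* The radius must stay below 1, hence depends on K through the smallest angle [xm]. With 640 the
     excess height 32 eta del / x^2 is at most eta/20 for every x >= xm. *)
  pose del := xm ^+ 2 / 640.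
  have del0 : 0 < del by apply: divr_gt0; [exact: exprn_gt0|rewrite ltr0n].
  have del1 : del <= xm / 640 by rewrite /del; nra.
  pose r := 1 - del.
  have r01 : 0 <= r < 1 by rewrite /r; apply/andP; split; lra.
  have r12 : 2^-1 <= r < 1 by rewrite /r; apply/andP; split; lra.
  have nr z : normc z = 1 -> normc (r%:C * z) < 1.
    by move=> z1; rewrite normcM z1 mulr1 normc_real ger0_norm; case/andP: r01.
  pose G z := (C^-1)%:C * cauchy h (halfplane x0 eta (r%:C * z)).
  have Gd : pdisc G.
    apply: pdisc_mul; last exact: halfplane_pdisc.
    by apply: pdisc_ext (pdisc_poly (C^-1)%:C%:P) => z _; rewrite hornerC.
  have GC z : normc (G z) = normc (cauchy h (halfplane x0 eta (r%:C * z))) / C.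
    by rewrite normcM normc_real ger0_norm 1?mulrC// invr_ge0 ltW.
  have G1 z : normc z = 1 -> normc (G z) <= 1.
    move=> z1; rewrite GC ler_pdivrMr// mul1r; apply: bound.
    by apply: halfplane_Im => //; exact: nr.
  (* [cauchy_decay] needs a height of at most 2^k/10. The height is at most eta + eta/20 with eta <=
     1, so 2^5 = 32 is enough; nearer arcs get the trivial bound 1. *)
  pose b k := if (k < 5)%N then 0 else - ln (tau k) / 2.
  have Gb k x : (k < K)%N -> 2 * pi / 2 ^+ (s + k.+1) <= x ->
      x <= 2 * pi / 2 ^+ (s + k) -> normc (G (cis (- x))) <= expR (- b k).
    move=> kK x1 x2; rewrite /b; case: ltnP => k5.
      by rewrite oppr0 expR0; apply: G1; rewrite normc_cis.
    have xmx : xm <= x.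
      apply: le_trans x1; rewrite /xm ler_pM2l ?mulr_gt0//.
      by rewrite lef_pV2 ?posrE ?exprn_gt0// ler_eXn2l ?ltr1n// leq_add2l.
    have x0' : 0 < x by exact: lt_le_trans xmx.
    have x1' : x <= 1.
      apply: (le_trans x2); rewrite ler_pdivrMr ?exprn_gt0// mul1r (le_trans s2)//.
      by rewrite ler_eXn2l ?leq_addr// ltr1n.
    have x01 : 0 < x <= 1 by rewrite x0'.
    have rx : 1 - r <= x by rewrite /r; lra.
    have [hR /andP[hI1 hI2]] := halfplane_boundary x0 eta0 r12 x01 rx.
    rewrite GC ler_pdivrMr// [leRHS]mulrC /C.
    have -> : expR (- (- ln (tau k) / 2)) = Num.sqrt (tau k).
      rewrite mulNr opprK -[in RHS](lnK (tau0 k)) [in RHS](splitr (ln (tau k))).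
      by rewrite expRD -expr2 sqrtr_sqr ger0_norm// expR_ge0.
    have k32 : 32 <= (2 : R) ^+ k.
      by rewrite (_ : 32 = 2 ^+ 5) ?ler_eXn2l ?ltr1n// -natrX.
    apply: (@cauchy_decay _ h a eta (2 ^+ k)) => //.
    - by rewrite (le_trans _ k32)// ler1n.
    - apply: le_trans hR.
      have h1 : (2 + `|x0|) * 2 ^+ k <= eta / (4 * x).
        rewrite ler_pdivlMr ?mulr_gt0//.
        have h2 : x * 2 ^+ (s + k) <= 2 * pi.
          by rewrite -ler_pdivlMr ?exprn_gt0.
        have h3 : 8 * pi * (2 + `|x0|) <= 2 ^+ s * eta by rewrite -ler_pdivrMr.
        have p0 : (0 : R) < 2 ^+ s by rewrite exprn_gt0.
        rewrite exprD in h2.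
        rewrite -(ler_pM2l p0).
        rewrite (_ : 2 ^+ s * _ = 4 * (2 + `|x0|) * (x * (2 ^+ s * 2 ^+ k))); last by ring.
        apply: le_trans (_ : 4 * (2 + `|x0|) * (2 * pi) <= _).
          by rewrite ler_wpM2l// mulr_ge0// addr_ge0.
        by apply: le_trans h3; rewrite le_eqVlt; apply/orP; left; apply/eqP; ring.
      have h4 : - `|x0| <= x0 by rewrite lerNl -normrN ler_norm.
      have h5 : `|x0| * 1 <= `|x0| * 2 ^+ k by rewrite ler_wpM2l//; lra.
      lra.
    - rewrite hI1/=; apply: (le_trans hI2).
      have h1 : 32 * eta * (1 - r) / x ^+ 2 <= 32 * eta / 640.
        have hd : del <= x ^+ 2 / 640.
          apply: ler_wpM2r; first by rewrite invr_ge0 ler0n.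
          by rewrite -(subr_ge0 (xm ^+ 2)) subr_sqr mulr_ge0//; lra.
        have := ler_wpM2l (ltW eta0) hd.
        by rewrite ler_pdivrMr ?exprn_gt0// /r; lra.
      lra.
  have := pdisc_jensen Gd G1 Gb.
  rewrite GC mulr0 wE ler_pdivrMr// mulrC => /le_trans; apply.
  rewrite ler_pM2l// ler_expR mulNr lerN2 le_eqVlt; apply/orP; left; apply/eqP.
  rewrite big_distrr/= [LHS](@big_nat_widenl _ _ _ 5 0)//= big_mkcond/= big_mkord.
  apply: eq_bigr => k _; rewrite /b; have [k5|k5] := ltnP k 5.
    by rewrite /= mul0r.
  have -> : (2 : R) ^+ (s + k.+1) = 2 ^+ s * 2 ^+ k * 2 by rewrite exprD exprSr mulrA.
  have -> : (2 : R) ^+ (s + 2) = 2 ^+ s * 4 by rewrite exprD; ring.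
  by rewrite /=; field; rewrite !expf_neq0.
apply/eqP; rewrite -normc_eq0; apply/eqP/le_anti; rewrite normc_ge0 andbT.
apply/ler_addgt0Pr => e e0; rewrite add0r.
have [K KB] := div (2 ^+ (s + 2) * (C / e)).
apply: (le_trans (main K)).
rewrite mulNr expRN ler_pdivrMr ?expR_gt0//.
have h1 : C / e <= (2 ^+ (s + 2))^-1 * \sum_(5 <= k < K) - ln (tau k) / 2 ^+ k.
  by rewrite [leRHS]mulrC ler_pdivlMr ?exprn_gt0// [leLHS]mulrC.
have h2 := expR_ge1Dx ((2 ^+ (s + 2))^-1 * \sum_(5 <= k < K) - ln (tau k) / 2 ^+ k).
rewrite [leRHS]mulrC -ler_pdivrMr//; lra.
Qed.

End levinson.

(** * Levinson's theorem *)

Section levinson_theorem.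
Variable R : realType.
Implicit Types (h : R -> R[i]) (f : R -> R).

Lemma complex_integralJ h : cintegrable h ->
  complex_integral (fun t => conjc (h t)) = conjc (complex_integral h).
Proof.
move=> [i1 i2]; rewrite /complex_integral /=; congr (_ +i* _).
  by congr Rintegral; apply/funext => t; case: (h t).
rewrite -mulN1r -RintegralZl//.
by congr Rintegral; apply/funext => t; case: (h t) => a b /=; rewrite mulN1r.
Qed.

Lemma cintegrable_cis h (r : R) : cintegrable h ->
  cintegrable (fun t => h t * cis (- (r * t))).
Proof.
move=> ih; apply: (@cintegrableM _ _ _ 1) => //; last by move=> t; rewrite normc_cis.
by apply: cmeasurable_cis; apply: measurable_funN; exact: measurable_funM.
Qed.

(** The lower half-plane reduces to the upper one by conjugating [h]: this keeps the modulus, hence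
    the tails, and reflects the symmetric gap onto itself. *)
Lemma levinson h (a : R) (tau : nat -> R) : cintegrable h -> 0 < a ->
    (forall r, - a < r < a -> complex_integral (fun t => h t * cis (- (r * t))) = 0) ->
    (forall k, tail_mass h (2 ^+ k) <= tau k) ->
    (forall k, expR (- (a * 2 ^+ k / 8)) <= tau k) ->
    (forall k, tau k <= total_mass h + 1) ->
    (forall B, exists K, B <= \sum_(5 <= k < K) - ln (tau k) / 2 ^+ k) ->
  {ae leb, forall t, h t = 0}.
Proof.
move=> ih a0 gap tau1 tau2 tau3 div; apply: cauchy_eq0 => // w /andP[w0 w1].
have [wp|wn|e] := ltgtP 0 (Im w); last by move: w0; rewrite -e normr0 ltxx.
  apply: (cauchy_upper_eq0 ih a0 gap tau1 tau2 tau3 div).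
  by rewrite wp /=; rewrite gtr0_norm in w1.
have nJ : (fun t => normc (conjc (h t))) = (fun t => normc (h t)).
  by apply/funext => t; exact: normc_conjc.
have ihJ : cintegrable (fun t => conjc (h t)).
  case: ih => i1 i2; split.
    by apply: eq_integrable i1 => // t _; case: (h t).
  have := integrableZl measurableT (-1) i2; apply: eq_integrable => // t _ /=.
  by case: (h t) => p q; rewrite /= -EFinM mulN1r.
have wn0 : Im w != 0 by rewrite lt_eqF.
rewrite -[cauchy h w]conjcK (cauchyJ ih wn0).
rewrite (@cauchy_upper_eq0 _ (fun t => conjc (h t)) a tau) ?conjc0//.
- move=> r /andP[r1 r2].
  have -> : (fun t => conjc (h t) * cis (- (r * t))) =
      (fun t => conjc (h t * cis (- ((- r) * t)))).
    apply/funext => t; rewrite rmorphM; congr (_ * _).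
    by rewrite -[RHS]cisN mulNr opprK.
  rewrite complex_integralJ ?gap ?conjc0//; last exact: cintegrable_cis.
  by apply/andP; split; lra.
- move=> k; rewrite /tail_mass.
  by under eq_Rintegral do rewrite normc_conjc; exact: tau1.
- by move=> k; rewrite /total_mass nJ; exact: tau3.
- move: w0 w1; rewrite ltr0_norm//; case: (w) => p q /= q0 q1.
  by rewrite q0.
Qed.

Definition tail f (x : R) := Rintegral leb setT (fun t => if t <= x then 0 else f t).

(* A dyadic form of the divergence of the logarithmic integral on the right; the
   exponential keeps the logarithm finite, and is what a gap of length 2a
   contributes at distance 2^k. *)
Definition tail_diverges f := forall a : R, 0 < a -> forall B, exists K,
  B <= \sum_(5 <= k < K) - ln (Num.max (tail f (2 ^+ k)) (expR (- (a * 2 ^+ k / 8)))) / 2 ^+ k.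

Lemma fourier_gap_eq0 f (u v : R) :
    integrableR f -> (forall t, 0 <= f t) ->
    tail_diverges f -> u < v -> (forall xi, u < xi < v -> fourier f xi = 0) ->
  {ae leb, forall t, f t = 0}.
Proof.
move=> fi f0 div uv gap.
have p0 : 0 < pi :> R by exact: pi_gt0.
(* In the angular frequency 2 pi xi the gap has centre [lam] and half-length [a]. The modulation [h]
   moves it to ]-a, a[ and has modulus f. *)
pose lam := pi * (u + v); pose a := pi * (v - u).
have a0 : 0 < a by rewrite mulr_gt0// subr_gt0.
pose h t := (f t)%:C * cis (- (lam * t)).
have nh t : normc (h t) = f t by rewrite normcM normc_cis mulr1 normc_real ger0_norm.
have ih : cintegrable h by apply: cintegrable_cis; exact: cintegrable_real.
have tm x : tail_mass h x = tail f x by apply: eq_Rintegral => t _; rewrite nh.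
have I0 := total_mass_ge0 h.
have [N [mN N0 hN]] : {ae leb, forall t, h t = 0}.
  apply: (@levinson h a (fun k => Num.max (tail f (2 ^+ k)) (expR (- (a * 2 ^+ k / 8))))) => //.
  - move=> r /andP[r1 r2]; rewrite -[RHS](gap ((lam + r) / (2 * pi))); last first.
      rewrite ltr_pdivlMr ?mulr_gt0// ltr_pdivrMr ?mulr_gt0//.
      by move: r1 r2; rewrite /a /lam => r1 r2; apply/andP; split; lra.
    congr complex_integral; apply/funext => t; rewrite /h -mulrA -cisD -opprD -mulrDl.
    have p2 : 2 * pi != 0 :> R by rewrite mulf_neq0// gt_eqF.
    congr (_ * cis (- _)); rewrite [2 * pi * t]mulrC -mulrA.
    by rewrite [2 * pi * (_ / _)]mulrC divfK// mulrC.
  - by move=> k; rewrite tm le_max lexx.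
  - by move=> k; rewrite le_max lexx orbT.
  - move=> k; rewrite ge_max; apply/andP; split.
      by rewrite -tm (le_trans (tail_mass_le _ ih))// lerDl.
    apply: (@le_trans _ _ 1); last by rewrite lerDr.
    by rewrite -expR0 ler_expR oppr_le0 divr_ge0// mulr_ge0 ?ltW// exprn_gt0.
  - exact: div.
exists N; split => // t ft; apply: hN => ht; apply: ft.
by have : normc (h t) = 0; [rewrite ht normc0|rewrite nh].
Qed.

End levinson_theorem.

(** * Tails under an exponential moment *)

Section tails.
Variable R : realType.
Implicit Types (f : R -> R).

(** The integral of a nonnegative function is a supremum over simple functions below it, which gives
    monotonicity directly, also for the logarithmic integrand of an abstract [F]. *)
Lemma integral_le_ge0 (D : set R) (F G : R -> \bar R) :
    (forall x, D x -> 0 <= G x)%E -> (forall x, D x -> F x <= G x)%E ->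
  (\int[leb]_(x in D) F x <= \int[leb]_(x in D) G x)%E.
Proof.
move=> G0 FG; rewrite [leLHS]integralE.
have Fp x : (0 <= F^\+ x)%E by rewrite funepos.unlock le_max lexx orbT.
have Fn x : (0 <= F^\- x)%E by rewrite funeneg.unlock le_max lexx orbT.
apply: (@le_trans _ _ (\int[leb]_(x in D) F^\+ x)%E).
  by rewrite -[leRHS]sube0 leeB// integral_ge0.
rewrite !ge0_integralE//; apply: ereal_sup_le => _ [g gF <-]; exists g => // x.
apply: (le_trans (gF x)); rewrite /patch; case: ifP => // /set_mem Dx.
by rewrite funepos.unlock ge_max FG//= G0.
Qed.

Lemma tail_integrable_real f (x : R) : integrableR f ->
  leb.-integrable setT (fun t => (if t <= x then 0 else f t)%:E).
Proof.
move=> fi; have fi' := fi; apply: le_integrable fi' => //.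
  apply/measurable_EFinP; apply: measurable_fun_ifT => //; first exact: measurable_le.
  by apply/measurable_EFinP; move/measurable_int: fi.
by move=> t _ /=; case: ifP => _ //; rewrite normr0 lee_fin normr_ge0.
Qed.

Lemma le_tail f x y : integrableR f ->
  (forall t, 0 <= f t) -> x <= y -> tail f y <= tail f x.
Proof.
move=> fi f0 xy; apply: le_Rintegral => //; try exact: tail_integrable_real.
move=> t _; case: ifP => ty; case: ifP => tx //.
by rewrite (le_trans tx xy) in ty.
Qed.

Lemma tail_le_total f x : integrableR f ->
  (forall t, 0 <= f t) -> tail f x <= Rintegral leb setT f.
Proof.
move=> fi f0; apply: le_Rintegral => //; first exact: tail_integrable_real.
by move=> t _; case: ifP.
Qed.

Lemma geometric_sum_le1 K : \sum_(5 <= k < K) (2 ^+ k)^-1 <= 1 :> R.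
Proof.
have [K5|K5] := leqP K 5; first by rewrite big_geq.
have -> : K = (5 + (K - 5))%N by rewrite subnKC// ltnW.
elim: (K - 5)%N => {K5}[|n IH]; first by rewrite big_geq.
suff : \sum_(5 <= k < 5 + n.+1) (2 ^+ k)^-1 <= 1 - (2 ^+ n.+1)^-1 :> R.
  by move=> /le_trans; apply; rewrite gerBl invr_ge0 exprn_ge0.
elim: n {IH} => [|n IH].
  by rewrite addn1 big_nat1 expr1 (_ : (2 : R) ^+ 5 = 32); [lra|ring].
rewrite addnS big_nat_recr ?leq_addr//=; apply: le_trans (lerD IH (lexx _)) _.
rewrite (_ : (2 ^+ (5 + n.+1))^-1 = (2 ^+ n.+2)^-1 / 16 :> R); last first.
  rewrite (_ : (5 + n.+1 = n.+2 + 4)%N); last by lia.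
  by rewrite exprD (_ : (2 : R) ^+ 4 = 16) ?invfM//; ring.
have : 0 < (2 ^+ n.+2)^-1 :> R by rewrite invr_gt0 exprn_gt0.
have -> : (2 ^+ n.+1)^-1 = 2 * (2 ^+ n.+2)^-1 :> R.
  by rewrite [in RHS]exprS; field; rewrite expf_neq0.
lra.
Qed.

(** The tail is at most D exp(-M x), so with c = min(M, a/8) each term is at least c - ln(D + 1) /
    2^k: the constants c add up without bound, the corrections to at most ln(D + 1). *)
Lemma tail_diverges_exp f (M : R) : integrableR f ->
    (forall t, 0 <= f t) -> 0 < M ->
    (\int[leb]_x (f x * expR (M * `|x|))%:E < +oo)%E ->
  tail_diverges f.
Proof.
move=> fi f0 M0 fM a a0 B.
have fMi : leb.-integrable setT (fun x => (f x * expR (M * `|x|))%:E).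
  apply/integrableP; split.
    apply/measurable_EFinP; apply: measurable_funM.
      by apply/measurable_EFinP; move/measurable_int: fi.
    apply: (measurableT_comp (@measurable_expR R)); apply: measurable_funM => //.
  apply: le_lt_trans fM; apply: integral_le_ge0 => x _.
    by rewrite lee_fin mulr_ge0// expR_ge0.
  by rewrite lee_fin ger0_norm// mulr_ge0// expR_ge0.
set D := Rintegral leb setT (fun x => f x * expR (M * `|x|)).
have D0 : 0 <= D by apply: Rintegral_ge0 => x _; rewrite mulr_ge0// expR_ge0.
have tD x : 0 <= x -> tail f x <= D * expR (- (M * x)).
  move=> x0; rewrite /D -RintegralZr//; apply: le_Rintegral => //.
  - exact: tail_integrable_real.
  - by rewrite /comp; under eq_fun do rewrite EFinM; apply: integrableZr.
  - move=> t _; case: ifPn => [_|]; first by rewrite !mulr_ge0 ?expR_ge0.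
    rewrite -ltNge => xt.
    rewrite -mulrA -expRD ler_peMr// -expR0 ler_expR subr_ge0 ler_pM2l//.
    by rewrite (le_trans (ltW xt))// ler_norm.
pose c := Num.min M (a / 8).
have c0 : 0 < c by rewrite lt_min M0 divr_gt0.
have cM : c <= M by rewrite ge_min lexx.
have ca : c <= a / 8 by rewrite ge_min lexx orbT.
have D1 : 0 < D + 1 by lra.
have L0 : 0 <= ln (D + 1) by rewrite ln_ge0// lerDr.
have term k : c - ln (D + 1) * (2 ^+ k)^-1 <=
    - ln (Num.max (tail f (2 ^+ k)) (expR (- (a * 2 ^+ k / 8)))) / 2 ^+ k.
  have k0 : 0 < (2 : R) ^+ k by rewrite exprn_gt0.
  rewrite ler_pdivlMr// mulrBl mulfVK ?gt_eqF// lerNr opprB.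
  rewrite -(expRK (ln _ - _)) ler_ln ?posrE ?expR_gt0 ?lt_max ?expR_gt0 ?orbT//.
  rewrite expRD lnK ?posrE// ge_max; apply/andP; split.
    apply: (le_trans (tD _ (ltW k0))); apply: ler_pM; rewrite ?expR_ge0//.
      by rewrite lerDl.
    by rewrite ler_expR lerN2 ler_pM2r.
  rewrite -[leLHS]mul1r; apply: ler_pM; rewrite ?expR_ge0//.
    by rewrite lerDr.
  by rewrite ler_expR lerN2 mulrAC ler_pM2r.
pose n := Num.bound `|(B + ln (D + 1)) / c|.
exists (5 + n)%N.
apply: (@le_trans _ _ (\sum_(5 <= k < 5 + n) (c - ln (D + 1) * (2 ^+ k)^-1))); last first.
  by apply: ler_sum => k _; exact: term.
rewrite big_split/= sumr_const_nat addKn sumrN -mulr_sumr.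
have := ler_wpM2l L0 (geometric_sum_le1 (5 + n)); rewrite mulr1 => h.
have h2 : B + ln (D + 1) <= c *+ n.
  rewrite -mulr_natr mulrC -ler_pdivrMr// ltW// (le_lt_trans (ler_norm _))//.
  by apply: archi_boundP.
lra.
Qed.

End tails.

(** * Divergent logarithmic integrals in dyadic form *)

Section log_integral.
Variable R : realType.
Implicit Types (f : R -> R).

Lemma small_terms (p : nat -> R) (B e : R) : 0 < e -> (forall k, 0 <= p k) ->
    (forall K, \sum_(5 <= k < K) p k <= B) ->
  exists2 k0, (5 <= k0)%N & forall k, (k0 <= k)%N -> p k < e.
Proof.
move=> e0 p0 pB; pose P K := \sum_(5 <= k < K) p k.
have ndP : nondecreasing_seq P.
  apply/nondecreasing_seqP => n; rewrite /P.
  have [n5|n5] := leqP 5 n; first by rewrite big_nat_recr//= lerDl.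
  by rewrite !big_geq// ltnW.
have cvP : cvgn P.
  by apply: nondecreasing_is_cvgn => //; exists B => _ [n _ <-]; exact: pB.
have dP : (fun n => P n.+1 - P n) @ \oo --> (0 : R).
  by rewrite -(subrr (limn P)); apply: cvgB => //; rewrite cvg_shiftS.
have /cvgrPdist_lt/(_ _ e0) [N _ hN] := dP.
exists (maxn 5 N); first exact: leq_maxl.
move=> k; rewrite geq_max => /andP[k5 kN].
have := hN k kN; rewrite sub0r normrN /P big_nat_recr//= [_ + p k]addrC addrK.
by rewrite ger0_norm.
Qed.

(** On the shell [2^(n-1), 2^n[ the weight is at most 4^(1-n) and the length at most 2^n, so it
    contributes at most 4 q_n / 2^n. On the shells n < k0, where [T n] has no positive lower bound
    of its own, the bound at k0 is used, valid on all of [0, 2^k0]. *)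
Lemma log_integral_bound (F : R -> \bar R) (T q : nat -> R) (A C : R) (k0 : nat) :
    (forall x n, 0 <= x <= 2 ^+ n -> ((T n)%:E <= F x)%E) ->
    (forall k, (k0 <= k)%N -> 0 < T k /\ - ln (T k) <= q k) ->
    (forall k, 0 <= q k) -> (forall K, \sum_(0 <= k < K) q k / 2 ^+ k <= C) ->
  (\int[leb]_(x in `[0%R, +oo[) (- lne (F x) * ((1 + x ^+ 2)^-1)%:E) < +oo)%E.
Proof.
move=> TF Tq q0 qC.
have lneF x n (c : R) : 0 <= x <= 2 ^+ n -> 0 < T n -> - ln (T n) <= c ->
    (- lne (F x) <= c%:E)%E.
  move=> xn Tn0 Tc; apply: (@le_trans _ _ (- (ln (T n))%:E)%E); last by rewrite lee_fin.
  have Tp : (0 <= (T n)%:E)%E by rewrite lee_fin ltW.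
  have TFx := TF _ _ xn; have Fp := le_trans Tp TFx.
  by rewrite leeN2 -lne_EFin// lee_lne// in_itv/= leey andbT.
pose d n := if (n < k0)%N then q k0 else q n / 4 ^+ n.-1.
pose a n : R := if n is m.+1 then 2 ^+ m else 0.
pose J n : set R := `[a n, 2 ^+ n[%classic.
have d0 n : 0 <= d n by rewrite /d; case: ifP => // _; rewrite divr_ge0// exprn_ge0.
have a0 n : 0 <= a n by case: n => [|n]//=; rewrite exprn_ge0.
have aw n x : a n <= x -> (1 + x ^+ 2)^-1 <= (4 ^+ n.-1)^-1.
  move=> ax; rewrite lef_pV2 ?posrE ?exprn_gt0 ?ltr_pwDl ?sqr_ge0//.
  case: n ax => [|n] /= ax; first by rewrite expr0 lerDl sqr_ge0.
  have -> : (4 : R) ^+ n = (2 ^+ n) ^+ 2 by rewrite -exprM mulnC exprM expr2; congr (_ ^+ _); ring.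
  rewrite (le_trans (y := x ^+ 2))// ?lerDr//.
  by rewrite ler_sqr ?nnegrE ?exprn_ge0// (le_trans _ ax)// exprn_ge0.
have w1 (x : R) : 0 <= (1 + x ^+ 2)^-1 <= 1.
  rewrite invr_ge0 invf_le1 ?ltr_pwDl ?sqr_ge0//= addr_ge0 ?sqr_ge0//=.
  by rewrite lerDl sqr_ge0.
have J_ex x : 0 <= x -> exists n, J n x.
  move=> x0; have ex : exists n, x < 2 ^+ n.
    exists (Num.bound x); rewrite (lt_le_trans (archi_boundP x0))//.
    by rewrite -natrX ler_nat ltnW// ltn_expl.
  case: (ex_minnP ex) => n xn nmin; exists n; rewrite /J /= in_itv/= xn andbT.
  case: n xn nmin => [|n] //= _ nmin; rewrite leNgt; apply/negP => /nmin.
  by rewrite ltnn.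
have bnd n x : J n x -> (- lne (F x) * ((1 + x ^+ 2)^-1)%:E <= (d n)%:E)%E.
  rewrite /J /= in_itv/= => /andP[ax xn].
  have x0 : 0 <= x by exact: le_trans ax.
  have /andP[w0 w11] := w1 x.
  have mulle (c e : R) : (- lne (F x) <= c%:E)%E -> c * (1 + x ^+ 2)^-1 <= e ->
      (- lne (F x) * ((1 + x ^+ 2)^-1)%:E <= e%:E)%E.
    move=> h1 h2; apply: (@le_trans _ _ (c%:E * ((1 + x ^+ 2)^-1)%:E)%E).
      by apply: lee_wpmul2r => //; rewrite lee_fin.
    by rewrite -EFinM lee_fin.
  rewrite /d; case: ltnP => nk.
    have [T0 Tq0] := Tq k0 (leqnn _).
    apply: (mulle (q k0)); last by rewrite ler_piMr.
    apply: (lneF x k0) => //; rewrite x0 (le_trans (ltW xn))//.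
    by rewrite ler_eXn2l ?ltr1n// ltnW.
  have [T0 Tq0] := Tq n nk.
  apply: (mulle (q n)); last by rewrite ler_wpM2l// aw.
  by apply: (lneF x n) => //; rewrite x0 ltW.
pose G x := (\sum_(n <oo) (d n * \1_(J n) x)%:E)%E.
have G0 n x : (0 <= (d n * \1_(J n) x)%:E)%E by rewrite lee_fin mulr_ge0.
apply: (@le_lt_trans _ _ (\int[leb]_(x in `[0%R, +oo[) G x)%E).
  apply: integral_le_ge0 => x /=; first by move=> _; apply: nneseries_ge0.
  rewrite in_itv/= andbT => /J_ex[n Jx]; apply: (le_trans (bnd n x Jx)).
  apply: (@le_trans _ _ (\sum_(0 <= k < n.+1) (d k * \1_(J k) x)%:E)%E).
    rewrite big_nat_recr//= indicE mem_set// mulr1 leeDr// sume_ge0//.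
  by apply: nneseries_lim_ge => k _ _; exact: G0.
rewrite integral_nneseries//; last first.
  move=> n; apply/measurable_EFinP; apply: measurable_funM => //.
  by apply: measurable_indic; exact: measurable_itv.
apply: (@le_lt_trans _ _ (2 * (q k0 * 4 ^+ k0) + 4 * C)%:E); last by rewrite ltry.
have mJ n : measurable (J n : set (measurableTypeR R)) by exact: measurable_itv.
apply: lime_le; first by apply: is_cvg_nneseries => n _ _; apply: integral_ge0.
apply: nearW => N.
(* Both ranges of n take one summable form: d_n 2^n is at most q_k0 4^k0 / 2^n below k0 and 4 q_n /
   2^n from k0 on. *)
have term n : (\int[leb]_(x in `[0%R, +oo[) (d n * \1_(J n) x)%:E <=
    ((q k0 * 4 ^+ k0 + 4 * q n) / 2 ^+ n)%:E)%E.
  under eq_integral do rewrite EFinM.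
  rewrite ge0_integralZl_EFin//; last first.
    by apply/measurable_EFinP; apply: measurable_indic; exact: measurable_itv.
  rewrite integral_indic//.
  apply: (@le_trans _ _ ((d n)%:E * (2 ^+ n)%:E)%E).
    apply: lee_wpmul2l; first by rewrite lee_fin.
    apply: (@le_trans _ _ (leb (J n))); first by apply: le_measure; rewrite ?inE//; apply: measurableI.
    rewrite lebesgue_measure_itv/= lte_fin; case: ifP => _.
      by rewrite -EFinB lee_fin gerBl.
    by rewrite lee_fin exprn_ge0.
  rewrite -EFinM lee_fin.
  have p0 : 0 < (2 : R) ^+ n by rewrite exprn_gt0.
  have e4 : (2 : R) ^+ n * 2 ^+ n = 4 ^+ n by rewrite -exprMn; congr (_ ^+ _); ring.
  rewrite ler_pdivlMr// -mulrA e4 /d; case: ltnP => nk.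
    apply: ler_wpDr; first by rewrite mulr_ge0.
    by rewrite ler_wpM2l// ler_weXn2l ?ler1n// ltnW.
  apply: ler_wpDl; first by rewrite mulr_ge0// exprn_ge0.
  case: (n) => [|m] /=; first by rewrite expr0 divr1 mulr1; have := q0 0%N; lra.
  by rewrite exprS mulrA mulrAC divfK ?expf_neq0// mulrC.
have S2 : \sum_(0 <= n < N) (2 ^+ n)^-1 <= 2 :> R.
  suff : \sum_(0 <= n < N) (2 ^+ n)^-1 <= 2 - 2 * (2 ^+ N)^-1 :> R.
    by move=> /le_trans; apply; rewrite gerBl mulr_ge0// invr_ge0 exprn_ge0.
  elim: (N) => [|m IH]; first by rewrite big_geq// expr0 invr1; lra.
  rewrite big_nat_recr//= exprS invfM mulrA divff// mul1r; lra.
apply: (@le_trans _ _ (\sum_(0 <= n < N) ((q k0 * 4 ^+ k0 + 4 * q n) / 2 ^+ n)%:E)%E).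
  by apply: lee_sum => n _; exact: term.
rewrite sumEFin lee_fin.
under eq_bigr do rewrite mulrDl -[4 * _ / _]mulrA.
rewrite big_split/= -!mulr_sumr lerD ?ler_pM2l//.
by rewrite mulrC ler_wpM2r// mulr_ge0// exprn_ge0.
Qed.

(** By contraposition: bounded sums have terms tending to 0, whereas the exponential alone would
    contribute a/8 each time. So from some k0 on the maximum is the tail itself, and the logarithmic
    integral is dominated by a convergent series. [F] is abstract so that left rays, once reflected,
    are covered too. *)
Lemma tail_diverges_log f (F : R -> \bar R) :
    integrableR f -> (forall t, 0 <= f t) ->
    (forall x, (tail f x)%:E <= F x)%E ->
    (\int[leb]_(x in `[0%R, +oo[) (- lne (F x) * ((1 + x ^+ 2)^-1)%:E) = +oo)%E ->
  tail_diverges f.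
Proof.
move=> fi f0 tF; apply: contraPP => /existsNP[a /not_implyP[a0 /existsNP[B HB]]].
pose tau k := Num.max (tail f (2 ^+ k)) (expR (- (a * 2 ^+ k / 8))).
have {}HB K : \sum_(5 <= k < K) - ln (tau k) / 2 ^+ k <= B.
  by rewrite leNgt; apply/negP => h; apply: HB; exists K; exact: ltW.
set I := Rintegral leb setT f.
have I0 : 0 <= I by apply: Rintegral_ge0.
pose L := ln (I + 1).
have L0 : 0 <= L by rewrite ln_ge0// lerDr.
have tau0 k : 0 < tau k by rewrite lt_max expR_gt0 orbT.
have tauI k : tau k <= I + 1.
  rewrite ge_max; apply/andP; split.
    by rewrite (le_trans (tail_le_total _ fi f0))// lerDl.
  apply: (@le_trans _ _ 1); last by rewrite lerDr.
  by rewrite -expR0 ler_expR oppr_le0 divr_ge0// mulr_ge0 ?ltW// exprn_gt0.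
(* The shift by [L] makes the terms nonnegative and raises the sums by at most [L]. *)
pose q k := L - ln (tau k).
have q0 k : 0 <= q k by rewrite subr_ge0 ler_ln// posrE// ltr_wpDl.
have p0 k : 0 <= q k / 2 ^+ k by rewrite divr_ge0// exprn_ge0.
have psum K : \sum_(5 <= k < K) q k / 2 ^+ k <= B + L.
  under eq_bigr do rewrite /q mulrDl.
  rewrite big_split/= -mulr_sumr addrC lerD// -[leRHS]mulr1.
  by rewrite ler_wpM2l// geometric_sum_le1.
have a8 : 0 < a / 8 by rewrite divr_gt0.
have [k0 k05 k0P] := small_terms a8 p0 psum.
apply/eqP; rewrite lt_eqF//.
apply: (@log_integral_bound F (fun k => tail f (2 ^+ k)) q _
   (\sum_(0 <= k < 5) q k / 2 ^+ k + (B + L)) k0) => //.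
- move=> x n /andP[x0 xn]; apply: le_trans (tF x).
  by rewrite lee_fin; exact: le_tail.
- move=> k /k0P; rewrite ltr_pdivrMr ?exprn_gt0// => qk.
  have tk : expR (- (a * 2 ^+ k / 8)) < tail f (2 ^+ k).
    rewrite ltNge; apply/negP => h; move: qk; rewrite /q /tau max_r// expRK; lra.
  have tkE : tau k = tail f (2 ^+ k) by rewrite /tau max_l// ltW.
  by rewrite -tkE tau0; split=> //; rewrite /q; lra.
- move=> K; have [K5|K5] := leqP 5 K.
    by rewrite (big_cat_nat (leq0n 5) K5)/= lerD2l.
  rewrite (@le_trans _ _ (\sum_(0 <= k < 5) q k / 2 ^+ k))//.
    by rewrite (big_cat_nat (leq0n K) (ltnW K5))/= lerDl sumr_ge0.
  by rewrite lerDl; have := psum 5; rewrite big_geq.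
Qed.

End log_integral.

(** * The bispectrum *)

Section bispectrum.
Variable R : realType.
Implicit Types (f : R -> R).

Definition ft f (th : R) : R[i] := complex_integral (fun t => (f t)%:C * cis (th * t)).

Lemma ft_cintegrable f th : integrableR f ->
  cintegrable (fun t => (f t)%:C * cis (th * t)).
Proof.
move=> fi; have := cintegrable_cis (- th) (cintegrable_real fi).
by under eq_fun do rewrite mulNr opprK.
Qed.

(** The kernel A + Re(c exp(i th y)) keeps its shape under integration against [f]: A is multiplied
    by the integral of f and c by its transform. The triple integral is then three such steps. *)
Lemma integral_step f (s A : R) (c : R[i]) (th : R) :
    integrableR f ->
  (\int[leb]_y (s * (f y * (A + Re (c * cis (th * y)))))%:E =
   (s * (A * Rintegral leb setT f + Re (c * ft f th)))%:E)%E.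
Proof.
move=> fi; have iF := ft_cintegrable th fi.
have [i1 _] := cintegrableZ c iF.
have i2 : leb.-integrable setT (fun y => (A * f y)%:E).
  by under eq_fun do rewrite EFinM; apply: integrableZl.
have i3 : leb.-integrable setT
    (fun y => (A * f y + Re (c * ((f y)%:C * cis (th * y))))%:E).
  by under eq_fun do rewrite EFinD; apply: integrableD.
have E y : s * (f y * (A + Re (c * cis (th * y)))) =
    s * (A * f y + Re (c * ((f y)%:C * cis (th * y)))).
  by case: c {i1 i3} => p q /=; ring.
under eq_integral do rewrite E EFinM.
rewrite integralZl// -[RHS]EFinM EFinM; congr (_ * _)%E.
rewrite -[LHS]fineK ?integrable_fin_num//; congr EFin.
rewrite -[LHS]/(Rintegral leb setT _) RintegralD//; congr (_ + _).
  by rewrite RintegralZl.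
by rewrite -complex_integralZ.
Qed.

Variable f : R -> R.
Hypothesis fi : integrableR f.
Hypothesis f0 : forall t, 0 <= f t.

Let mf : measurable_fun setT f.
Proof. by apply/measurable_EFinP; move/measurable_int: fi. Qed.

Let If := Rintegral leb setT f.

Variables (c : R[i]) (c1 : normc c <= 1) (th1 th2 : R).

(* Nonnegative real kernels, so that Tonelli's theorem applies to the deck; those
   for c = 0, 1, -i determine the integral of f and the bispectrum. *)
Definition deck_kernel (x : R * R) := 1 + Re (c * cis (th1 * x.1 + th2 * x.2)).

Lemma deck_kernel_ge0 x : 0 <= deck_kernel x.
Proof.
rewrite /deck_kernel; have := normc_Re (c * cis (th1 * x.1 + th2 * x.2)).
rewrite normcM normc_cis mulr1 => /le_trans/(_ c1); rewrite ler_norml => /andP[h _].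
by lra.
Qed.

Lemma measurable_deck_kernel : measurable_fun setT deck_kernel.
Proof.
apply: measurable_funD => //.
suff [] : cmeasurable (fun x : R * R => c * cis (th1 * x.1 + th2 * x.2)) by [].
apply: cmeasurableM; first exact: cmeasurable_cst.
apply: cmeasurable_cis; apply: measurable_funD; apply: measurable_funM => //.
Qed.

Definition deck_integrand (z : (R * R) * R) : \bar R :=
  (f z.2 * f (z.2 + z.1.1) * f (z.2 + z.1.2) * deck_kernel z.1)%:E.

Lemma deck_integrand_ge0 z : (0 <= deck_integrand z)%E.
Proof. by rewrite lee_fin !mulr_ge0// deck_kernel_ge0. Qed.

Lemma measurable_deck_integrand : measurable_fun setT deck_integrand.
Proof.
apply/measurable_EFinP; apply: measurable_funM; last first.
  exact: (measurableT_comp measurable_deck_kernel).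
apply: measurable_funM.
  apply: measurable_funM; first exact: (measurableT_comp mf).
  apply: (measurableT_comp mf); apply: measurable_funD => //.
  exact: (measurableT_comp measurable_fst).
apply: (measurableT_comp mf); apply: measurable_funD => //.
exact: (measurableT_comp measurable_snd).
Qed.

Lemma deck_weighted x : (deck3 f x * (deck_kernel x)%:E = \int[leb]_t deck_integrand (x, t))%E.
Proof.
rewrite /deck3 muleC -ge0_integralZl_EFin//; first 1 last.
- by move=> t _; rewrite lee_fin !mulr_ge0.
- apply/measurable_EFinP; apply: measurable_funM; first apply: measurable_funM => //.
    exact: (measurableT_comp mf (@measurable_shiftr R x.1)).
  exact: (measurableT_comp mf (@measurable_shiftr R x.2)).
- exact: deck_kernel_ge0.
by apply: eq_integral => t _; rewrite /deck_integrand -EFinM mulrC.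
Qed.

Lemma measurable_deck_weighted :
  measurable_fun setT (fun x => (deck3 f x * (deck_kernel x)%:E)%E).
Proof.
under eq_fun do rewrite deck_weighted.
exact: (measurable_fun_fubini_tonelli_F (m2 := leb) _ measurable_deck_integrand deck_integrand_ge0).
Qed.

Lemma measurable_step (s A th : R) (e : R[i]) :
  measurable_fun setT (fun y => (s * (f y * (A + Re (e * cis (th * y)))))%:E).
Proof.
apply/measurable_EFinP; apply: measurable_funM => //; apply: measurable_funM => //.
apply: measurable_funD => //.
suff [] : cmeasurable (fun y : R => e * cis (th * y)) by [].
apply: cmeasurableM; first exact: cmeasurable_cst.
by apply: cmeasurable_cis; exact: measurable_funM.
Qed.

Lemma integral_step_shift (s A th t : R) (e : R[i]) :
  (\int[leb]_y (s * (f (y + t) * (A + Re (e * cis (th * (y + t))))))%:E =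
   (s * (A * If + Re (e * ft f th)))%:E)%E.
Proof.
by rewrite -integral_step//; exact: (integral_shift t (measurable_step s A th e)).
Qed.

(** Tonelli's theorem moves t outermost. The substitutions x2 + t and x1 + t extract the transforms
    at th2 and th1 and leave the phase exp(-i (th1 + th2) t), which the integral over t turns into
    the third factor. *)
Lemma integral_deck_weighted :
  (\int[(leb \x leb)%E]_x (deck3 f x * (deck_kernel x)%:E) =
   (If ^+ 3 + Re (c * (ft f th1 * ft f th2 * ft f (- th1 - th2))))%:E)%E.
Proof.
have inner2 t x1 : (\int[leb]_x2 deck_integrand ((x1, x2), t) =
    ((f t * f (t + x1)) *
     (If + Re (c * cis (th1 * x1 - th2 * t) * ft f th2)))%:E)%E.
  rewrite -[X in (_ * (X + _))%:E]mul1r -(integral_step_shift _ _ _ t).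
  apply: eq_integral => x2 _; rewrite /deck_integrand /deck_kernel /=.
  congr EFin; rewrite -!mulrA [t + x2]addrC; congr (_ * (_ * (_ * (_ + Re _)))).
  by rewrite -cisD; congr (_ * cis _); ring.
pose G (p : R * R) : \bar R := ((f p.2 * f (p.2 + p.1)) *
     (If + Re (c * cis (th1 * p.1 - th2 * p.2) * ft f th2)))%:E.
have G0 p : (0 <= G p)%E.
  case: p => x1 t; rewrite /G /= -inner2; apply: integral_ge0 => x2 _.
  exact: deck_integrand_ge0.
have mG : measurable_fun setT G.
  apply/measurable_EFinP; apply: measurable_funM.
    apply: measurable_funM; first exact: (measurableT_comp mf).
    by apply: (measurableT_comp mf); exact: measurable_funD.
  apply: measurable_funD => //.
  suff [] : cmeasurable (fun p : R * R => c * cis (th1 * p.1 - th2 * p.2) * ft f th2) by [].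
  apply: cmeasurableM; last exact: cmeasurable_cst.
  apply: cmeasurableM; first exact: cmeasurable_cst.
  by apply: cmeasurable_cis; apply: measurable_funB; exact: measurable_funM.
have W0 x : (0 <= deck3 f x * (deck_kernel x)%:E)%E.
  by rewrite deck_weighted; apply: integral_ge0 => t _; exact: deck_integrand_ge0.
have -> := @fubini_tonelli1 _ _ _ _ R (@lebesgue_measure R) (@lebesgue_measure R)
  _ measurable_deck_weighted W0.
rewrite /fubini_F.
have E1 x1 : (\int[leb]_x2 (deck3 f (x1, x2) * (deck_kernel (x1, x2))%:E) =
    \int[leb]_t G (x1, t))%E.
  under eq_integral do rewrite deck_weighted.
  have mh : measurable_fun setT (fun p : R * R => deck_integrand ((x1, p.1), p.2)).
    apply: (measurableT_comp measurable_deck_integrand).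
    apply: measurable_fun_pair => //; apply: measurable_fun_pair => //.
  have := @fubini_tonelli _ _ _ _ R (@lebesgue_measure R) (@lebesgue_measure R)
    _ mh (fun p => deck_integrand_ge0 _).
  by move=> /= ->; apply: eq_integral => t _; rewrite inner2.
under eq_integral do rewrite E1.
have -> := @fubini_tonelli _ _ _ _ R (@lebesgue_measure R) (@lebesgue_measure R) _ mG G0.
have inner1 t : (\int[leb]_x1 G (x1, t) =
    (f t * (If * If + Re (c * cis (- (th1 + th2) * t) * ft f th2 * ft f th1)))%:E)%E.
  rewrite -(integral_step_shift _ _ _ t).
  apply: eq_integral => x1 _; rewrite /G /=; congr EFin; rewrite -mulrA [t + x1]addrC.
  congr (_ * (_ * (_ + Re _))).
  rewrite (_ : th1 * x1 - th2 * t = - (th1 + th2) * t + th1 * (x1 + t)); last by ring.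
  by rewrite cisD; ring.
under eq_integral do rewrite inner1.
rewrite (_ : If ^+ 3 = If * If * If); last by rewrite !exprSr expr0 mul1r.
have -> : c * (ft f th1 * ft f th2 * ft f (- th1 - th2)) =
  (c * ft f th2 * ft f th1) * ft f (- th1 - th2) by ring.
rewrite -[X in X%:E]mul1r -(integral_step _ _ _ _ fi); apply: eq_integral => t _.
congr EFin; rewrite mul1r; congr (_ * (_ + Re _)).
by rewrite (_ : - (th1 + th2) = - th1 - th2); ring.
Qed.

End bispectrum.

Lemma deck_bispectrum (R : realType) (f g : R -> R) :
    integrableR f -> (forall t, 0 <= f t) ->
    integrableR g -> (forall t, 0 <= g t) ->
    {ae (leb \x leb)%E, forall x : R * R, deck3 g x = deck3 f x} ->
  Rintegral leb setT g = Rintegral leb setT f /\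
  forall a b, ft g a * ft g b * ft g (- a - b) = ft f a * ft f b * ft f (- a - b).
Proof.
move=> fi f0 gi g0 [N [mN N0 hN]].
have key c (c1 : normc c <= 1) a b :
    (Rintegral leb setT g) ^+ 3 + Re (c * (ft g a * ft g b * ft g (- a - b))) =
    (Rintegral leb setT f) ^+ 3 + Re (c * (ft f a * ft f b * ft f (- a - b))).
  apply: EFin_inj; rewrite -!integral_deck_weighted//.
  apply: ae_eq_integral => //; try exact: measurable_deck_weighted.
  exists N; split => // x /= nx; apply: hN => /= e; apply: nx => _; by rewrite e.
have I3 : Rintegral leb setT g = Rintegral leb setT f.
  have n0 : normc (0 : R[i]) <= 1 by rewrite normc0.
  have := key 0 n0 0 0; rewrite !mul0r !addr0 => e.
  have I0 h : (forall t, 0 <= h t) -> 0 <= Rintegral leb setT h.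
    by move=> h0; apply: Rintegral_ge0.
  by apply: (pexpIrn _ _ _ e) => //; rewrite qualifE/=; exact: I0.
split=> // a b; move: (ft g a * _ * _) (ft f a * _ * _) (fun c c1 => key c c1 a b) => p q {}key.
apply/eqP; rewrite eq_complex; apply/andP; split; apply/eqP.
  have n1 : normc (1 : R[i]) <= 1 by rewrite normc1.
  by have := key 1 n1; rewrite I3 !mul1r => /addrI.
have ni : normc (- 'i : R[i]) <= 1.
  by rewrite normcN /normc /= expr0n add0r expr1n sqrtr1.
have := key _ ni; rewrite I3 => /addrI.
by case: p q {key} => [p1 p2] [q1 q2] /=; lra.
Qed.

(** * From equal bispectra to a local phase *)

Section phase.
Variable R : realType.

Lemma unit_cis (z : R[i]) : normc z = 1 -> 0 < Re z ->
  exists2 b, z = cis b & - (pi / 2) <= b <= pi / 2.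
Proof.
case: z => p q n1 /= p0.
have e : p ^+ 2 + q ^+ 2 = 1.
  by have := sqr_normc (p +i* q); rewrite n1 expr1n /= => <-.
have q1 : -1 <= q <= 1 by have := sqr_ge0 p; nra.
exists (asin q); last by rewrite asin_geNpi2// asin_lepi2.
rewrite /cis asinK// cos_asin//; congr (_ +i* _).
by rewrite -e addrK sqrtr_sqr gtr0_norm.
Qed.

Lemma sqr_inj_Re_gt0 (z w : R[i]) : 0 < Re z -> 0 < Re w ->
  z ^+ 2 = w ^+ 2 -> z = w.
Proof.
move=> z0 w0 /eqP; rewrite eqf_sqr => /orP[/eqP//|/eqP e]; exfalso.
by move: z0; rewrite e; case: w w0 {e} => p q /=; lra.
Qed.

(* On dyadic multiples of d the character is determined by its value at d, square
   roots with positive real part being unique; other points are reduced to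
   arbitrarily small ones. *)
Lemma local_character (phi : R -> R[i]) (d : R) : 0 < d ->
    (forall x, 0 <= x <= d -> normc (phi x) = 1) ->
    (forall x, 0 <= x <= d -> 0 < Re (phi x)) ->
    (forall a b, 0 <= a -> 0 <= b -> a + b <= d -> phi a * phi b = phi (a + b)) ->
  exists al, forall x e, 0 <= x <= d -> 0 < e ->
    exists2 y, 0 <= y < e & 
      [/\ y <= d & phi x * cis (- al * x) = phi y * cis (- al * y)].
Proof.
move=> d0 phi1 phip phiM.
have dd : 0 <= d <= d by lra.
have [b eb bpi] := unit_cis (phi1 _ dd) (phip _ dd).
pose al := b / d; exists al.
pose chi x := phi x * cis (- al * x).
have chiM x y : 0 <= x -> 0 <= y -> x + y <= d -> chi x * chi y = chi (x + y).
  move=> x0 y0 xy; rewrite /chi -phiM// mulrDr cisD.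
  by rewrite !mulrA; congr (_ * _); rewrite -!mulrA; congr (_ * _); rewrite mulrC.
have p2 k : (0 : R) < 2 ^- k by rewrite invr_gt0 exprn_gt0.
have p2le k : (2 : R) ^- k <= 1 by rewrite invf_le1 ?exprn_gt0// exprn_ege1// ler1n.
have dk0 k : 0 <= d * 2 ^- k <= d.
  by rewrite mulr_ge0 ?(ltW d0) ?(ltW (p2 k))//= ler_piMr ?(ltW d0).
have phik k : phi (d * 2 ^- k) = cis (b * 2 ^- k).
  elim: k => [|k IH]; first by rewrite expr0 invr1 !mulr1.
  have half z : z * 2 ^- k.+1 + z * 2 ^- k.+1 = z * 2 ^- k :> R.
    by rewrite exprS invfM; field; rewrite expf_neq0// pnatr_eq0.
  apply: sqr_inj_Re_gt0.
  - exact: phip.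
  - rewrite /=; apply: cos_gt0_pihalf.
    have h := p2le k; have h0 := p2 k; have pi0 := @pi_gt0 R.
    rewrite exprS invfM; move: (2 ^- k) h h0 => z h h0.
    by apply/andP; split; nra.
  - rewrite !expr2 -cisD half -IH phiM ?half//.
    - by case/andP: (dk0 k.+1).
    - by case/andP: (dk0 k.+1).
    - by case/andP: (dk0 k).
have chik k : chi (d * 2 ^- k) = 1.
  rewrite /chi phik -cisD (_ : _ + _ = 0) ?cis0//.
  rewrite mulrA -mulrDl (_ : b + - al * d = 0) ?mul0r// /al mulNr divfK ?subrr//.
  by rewrite gt_eqF.
have chikm k m : m%:R * (d * 2 ^- k) <= d -> chi (m%:R * (d * 2 ^- k)) = 1.
  have /andP[dk _] := dk0 k.
  elim: m => [|m IH] h.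
    (* [chi 0] is idempotent and of modulus 1, hence equal to 1. *)
    have := @chiM 0 0; rewrite addr0 mul0r => h0.
    have {h0} /eqP := h0 (lexx _) (lexx _) (ltW d0).
    rewrite -subr_eq0 -[X in _ - X]mulr1 -mulrBr mulf_eq0 subr_eq0 => /orP[/eqP e0|/eqP//].
    have : normc (chi 0) = 1 by rewrite normcM normc_cis mulr1 phi1//; lra.
    by rewrite e0 normc0 => /esym/eqP; rewrite oner_eq0.
  have em : m.+1%:R * (d * 2 ^- k) = m%:R * (d * 2 ^- k) + d * 2 ^- k.
    by rewrite -natr1 mulrDl mul1r.
  rewrite em in h *; rewrite -chiM// ?chik ?mulr1 ?IH//; first by lra.
  by rewrite mulr_ge0.
move=> x e /andP[x0 xd] e0.
have [k ke] : exists k, d * 2 ^- k < e.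
  have [k hk] := ltr_add_invr (y := 0) (x := e / d) (divr_gt0 e0 d0).
  exists k; rewrite mulrC -ltr_pdivlMr//; move: hk; rewrite add0r; apply: le_lt_trans.
  rewrite lef_pV2 ?posrE ?exprn_gt0// -natrX ler_nat; exact: ltn_expl.
have s0 : 0 < d * 2 ^- k by rewrite mulr_gt0.
pose m := Num.truncn (x / (d * 2 ^- k)).
have /andP[m1 m2] := truncn_itv (divr_ge0 x0 (ltW s0)).
rewrite ler_pdivlMr// in m1; rewrite ltr_pdivrMr// -natr1 mulrDl mul1r in m2.
have y0 : 0 <= x - m%:R * (d * 2 ^- k) by rewrite subr_ge0.
exists (x - m%:R * (d * 2 ^- k)).
  by rewrite y0 /=; apply: le_lt_trans ke; rewrite lerBlDl ltW.
split; first by apply: le_trans xd; rewrite gerBl mulr_ge0// ltW.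
have mm0 : 0 <= m%:R * (d * 2 ^- k) by rewrite mulr_ge0// ltW.
have := chiM _ _ y0 mm0; rewrite subrK => /(_ xd).
by rewrite chikm ?mulr1//; exact: le_trans xd.
Qed.

Lemma frequently_eq0 (h : R -> R) : {for 0, continuous h} ->
  (forall e, 0 < e -> exists2 y, 0 <= y < e & h y = 0) -> h 0 = 0.
Proof.
move=> ch hz; apply/eqP; apply: contrapT => /negP h0.
have : \forall x \near (0 : R), `|h 0 - h x| < `|h 0|.
  by move/cvgr_dist_lt : ch; apply; rewrite normr_gt0.
move=> /nbhs_ballP[e /= e0 he]; have [y /andP[y0 ye] hy] := hz _ e0.
have : ball 0 e y by rewrite /ball /= sub0r normrN ger0_norm.
by move=> /he; rewrite /= hy subr0 ltxx.
Qed.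

(** P = B conj(A) is positive at 0, so its real part is positive nearby; there the ratio phi = P /
    |A|^2 is unimodular, and the bispectrum at (a, b, -a-b) makes it multiplicative. Continuity at 0
    then disposes of the small remainder left by [local_character]. *)
Lemma same_bispectrum_local (A B : R -> R[i]) (I : R) : 0 < I ->
    {for 0, continuous (fun x => Re (A x))} ->
    {for 0, continuous (fun x => Im (A x))} ->
    {for 0, continuous (fun x => Re (B x))} ->
    {for 0, continuous (fun x => Im (B x))} ->
    A 0 = I%:C -> B 0 = I%:C ->
    (forall x, A (- x) = conjc (A x)) -> (forall x, B (- x) = conjc (B x)) ->
    (forall x, normc (B x) = normc (A x)) ->
    (forall a b, B a * B b * B (- a - b) = A a * A b * A (- a - b)) ->
  exists2 d, 0 < d & exists al, forall x, `|x| <= d ->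
    A x != 0 /\ B x = cis (al * x) * A x.
Proof.
move=> I0 cA1 cA2 cB1 cB2 A0 B0 AJ BJ AB bis.
pose P x := B x * conjc (A x).
have cP1 : {for 0, continuous (fun x => Re (P x))}.
  rewrite (_ : (fun _ => _) = (fun x => Re (B x) * Re (A x) +
    Im (B x) * Im (A x))).
    by apply: cvgD; apply: cvgM.
  by apply/funext => x; rewrite /P; case: (B x) (A x) => [p q] [r s] /=; ring.
have cP2 : {for 0, continuous (fun x => Im (P x))}.
  rewrite (_ : (fun _ => _) = (fun x => Im (B x) * Re (A x) -
    Re (B x) * Im (A x))).
    by apply: cvgB; apply: cvgM.
  by apply/funext => x; rewrite /P; case: (B x) (A x) => [p q] [r s] /=; ring.
have P0 : P 0 = (I ^+ 2)%:C by rewrite /P A0 B0 conjc_real -rmorphM expr2.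
have I2 : 0 < I ^+ 2 by rewrite exprn_gt0.
have [d d0 Pd] : exists2 d, 0 < d & forall x, `|x| <= d -> 0 < Re (P x).
  have : \forall x \near (0 : R), 0 < Re (P x).
    by move/cvgr_gt : cP1; apply; rewrite P0.
  move=> /nbhs_ballP[e /= e0 he]; exists (e / 2); first by rewrite divr_gt0.
  move=> x xe; apply: he; rewrite /ball /= sub0r normrN; lra.
have nA x : `|x| <= d -> A x != 0.
  by move=> /Pd; rewrite /P; apply: contraTneq => ->; rewrite conjc0 mulr0 ltxx.
have nA2 x : A x * conjc (A x) = (normc (A x) ^+ 2)%:C.
  rewrite sqr_normc; case: (A x) => p q.
  by apply/eqP; rewrite eq_complex /=; apply/andP; split; apply/eqP; ring.
have nA0 x : `|x| <= d -> 0 < normc (A x) by move=> /nA; rewrite normc_gt0.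
pose n x := normc (A x) ^+ 2.
have n0 x : `|x| <= d -> 0 < n x by move=> h; rewrite exprn_gt0// nA0.
pose phi x := ((n x)^-1)%:C * P x.
have nphi x : `|x| <= d -> (n x)%:C * phi x = P x.
  by move=> h; rewrite mulrA -rmorphM/= mulfV ?mul1r// gt_eqF// n0.
have Bphi x : `|x| <= d -> B x = phi x * A x.
  move=> h; apply: (@mulfI _ (n x)%:C).
    by rewrite (inj_eq (@complexI R)) gt_eqF// n0.
  by rewrite mulrA nphi// /P -mulrA [_ * A x]mulrC nA2 mulrC.
have nd x : 0 <= x <= d -> `|x| <= d by case/andP => x0 xd; rewrite ger0_norm.
have phi1 x : `|x| <= d -> normc (phi x) = 1.
  move=> h; have := congr1 (@normc R) (Bphi x h); rewrite AB normcM.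
  by rewrite -[LHS]mul1r => /mulIf <-//; rewrite gt_eqF// nA0.
have [] := @local_character phi d d0.
- by move=> x /nd; exact: phi1.
- move=> x /nd h; rewrite /phi; move: (Pd x h); case: (P x) => p q /= p0.
  by rewrite mul0r subr0 mulr_gt0// invr_gt0 n0.
- move=> a b a0 b0 ab.
  have ha : `|a| <= d by apply: nd; lra.
  have hb : `|b| <= d by apply: nd; lra.
  have hc : `|a + b| <= d by apply: nd; lra.
  have := bis a b; rewrite -opprD AJ BJ (Bphi a)// (Bphi b)// (Bphi (a + b))//.
  rewrite rmorphM/= => e.
  have {}e : phi a * phi b * conjc (phi (a + b)) = 1.
    apply: (@mulIf _ (A a * A b * conjc (A (a + b)))).
      by rewrite !mulf_neq0 ?nA// conjc_eq0 nA.
    by rewrite [RHS]mul1r -[RHS]e; ring.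
  have u : conjc (phi (a + b)) * phi (a + b) = 1.
    by rewrite mulrC mulcJ phi1// expr1n.
  by rewrite -[LHS]mulr1 -u mulrA e mul1r.
move=> al hal; exists d => //; exists al.
have pos x : 0 <= x <= d -> phi x = cis (al * x).
  move=> xd; pose c := phi x * cis (- al * x).
  (* [G y] is n y times (phi y cis(-al y) - c), written without division so that continuity at 0 is
     inherited from A and B. It has zeros arbitrarily close to 0, so [G 0 = 0], and P 0 = n 0 gives
     c = 1. *)
  pose G y := P y * cis (- al * y) - (n y)%:C * c.
  have cc : continuous (fun y : R => cos (- al * y)).
    by move=> y; apply: continuous_comp; [exact: mulrl_continuous|exact: continuous_cos].
  have cs : continuous (fun y : R => sin (- al * y)).
    by move=> y; apply: continuous_comp; [exact: mulrl_continuous|exact: continuous_sin].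
  have cn : {for 0, continuous n}.
    rewrite (_ : n = fun x => Re (A x) * Re (A x) + Im (A x) * Im (A x)).
      by apply: cvgD; apply: cvgM.
    by apply/funext => y; rewrite /n sqr_normc !expr2.
  have Gz e : 0 < e -> exists2 y, 0 <= y < e & G y = 0.
    move=> e0; have [y ye [yd cy]] := hal x e xd e0; exists y => //.
    have yd' : `|y| <= d by apply: nd; case/andP: ye => -> _.
    by rewrite /G /c cy -nphi// -mulrA subrr.
  have cG1 : {for 0, continuous (fun y => Re (G y))}.
    rewrite (_ : (fun _ => _) = (fun y => Re (P y) * cos (- al * y) -
      Im (P y) * sin (- al * y) - n y * Re c)).
      apply: cvgB; first by apply: cvgB; apply: cvgM => //; [exact: cc|exact: cs].
      by apply: cvgM => //; exact: cvg_cst.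
    by apply/funext => y; rewrite /G /cis; case: (P y) (c) => [p q] [r s] /=; ring.
  have cG2 : {for 0, continuous (fun y => Im (G y))}.
    rewrite (_ : (fun _ => _) = (fun y => Re (P y) * sin (- al * y) +
      Im (P y) * cos (- al * y) - n y * Im c)).
      apply: cvgB; first by apply: cvgD; apply: cvgM => //; [exact: cs|exact: cc].
      by apply: cvgM => //; exact: cvg_cst.
    by apply/funext => y; rewrite /G /cis; case: (P y) (c) => [p q] [r s] /=; ring.
  have G0 : G 0 = 0.
    apply/eqP; rewrite eq_complex; apply/andP; split; apply/eqP.
      by apply: (frequently_eq0 cG1) => e /Gz[y ye Gy]; exists y; rewrite ?Gy.
    by apply: (frequently_eq0 cG2) => e /Gz[y ye Gy]; exists y; rewrite ?Gy.
  have c1 : c = 1.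
    have nz : (n 0)%:C != 0.
      by rewrite (inj_eq (@complexI R)) gt_eqF// n0// normr0 ltW.
    apply: (mulfI nz); rewrite mulr1.
    move/eqP: G0; rewrite /G mulr0 cis0 mulr1 subr_eq0 => /eqP <-.
    by rewrite P0 /n A0 normc_real gtr0_norm.
  apply: (@mulIf _ (cis (- al * x))); first by rewrite cis_eq0.
  by rewrite -/c c1 -cisD mulNr subrr cis0.
move=> x xd; split; first exact: nA.
have [x0|x0] := leP 0 x.
  by rewrite Bphi// pos// x0 (le_trans _ xd)// ler_norm.
have xd' : `|- x| <= d by rewrite normrN.
rewrite -[in LHS](opprK x) BJ Bphi// pos.
  by rewrite conjcM AJ conjcK -cisN mulrN opprK.
by rewrite (le_trans _ xd') ?ler_norm// andbT oppr_ge0 ltW.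
Qed.

End phase.

(** * From the phase to a translation *)

Section translation.
Variable R : realType.

Lemma same_bispectrum_translate (A B : R -> R[i]) (I : R) : 0 < I ->
    {for 0, continuous (fun x => Re (A x))} ->
    {for 0, continuous (fun x => Im (A x))} ->
    {for 0, continuous (fun x => Re (B x))} ->
    {for 0, continuous (fun x => Im (B x))} ->
    A 0 = I%:C -> B 0 = I%:C ->
    (forall x, A (- x) = conjc (A x)) -> (forall x, B (- x) = conjc (B x)) ->
    (forall a b, B a * B b * B (- a - b) = A a * A b * A (- a - b)) ->
    (forall u v, u < v -> exists2 x, u < x < v & A x != 0) ->
  exists al, forall x, B x = cis (al * x) * A x.
Proof.
move=> I0 cA1 cA2 cB1 cB2 A0 B0 AJ BJ bis dense.
have AB x : normc (B x) = normc (A x).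
  have := bis x (- x); rewrite subrr A0 B0 AJ BJ !mulcJ.
  rewrite -!rmorphM/= => /complexI /mulIf; rewrite gt_eqF// => /(_ isT) /eqP.
  by rewrite eqrXn2 ?normc_ge0// => /eqP.
have [d d0 [al loc]] := same_bispectrum_local I0 cA1 cA2 cB1 cB2 A0 B0 AJ BJ AB bis.
exists al.
have reach n x : 0 <= x -> x <= d + n%:R * (d / 2) -> B x = cis (al * x) * A x.
  elim: n x => [|n IH] x x0 xn.
    by have [] := loc x _; rewrite ?ger0_norm//; lra.
  have [xd|xd] := leP x d; first by have [] := loc x _; rewrite ?ger0_norm//.
  rewrite -natr1 mulrDl mul1r in xn.
  have [Ax|Ax] := eqVneq (A x) 0.
    have : normc (B x) = 0 by rewrite AB Ax normc0.
    by move=> /eqP; rewrite normc_eq0 Ax mulr0 => /eqP.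
  (* This window keeps x - a in ]d/2, d[, where the local identity holds, and a in the range covered
     by the previous stage. *)
  have [a /andP[a1 a2] Aa] := dense (x - d) (x - d / 2) ltac:(lra).
  have [Ab Bb] := loc (x - a) ltac:(by rewrite ger0_norm; lra).
  have Ba := IH a ltac:(lra) ltac:(lra).
  have := bis a (x - a); rewrite (_ : - a - (x - a) = - x); last by ring.
  rewrite AJ BJ Ba Bb => e.
  have {}e : cis (al * x) * conjc (B x) = conjc (A x).
    apply: (@mulfI _ (A a * A (x - a))); first by rewrite mulf_neq0.
    rewrite -[RHS]e (_ : al * x = al * a + al * (x - a)); last by ring.
    by rewrite cisD; ring.
  have {e} /(congr1 (@conjc R)) : conjc (B x) = cis (- (al * x)) * conjc (A x).
    by rewrite -e mulrA -cisD addNr cis0 mul1r.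
  by rewrite conjcM !conjcK -cisN opprK.
have pos x : 0 <= x -> B x = cis (al * x) * A x.
  move=> x0; apply: (reach (Num.truncn (x / (d / 2))).+1) => //.
  have /andP[_] := truncn_itv (divr_ge0 x0 (ltW (divr_gt0 d0 (ltr0Sn R 1)))).
  by rewrite ltr_pdivrMr ?divr_gt0//; lra.
move=> x; have [/pos//|x0] := leP 0 x.
rewrite -[in LHS](opprK x) BJ pos; last by rewrite oppr_ge0 ltW.
by rewrite conjcM AJ conjcK -cisN mulrN opprK.
Qed.

Lemma ftN (f : R -> R) x : integrableR f ->
  ft f (- x) = conjc (ft f x).
Proof.
move=> fi; rewrite /ft -complex_integralJ; last exact: ft_cintegrable.
congr complex_integral; apply/funext => t.
by rewrite conjcM conjc_real mulNr cisN.
Qed.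

Lemma ft0 (f : R -> R) : ft f 0 = (Rintegral leb setT f)%:C.
Proof.
rewrite /ft /complex_integral; congr (_ +i* _).
  by apply: eq_Rintegral => t _; rewrite mul0r cis0 mulr1.
rewrite (_ : (fun _ => _) = cst 0); first by rewrite Rintegral_cst ?mul0r.
by apply/funext => t; rewrite mul0r cis0 mulr1.
Qed.

Lemma ft_continuous0 (f : R -> R) : integrableR f ->
  {for 0, continuous (fun x => Re (ft f x))} /\
  {for 0, continuous (fun x => Im (ft f x))}.
Proof.
move=> fi; have z : (0 : R) \in `]-1, 1[%classic by rewrite inE /= in_itv /=; lra.
have fi' : leb.-integrable setT (fun t => `|f t|%:E) by exact: (integrable_norm fi).
split.
  apply: (continuity_under_integral (mu := leb) (B := setT) _ _ _ fi' _ z) => //.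
  - by move=> x _; have [] := ft_cintegrable x fi.
  - apply: nearW => t _ x _ /=.
    rewrite (_ : (fun _ => _) = fun x => f t * cos (x * t)).
      apply: cvgM; first exact: cvg_cst.
      by apply: continuous_comp; [exact: mulrr_continuous|exact: continuous_cos].
    by apply/funext => y /=; ring.
  - move=> x _; apply: nearW => t _.
    by apply: (le_trans (normc_Re _)); rewrite normcM normc_cis mulr1 normc_real.
apply: (continuity_under_integral (mu := leb) (B := setT) _ _ _ fi' _ z) => //.
- by move=> x _; have [] := ft_cintegrable x fi.
- apply: nearW => t _ x _ /=.
  rewrite (_ : (fun _ => _) = fun x => f t * sin (x * t)).
    apply: cvgM; first exact: cvg_cst.
    by apply: continuous_comp; [exact: mulrr_continuous|exact: continuous_sin].
  by apply/funext => y /=; ring.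
- move=> x _; apply: nearW => t _.
  by apply: (le_trans (normc_Im _)); rewrite normcM normc_cis mulr1 normc_real.
Qed.

Lemma complex_integral_shift (a : R) (h : R -> R[i]) : cintegrable h ->
  complex_integral (fun x => h (x + a)) = complex_integral h.
Proof.
move=> [h1 h2]; rewrite /complex_integral /Rintegral.
by rewrite (integral_shift a (measurable_int _ h1)) (integral_shift a (measurable_int _ h2)).
Qed.

Lemma cintegrable_shift (a : R) (h : R -> R[i]) : cintegrable h ->
  cintegrable (fun x => h (x + a)).
Proof. by move=> [h1 h2]; split; [exact: (integrable_shift a h1)|exact: (integrable_shift a h2)]. Qed.

Lemma translate_of_ft (f g : R -> R) (a : R) :
    integrableR f ->
    integrableR g ->
    (forall x, ft g x = cis (a * x) * ft f x) ->
  {ae leb, forall x, g x = f (x - a)}.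
Proof.
move=> fi gi h.
pose k x := (g x)%:C + (-1) * (f (x - a))%:C.
have fai := integrable_shift (- a) fi.
have ki : cintegrable k.
  by apply: cintegrableD; [exact: cintegrable_real|apply: cintegrableZ; exact: cintegrable_real].
have [|N [mN N0 hN]] := fourier_eq0 ki.
  move=> r; have := h (- r); rewrite /ft => e.
  rewrite (_ : (fun _ => _) = (fun t => (g t)%:C * cis (- r * t) +
     (-1) * ((f (t - a))%:C * cis (- r * t)))); last first.
    by apply/funext => t; rewrite /k mulrDl -!mulrA (mulNr r t).
  rewrite (complex_integralD (ft_cintegrable (- r) gi)
    (cintegrableZ (-1) (ft_cintegrable (- r) fai))).
  rewrite complex_integralZ; last exact: (ft_cintegrable (- r) fai).
  rewrite e; apply/eqP; rewrite mulN1r subr_eq0; apply/eqP.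
  rewrite -[in LHS](complex_integral_shift (- a)); last exact: ft_cintegrable.
  rewrite -complex_integralZ; last first.
    exact: (cintegrable_shift (- a) (ft_cintegrable (- r) fi)).
  congr complex_integral; apply/funext => t; rewrite mulrCA -cisD.
  by congr (_ * cis _); ring.
exists N; split => // x /= nx; apply: hN => /= kx; apply: nx.
by move/eqP: kx; rewrite /k mulN1r subr_eq0 => /eqP/complexI.
Qed.

End translation.

Lemma deck3_translate (R : realType) (f g : R -> R) :
    integrableR f -> (forall t, 0 <= f t) ->
    0 < Rintegral leb setT f ->
    integrableR g -> (forall t, 0 <= g t) ->
    {ae (leb \x leb)%E, forall x : R * R, deck3 g x = deck3 f x} ->
    (forall u v, u < v -> exists2 x, u < x < v & ft f x != 0) ->
  exists a, {ae leb, forall x, g x = f (x - a)}.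
Proof.
move=> fi f0 If gi g0 /(deck_bispectrum fi f0 gi g0)[I3 bis] dense.
have [cf1 cf2] := ft_continuous0 fi; have [cg1 cg2] := ft_continuous0 gi.
have [|al hal] := same_bispectrum_translate If cf1 cf2 cg1 cg2 (ft0 f) _
  (fun x => ftN x fi) (fun x => ftN x gi) bis dense; first by rewrite ft0 I3.
by exists al; exact: translate_of_ft.
Qed.

(** * Zeros of holomorphic functions *)

Section segment_integral.
Variable R : realType.
Implicit Types (g : R -> R) (a b m K eta : R).

Definition segint a b g : R := Rintegral leb `[a, b]%classic g.

(** Continuity is two-sided at the endpoints as well; it will come from complex differentiability at
    every point of the closed segment. *)
Definition segcont a b g := forall x, a <= x <= b -> {for x, continuous g}.

Lemma segcont_integrable a b g : segcont a b g ->
  leb.-integrable `[a, b]%classic (fun x => (g x)%:E).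
Proof.
move=> cg; apply: continuous_compact_integrable; first exact: segment_compact.
apply: continuous_in_subspaceT => x; rewrite inE /= in_itv /=; exact: cg.
Qed.

Lemma segint_split a m b g : a <= m <= b -> segcont a b g ->
  segint a b g = segint a m g + segint m b g.
Proof.
move=> /andP[am mb] /segcont_integrable gi; rewrite /segint.
rewrite -(@Rintegral_itv_obnd_cbnd _ m).
  rewrite -(Rintegral_itvB (x := m) gi) ?bnd_simp//; first by rewrite addrCA subrr addr0.
apply: integrableS gi => //; apply: subset_itv; rewrite ?bnd_simp//.
Qed.

Lemma segintB a b g1 g2 : segcont a b g1 -> segcont a b g2 ->
  segint a b (fun x => g1 x - g2 x) = segint a b g1 - segint a b g2.
Proof. by move=> c1 c2; apply: RintegralB => //; exact: segcont_integrable. Qed.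

Lemma segint_cst a b K : a <= b -> segint a b (fun=> K) = K * (b - a).
Proof.
move=> ab; rewrite /segint Rintegral_cst//; congr (_ * _).
suff h : lebesgue_measure (`[a, b]%classic : set R) = (b - a)%:E by exact: (congr1 fine h).
rewrite lebesgue_measure_itv /= lte_fin; case: ltP => // ba.
by rewrite (_ : b = a) ?subrr//; apply/eqP; rewrite eq_le ab ba.
Qed.

Lemma segint_ge a b g K : a <= b -> segcont a b g ->
  (forall x, a <= x <= b -> K <= g x) -> K * (b - a) <= segint a b g.
Proof.
move=> ab cg h; rewrite -segint_cst//; apply: le_Rintegral => //.
  by apply: segcont_integrable => x _; exact: cvg_cst.
exact: segcont_integrable.
Qed.

Lemma segint_le a b g K : a <= b -> segcont a b g ->
  (forall x, a <= x <= b -> g x <= K) -> segint a b g <= K * (b - a).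
Proof.
move=> ab cg h; rewrite -segint_cst//; apply: le_Rintegral => //.
  exact: segcont_integrable.
by apply: segcont_integrable => x _; exact: cvg_cst.
Qed.

Lemma segint_eq0 a b g : a <= b -> segcont a b g ->
  (forall x, a <= x <= b -> g x = 0) -> segint a b g = 0.
Proof.
move=> ab cg h; apply/eqP; rewrite eq_le; apply/andP; split.
  by rewrite -[X in _ <= X](mul0r (b - a)); apply: segint_le => // x /h ->.
by rewrite -[X in X <= _](mul0r (b - a)); apply: segint_ge => // x /h ->.
Qed.

End segment_integral.

(** * Complex differentiability *)

Section complex_differentiable.
Variable R : realType.
Implicit Types (F G : R[i] -> R[i]) (z w c : R[i]).

(** Complex differentiability free of quotients, with real tolerances and the real-valued modulus
    [normc]; [derivable_cdiff] connects it to [derivable]. *)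
Definition cdiff F z := exists l : R[i], forall e : R, 0 < e ->
  exists2 d : R, 0 < d & forall h, normc h < d ->
    normc (F (z + h) - F z - l * h) <= e * normc h.

Lemma cdiff_lipschitz F z : cdiff F z -> exists M : R, exists2 d : R, 0 < d &
  0 < M /\ forall h, normc h < d -> normc (F (z + h) - F z) <= M * normc h.
Proof.
move=> [l hl]; have [d d0 hd] := hl 1 ltr01.
exists (normc l + 1); exists d => //; split; first by rewrite ltr_wpDl ?normc_ge0.
move=> h /hd hh; rewrite -[X in normc X](subrK (l * h)) addrC mulrDl -normcM.
by apply: (le_trans (le_normcD _ _)); rewrite lerD2l.
Qed.

Lemma cdiff_continuous F z (p : R -> R[i]) (t : R) : p t = z ->
    (forall s, normc (p s - p t) = `|s - t|) -> cdiff F z ->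
  {for t, continuous (fun s => Re (F (p s)))} /\
  {for t, continuous (fun s => Im (F (p s)))}.
Proof.
move=> pt pn /cdiff_lipschitz[M [d d0 [M0 hM]]].
have key (e : R) : 0 < e -> \forall s \near t, normc (F (p s) - F (p t)) < e.
  move=> e0; apply/nbhs_ballP; exists (Num.min d (e / M)) => /=.
    by rewrite lt_min d0 divr_gt0.
  move=> s; rewrite /ball /= distrC lt_min => /andP[sd se].
  have := hM (p s - p t); rewrite pn [z + _]addrC -pt subrK => /(_ sd) /le_lt_trans; apply.
  by rewrite mulrC -ltr_pdivlMr.
split; apply/cvgrPdist_lt => e /key; apply: filterS => s; apply: le_lt_trans.
  by rewrite distrC -raddfB; exact: normc_Re.
by rewrite distrC -raddfB; exact: normc_Im.
Qed.

Lemma cdiffM F G z : cdiff F z -> cdiff G z -> cdiff (fun w => F w * G w) z.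
Proof.
move=> cF cG; have [M1 [d1 d10 [M10 h1]]] := cdiff_lipschitz cF.
have [M2 [d2 d20 [M20 h2]]] := cdiff_lipschitz cG.
case: cF cG => [l hl] [m hm]; exists (l * G z + F z * m) => e e0.
pose K := normc (F z) + normc (G z) + 1.
have K0 : 0 < K by rewrite ltr_wpDl// addr_ge0// normc_ge0.
have e1 : 0 < e / 2 / K by rewrite !divr_gt0.
have [d3 d30 h3] := hl _ e1; have [d4 d40 h4] := hm _ e1.
have d50 : 0 < e / 2 / (M1 * M2) by rewrite !divr_gt0// mulr_gt0.
exists (Num.min (Num.min d1 d2) (Num.min (Num.min d3 d4) (e / 2 / (M1 * M2)))).
  by rewrite !lt_min d10 d20 d30 d40 d50.
move=> h; rewrite !lt_min -!andbA => /and5P[/h1 a1 /h2 a2 /h3 a3 /h4 a4 a5].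
set r := F (z + h) - F z - l * h in a3; set s := G (z + h) - G z - m * h in a4.
rewrite (_ : _ - _ = r * G z + F z * s + (F (z + h) - F z) * (G (z + h) - G z)); last first.
  by rewrite /r /s; ring.
apply: (le_trans (le_normcD _ _)); apply: (le_trans (lerD (le_normcD _ _) (lexx _))).
rewrite !normcM.
have n := @normc_ge0 R; have nh := n h; have nF := n (F z); have nG := n (G z).
have b1 : normc r * normc (G z) + normc (F z) * normc s <= e / 2 * normc h.
  rewrite (_ : e / 2 * normc h = e / 2 / K * normc h * K); last first.
    by field; rewrite gt_eqF.
  have := ler_wpM2r nG a3; have := ler_wpM2l nF a4.
  have : 0 <= e / 2 / K * normc h by rewrite mulr_ge0// ltW.
  by rewrite /K; move: (e / 2 / _ * _) => u; nra.
have b2 : normc (F (z + h) - F z) * normc (G (z + h) - G z) <= e / 2 * normc h.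
  apply: (le_trans (ler_pM (n _) (n _) a1 a2)).
  rewrite mulrACA (mulrA _ (normc h)); apply: ler_wpM2r => //.
  by rewrite mulrC -ler_pdivlMr ?mulr_gt0// ltW.
lra.
Qed.

Lemma cdiff_affine F (a b z : R[i]) : cdiff F (a * z + b) ->
  cdiff (fun w => F (a * w + b)) z.
Proof.
move=> [l hl]; exists (l * a) => e e0.
have na : 0 < normc a + 1 by rewrite ltr_wpDl ?normc_ge0.
have [d d0 hd] := hl (e / (normc a + 1)) (divr_gt0 e0 na).
exists (d / (normc a + 1)); first by rewrite divr_gt0.
move=> h; rewrite ltr_pdivlMr// => hh.
rewrite (_ : a * (z + h) + b = a * z + b + a * h); last by ring.
have nh := normc_ge0 h; have na0 := normc_ge0 a.
rewrite -mulrA; apply: (le_trans (hd (a * h) _)).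
  by rewrite normcM; nra.
rewrite normcM -mulrA; apply: ler_wpM2l; first exact: ltW.
by rewrite mulrA ler_piMl// mulrC ler_pdivrMr// mul1r lerDl.
Qed.

Lemma cdiff_cst (k z : R[i]) : cdiff (fun=> k) z.
Proof.
exists 0 => e e0; exists 1 => // h _.
by rewrite subrr mul0r subr0 normc0 mulr_ge0 ?normc_ge0 ?ltW.
Qed.

Lemma cdiff_inv (z : R[i]) : z != 0 -> cdiff (fun w => w^-1) z.
Proof.
move=> z0; exists (- (z ^+ 2)^-1) => e e0.
have nz : 0 < normc z by rewrite normc_gt0.
exists (Num.min (normc z / 2) (e * normc z ^+ 3 / 2)).
  by rewrite lt_min !divr_gt0// mulr_gt0// exprn_gt0.
move=> h; rewrite lt_min => /andP[h1 h2].
have nzh : normc z / 2 <= normc (z + h).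
  by have := le_normcB z (- h); rewrite normcN opprK; lra.
have zh : z + h != 0 by rewrite -normc_gt0; apply: lt_le_trans nzh; rewrite divr_gt0.
rewrite (_ : _ - _ = h * (h / (z ^+ 2 * (z + h)))); last by field; rewrite ?z0 ?zh.
rewrite normcM mulrC; apply: ler_wpM2r; first exact: normc_ge0.
rewrite normcM.
have -> : normc (z ^+ 2 * (z + h))^-1 = (normc z ^+ 2 * normc (z + h))^-1.
  apply: (@mulfI _ (normc (z ^+ 2 * (z + h)))).
    by rewrite normc_eq0 mulf_neq0// expf_neq0.
  rewrite -normcM mulfV ?mulf_neq0 ?expf_neq0// normc1 normcM normcX mulfV//.
  by rewrite gt_eqF// mulr_gt0 ?normc_gt0// exprn_gt0.
rewrite ler_pdivrMr ?mulr_gt0 ?exprn_gt0 ?normc_gt0//.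
apply: (le_trans (ltW h2)); rewrite -!mulrA; apply: ler_wpM2l; first exact: ltW.
by rewrite !ler_pM2l.
Qed.

End complex_differentiable.

Section bisection.
Variable R : realType.

Lemma halving_limit (u : nat -> R) (w : R) : 0 <= w ->
    (forall n, u n <= u n.+1 <= u n + w * 2 ^- n.+1) ->
  exists X, forall n, u n <= X <= u n + w * 2 ^- n.
Proof.
move=> w0 hu.
have half n : w * 2 ^- n = w * 2 ^- n.+1 + w * 2 ^- n.+1.
  by rewrite exprS invfM; field; rewrite expf_neq0// pnatr_eq0.
have nonneg n : 0 <= w * 2 ^- n by rewrite mulr_ge0// invr_ge0 exprn_ge0.
have up n k : u n <= u (n + k)%N /\ u (n + k)%N + w * 2 ^- (n + k) <= u n + w * 2 ^- n.
  elim: k => [|k [IH1 IH2]]; first by rewrite addn0.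
  rewrite addnS; have /andP[h1 h2] := hu (n + k)%N; split; first exact: le_trans h1.
  by apply: le_trans IH2; rewrite (half (n + k)%N); lra.
have bnd n m : u m <= u n + w * 2 ^- n.
  have [/subnKC e|/ltnW/subnKC e] := leqP n m.
    by have [_] := up n (m - n)%N; rewrite e; have := nonneg m; lra.
  by have [h _] := up m (n - m)%N; rewrite e in h; have := nonneg n; lra.
exists (sup [set u n | n in setT]) => n; apply/andP; split.
  by apply: ub_le_sup; [exists (u 0 + w * 2 ^- 0)%R => _ [m _ <-]|exists n].
by apply: ge_sup; [exists (u 0%N); exists 0%N|move=> _ [m _ <-]].
Qed.

(** [Bad x y k] stands for the rectangle with lower left corner (x, y) and sides w / 2^k and h /
    2^k. Choosing a bad subrectangle again and again gives corners converging to a point common to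
    all the closed rectangles. *)
Lemma bisection (Bad : R -> R -> nat -> Prop) (a c w h : R) : 0 <= w -> 0 <= h ->
    Bad a c 0 ->
    (forall x y k, Bad x y k -> exists x' y', [/\ Bad x' y' k.+1,
      x <= x' <= x + w * 2 ^- k.+1 & y <= y' <= y + h * 2 ^- k.+1]) ->
  exists X Y, forall k, exists x y, [/\ Bad x y k,
    x <= X <= x + w * 2 ^- k & y <= Y <= y + h * 2 ^- k].
Proof.
move=> w0 h0 B0 BS.
have step (kp : nat * (R * R)) : exists q : R * R, Bad kp.2.1 kp.2.2 kp.1 ->
    [/\ Bad q.1 q.2 kp.1.+1, kp.2.1 <= q.1 <= kp.2.1 + w * 2 ^- kp.1.+1 &
      kp.2.2 <= q.2 <= kp.2.2 + h * 2 ^- kp.1.+1].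
  case: kp => k [x y] /=; have [/BS[x' [y' H]]|nB] := pselect (Bad x y k).
    by exists (x', y').
  by exists (x, y).
have [next hnext] := choice step.
pose s := fix s k : R * R := if k is k'.+1 then next (k', s k') else (a, c).
have Bs k : Bad (s k).1 (s k).2 k.
  by elim: k => // k IH; have [] := hnext (k, s k) IH.
have [|X hX] := @halving_limit (fun n => (s n).1) w w0.
  by move=> n; have [] := hnext (n, s n) (Bs n).
have [|Y hY] := @halving_limit (fun n => (s n).2) h h0.
  by move=> n; have [] := hnext (n, s n) (Bs n).
by exists X, Y => k; exists (s k).1, (s k).2.
Qed.

End bisection.

(** * Goursat's theorem on rectangles *)

Section goursat.
Variable R : realType.
Implicit Types (F : R[i] -> R[i]) (a b c d : R).

Definition hdiff F a b y := forall x, a <= x <= b -> cdiff F (x +i* y).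
Definition vdiff F x c d := forall y, c <= y <= d -> cdiff F (x +i* y).

Lemma hdiff_segcont F a b y : hdiff F a b y ->
  segcont a b (fun x => Re (F (x +i* y))) /\
  segcont a b (fun x => Im (F (x +i* y))).
Proof.
move=> hF; have n (x s : R) : normc ((s +i* y) - (x +i* y)) = `|s - x|.
  by rewrite /normc /= subrr expr0n addr0 sqrtr_sqr.
split=> x /hF cF.
  by have [] := cdiff_continuous (p := fun s => s +i* y) (t := x) erefl (n x) cF.
by have [] := cdiff_continuous (p := fun s => s +i* y) (t := x) erefl (n x) cF.
Qed.

Lemma vdiff_segcont F x c d : vdiff F x c d ->
  segcont c d (fun y => Re (F (x +i* y))) /\
  segcont c d (fun y => Im (F (x +i* y))).
Proof.
move=> hF; have n (y s : R) : normc ((x +i* s) - (x +i* y)) = `|s - y|.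
  by rewrite /normc /= subrr expr0n add0r sqrtr_sqr.
split=> y /hF cF.
  by have [] := cdiff_continuous (p := fun s => x +i* s) (t := y) erefl (n y) cF.
by have [] := cdiff_continuous (p := fun s => x +i* s) (t := y) erefl (n y) cF.
Qed.

(* The real part of the integral of F around the rectangle [a, b] x [c, d]. *)
Definition rectint F a b c d : R :=
  segint a b (fun x => Re (F (x +i* c))) -
  segint a b (fun x => Re (F (x +i* d))) -
  (segint c d (fun y => Im (F (b +i* y))) -
   segint c d (fun y => Im (F (a +i* y)))).

Lemma rectint_vsplit F a m b c d : a <= m <= b -> hdiff F a b c -> hdiff F a b d ->
  rectint F a b c d = rectint F a m c d + rectint F m b c d.
Proof.
move=> amb /hdiff_segcont[h1 _] /hdiff_segcont[h2 _].
by rewrite /rectint !(segint_split amb)//; ring.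
Qed.

Lemma rectint_hsplit F a b c m d : c <= m <= d -> vdiff F a c d -> vdiff F b c d ->
  rectint F a b c d = rectint F a b c m + rectint F a b m d.
Proof.
move=> cmd /vdiff_segcont[_ h1] /vdiff_segcont[_ h2].
by rewrite /rectint !(segint_split cmd)//; ring.
Qed.

Lemma rectint_quarters F a m b c n d : a <= m <= b -> c <= n <= d ->
    (forall x y, a <= x <= b -> c <= y <= d -> cdiff F (x +i* y)) ->
  rectint F a b c d = rectint F a m c n + rectint F a m n d +
    (rectint F m b c n + rectint F m b n d).
Proof.
move=> amb cnd hF; have amb' := amb; have cnd' := cnd.
case/andP: amb' => am mb; case/andP: cnd' => cn nd.
have ab := le_trans am mb; have cd := le_trans cn nd.
have hv x : a <= x <= b -> vdiff F x c d by move=> xab y yab; exact: hF.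
have hh y : c <= y <= d -> hdiff F a b y by move=> ycd x xab; exact: hF.
rewrite (rectint_vsplit amb); last 2 first.
- by apply: hh; rewrite lexx.
- by apply: hh; rewrite lexx andbT.
rewrite (rectint_hsplit cnd); last 2 first.
- by apply: hv; rewrite lexx.
- exact: hv.
rewrite (rectint_hsplit cnd) //; first exact: hv.
by apply: hv; rewrite lexx andbT.
Qed.

(** Opposite sides are paired. For the affine approximation the differences across the rectangle are
    the constants Im l (d - c) and Im l (b - a), whose integrals cancel; only the error eta on each
    side remains. *)
Lemma rectint_le F a b c d (A l z0 : R[i]) (eta : R) : a <= b -> c <= d ->
    hdiff F a b c -> hdiff F a b d -> vdiff F a c d -> vdiff F b c d ->
    (forall x y, a <= x <= b -> c <= y <= d ->
      normc (F (x +i* y) - A - l * (x +i* y - z0)) <= eta) ->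
  `|rectint F a b c d| <= 2 * eta * ((b - a) + (d - c)).
Proof.
move=> ab cd hc hd ha hb hF.
have [hc1 _] := hdiff_segcont hc; have [hd1 _] := hdiff_segcont hd.
have [_ ha1] := vdiff_segcont ha; have [_ hb1] := vdiff_segcont hb.
rewrite /rectint -!segintB//.
set u := fun x => _; set v := (fun y => Im _ - _).
have cu : segcont a b u by move=> x xab; apply: cvgB; [exact: hc1|exact: hd1].
have cv : segcont c d v by move=> y yab; apply: cvgB; [exact: hb1|exact: ha1].
have ca : a <= a <= b by rewrite lexx.
have cb : a <= b <= b by rewrite lexx andbT.
have cc : c <= c <= d by rewrite lexx.
have dd : c <= d <= d by rewrite lexx andbT.
have hu x : a <= x <= b -> `|u x - Im l * (d - c)| <= 2 * eta.
  move=> xab; have := hF x c xab cc; have := hF x d xab dd.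
  have := normc_Re (F (x +i* c) - A - l * (x +i* c - z0)).
  have := normc_Re (F (x +i* d) - A - l * (x +i* d - z0)).
  rewrite /u; case: (F (x +i* c)) (F (x +i* d)) A l z0 {hF} => [p q] [r s] [A1 A2] [l1 l2] [z1 z2].
  move: (normc _) (normc _) => n1 n2 /=; rewrite !ler_norml; lra.
have hv y : c <= y <= d -> `|v y - Im l * (b - a)| <= 2 * eta.
  move=> yab; have := hF a y ca yab; have := hF b y cb yab.
  have := normc_Im (F (a +i* y) - A - l * (a +i* y - z0)).
  have := normc_Im (F (b +i* y) - A - l * (b +i* y - z0)).
  rewrite /v; case: (F (a +i* y)) (F (b +i* y)) A l z0 {hF hu} => [p q] [r s] [A1 A2] [l1 l2] [z1 z2].
  move: (normc _) (normc _) => n1 n2 /=; rewrite !ler_norml; lra.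
have u1 := segint_ge (K := Im l * (d - c) - 2 * eta) ab cu.
have u2 := segint_le (K := Im l * (d - c) + 2 * eta) ab cu.
have v1 := segint_ge (K := Im l * (b - a) - 2 * eta) cd cv.
have v2 := segint_le (K := Im l * (b - a) + 2 * eta) cd cv.
have {}u1 := u1 (fun x xab => ltac:(have := hu x xab; rewrite ler_norml; lra)).
have {}u2 := u2 (fun x xab => ltac:(have := hu x xab; rewrite ler_norml; lra)).
have {}v1 := v1 (fun x xab => ltac:(have := hv x xab; rewrite ler_norml; lra)).
have {}v2 := v2 (fun x xab => ltac:(have := hv x xab; rewrite ler_norml; lra)).
rewrite ler_norml; move: (segint a b u) (segint c d v) (Im l) u1 u2 v1 v2 => P Q L.
by rewrite !mulrBl !mulrDl; nra.
Qed.

Lemma goursat F a b c d : a <= b -> c <= d ->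
  (forall x y, a <= x <= b -> c <= y <= d -> cdiff F (x +i* y)) ->
  rectint F a b c d = 0.
Proof.
move=> ab cd hF; apply/eqP; apply: contrapT => /negP J0.
pose al := `|rectint F a b c d|; have al0 : 0 < al by rewrite normr_gt0.
pose w := b - a; pose h := d - c.
have w0 : 0 <= w by rewrite subr_ge0.
have h0 : 0 <= h by rewrite subr_ge0.
pose Bad x y k := [/\ a <= x, x + w * 2 ^- k <= b, c <= y, y + h * 2 ^- k <= d &
  al * 4 ^- k <= `|rectint F x (x + w * 2 ^- k) y (y + h * 2 ^- k)|].
have p2 k : 0 < 2 ^- k :> R by rewrite invr_gt0 exprn_gt0.
have half (u : R) k : u * 2 ^- k = u * 2 ^- k.+1 + u * 2 ^- k.+1.
  by rewrite exprS invfM; field; rewrite expf_neq0// pnatr_eq0.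
have [|x y k [ax xb cy yd Bk]|X [Y hXY]] := bisection (Bad := Bad) (a := a) (c := c) w0 h0.
- by rewrite /Bad !expr0 !invr1 !mulr1 /w /h !subrKC !lexx.
- have wk : 0 <= w * 2 ^- k.+1 by rewrite mulr_ge0// ltW.
  have hk : 0 <= h * 2 ^- k.+1 by rewrite mulr_ge0// ltW.
  move: xb yd Bk; rewrite (half w) (half h) !addrA.
  set s := w * _ in wk *; set t := h * _ in hk * => xb yd Bk.
  have xm : x <= x + s <= x + s + s by rewrite !lerDl wk.
  have ym : y <= y + t <= y + t + t by rewrite !lerDl hk.
  have Jsplit := rectint_quarters (F := F) xm ym.
  have {}Jsplit := Jsplit (fun p q hp hq => hF p q ltac:(lra) ltac:(lra)).
  have e4 : al * 4 ^- k = al * 4 ^- k.+1 + al * 4 ^- k.+1 + (al * 4 ^- k.+1 + al * 4 ^- k.+1).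
    by rewrite exprS invfM; field; rewrite expf_neq0// pnatr_eq0.
  have : (al * 4 ^- k.+1 <= `|rectint F x (x + s) y (y + t)|) ||
    (al * 4 ^- k.+1 <= `|rectint F x (x + s) (y + t) (y + t + t)|) ||
    ((al * 4 ^- k.+1 <= `|rectint F (x + s) (x + s + s) y (y + t)|) ||
    (al * 4 ^- k.+1 <= `|rectint F (x + s) (x + s + s) (y + t) (y + t + t)|)).
    apply: contraT; rewrite !negb_or -!ltNge => /andP[/andP[l1 l2] /andP[l3 l4]].
    move: Bk; rewrite Jsplit e4 => Bk; exfalso.
    have := le_trans Bk (le_trans (ler_normD _ _) (lerD (ler_normD _ _) (ler_normD _ _))).
    by lra.
  rewrite -orbA => /or4P[] Q.
  + by exists x, y; rewrite /Bad -/s -/t; split; [split => //; lra|lra|lra].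
  + by exists x, (y + t); rewrite /Bad -/s -/t; split; [split => //; lra|lra|lra].
  + by exists (x + s), y; rewrite /Bad -/s -/t; split; [split => //; lra|lra|lra].
  + by exists (x + s), (y + t); rewrite /Bad -/s -/t; split; [split => //; lra|lra|lra].
have [Xab Ycd] : a <= X <= b /\ c <= Y <= d.
  by have [x [y [[ax xb cy yd _] xX yY]]] := hXY 0%N; split; lra.
have [l hl] := hF X Y Xab Ycd.
(* Chosen so that 2 e (w + h)^2 < al: the bound of [rectint_le] on the k-th rectangle then falls
   below al / 4^k. The 1 also covers w + h = 0. *)
pose e := al / (2 * (w + h) ^+ 2 + 1).
have D0 : 0 < 2 * (w + h) ^+ 2 + 1 by rewrite ltr_wpDl// mulr_ge0// sqr_ge0.
have e0 : 0 < e by rewrite divr_gt0.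
have [dl dl0 hdl] := hl e e0.
have [k hk] : exists k, (w + h) * 2 ^- k < dl.
  have [E|E] := eqVneq (w + h) 0; first by exists 0%N; rewrite E mul0r.
  have wh : 0 < w + h by rewrite lt0r E addr_ge0.
  have [k hk] := ltr_add_invr (y := 0) (x := dl / (w + h)) (divr_gt0 dl0 wh).
  exists k; rewrite mulrC -ltr_pdivlMr//; move: hk; rewrite add0r; apply: le_lt_trans.
  rewrite lef_pV2 ?posrE ?exprn_gt0// -natrX ler_nat; exact: ltn_expl.
have [x [y [[ax xb cy yd Bk] xX yY]]] := hXY k.
set s := w * _ in xb Bk xX; set t := h * _ in yd Bk yY.
have s0 : 0 <= s by rewrite mulr_ge0// ltW.
have t0 : 0 <= t by rewrite mulr_ge0// ltW.
have st : s + t = (w + h) * 2 ^- k by rewrite mulrDl.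
have : `|rectint F x (x + s) y (y + t)| <= 2 * (e * (s + t)) * ((x + s - x) + (y + t - y)).
  apply: (rectint_le (A := F (X +i* Y)) (l := l) (z0 := X +i* Y)).
  - lra.
  - lra.
  - by move=> p hp; apply: hF; lra.
  - by move=> p hp; apply: hF; lra.
  - by move=> p hp; apply: hF; lra.
  - by move=> p hp; apply: hF; lra.
  move=> p q hp hq.
  have n1 : normc ((p +i* q) - (X +i* Y)) <= s + t.
    by apply: (le_trans (normc_le _)); rewrite /= lerD// ler_norml; lra.
  have := hdl ((p +i* q) - (X +i* Y)); rewrite [X in F X]addrC subrK st => /(_ (le_lt_trans _ hk)).
  rewrite -st => /(_ n1) /le_trans; apply; apply: ler_wpM2l n1; exact: ltW.
apply/negP; rewrite -ltNge; apply: lt_le_trans Bk.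
rewrite (_ : x + s - x + (y + t - y) = s + t); last by ring.
rewrite st (_ : (4 : R) ^- k = 2 ^- k * 2 ^- k); last first.
  by rewrite -invfM -exprMn -natrM.
rewrite (_ : _ * _ = 2 * e * (w + h) ^+ 2 * (2 ^- k * 2 ^- k)); last by ring.
rewrite ltr_pM2r ?mulr_gt0// mulrAC /e mulrA ltr_pdivrMr// mulrC ltr_pM2l//.
by rewrite ltrDl.
Qed.

End goursat.

(** * Functions vanishing on the sides of a square *)

Section square.
Variable R : realType.
Implicit Types (F : R[i] -> R[i]).

(* If F 0 <> 0, then F z / z integrates to 0 around the boundary, hence, by Goursat,
   around small squares, where it is F 0 / z up to a bounded term. The factor
   -i / F 0 makes the real part of the latter integral positive. *)
Lemma square_boundary_eq0 F :
    (forall x y, -1 <= x <= 1 -> -1 <= y <= 1 -> cdiff F (x +i* y)) ->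
    (forall t, -1 <= t <= 1 -> [/\ F (t +i* (-1)) = 0, F (t +i* 1) = 0,
       F ((-1) +i* t) = 0 & F (1 +i* t) = 0]) ->
  F 0 = 0.
Proof.
move=> hF hb; apply/eqP; apply: contrapT => /negP F0.
pose F1 z := (- 'i / F 0) * F z.
have F10 : F1 0 = - 'i by rewrite /F1 divfK.
have dF1 x y : -1 <= x <= 1 -> -1 <= y <= 1 -> cdiff F1 (x +i* y).
  by move=> hx hy; apply: cdiffM; [exact: cdiff_cst|exact: hF].
have [M [d d0 [M0 hM]]] : exists M : R, exists2 d : R, 0 < d & 0 < M /\
    forall h, normc h < d -> normc (F1 h + 'i) <= M * normc h.
  have [|M [d d0 [M0 hM]]] := @cdiff_lipschitz _ F1 0.
    by apply: (dF1 0 0); lra.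
  exists M; exists d => //; split => // h /hM; by rewrite add0r F10 opprK.
pose G z := F1 z * z^-1.
have dG x y : -1 <= x <= 1 -> -1 <= y <= 1 -> x +i* y != 0 -> cdiff G (x +i* y).
  by move=> hx hy z0; apply: cdiffM; [exact: dF1|exact: cdiff_inv].
have nz (x y : R) : x != 0 \/ y != 0 -> x +i* y != 0.
  by rewrite eq_complex /= negb_and => /orP.
have hG (a b y : R) : -1 <= a -> b <= 1 -> -1 <= y <= 1 -> y != 0 -> hdiff G a b y.
  by move=> ha hb' hy y0 x hx; apply: dG => //; [lra|apply: nz; right].
have vG (a b x : R) : -1 <= a -> b <= 1 -> -1 <= x <= 1 -> x != 0 -> vdiff G x a b.
  by move=> ha hb' hx x0 y hy; apply: dG => //; [lra|apply: nz; left].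
have outer : rectint G (-1) 1 (-1) 1 = 0.
  have G0 z : F z = 0 -> G z = 0 by rewrite /G /F1 => ->; rewrite mulr0 mul0r.
  have e1 : (1 : R) != 0 by rewrite oner_eq0.
  have e2 : (-1 : R) != 0 by rewrite oppr_eq0.
  have m1 : -1 <= 1 :> R by lra.
  have i1 : -1 <= (-1 : R) <= 1 by lra.
  have i2 : -1 <= (1 : R) <= 1 by lra.
  have [cb _] := hdiff_segcont (hG _ _ _ (lexx _) (lexx _) i1 e2).
  have [ct _] := hdiff_segcont (hG _ _ _ (lexx _) (lexx _) i2 e1).
  have [_ cl] := vdiff_segcont (vG _ _ _ (lexx _) (lexx _) i1 e2).
  have [_ cr] := vdiff_segcont (vG _ _ _ (lexx _) (lexx _) i2 e1).
  have zb t : -1 <= t <= 1 -> Re (G (t +i* (-1))) = 0.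
    by move=> ht; rewrite G0//; have [] := hb t ht.
  have zt t : -1 <= t <= 1 -> Re (G (t +i* 1)) = 0.
    by move=> ht; rewrite G0//; have [] := hb t ht.
  have zl t : -1 <= t <= 1 -> Im (G ((-1) +i* t)) = 0.
    by move=> ht; rewrite G0//; have [] := hb t ht.
  have zr t : -1 <= t <= 1 -> Im (G (1 +i* t)) = 0.
    by move=> ht; rewrite G0//; have [] := hb t ht.
  by rewrite /rectint (segint_eq0 m1 cb zb) (segint_eq0 m1 ct zt)
    (segint_eq0 m1 cl zl) (segint_eq0 m1 cr zr) !subrr.
(* 2 s M < 1 lets the main term, at least 1/(2s) on each side of the small square, exceed the error
   M; 2 s < d keeps this square where the Lipschitz bound holds. *)
have [s s0 [s1 sd sM]] : exists2 s : R, 0 < s & [/\ s < 1, 2 * s < d & 2 * s * M < 1].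
  exists (Num.min (1 / 2) (Num.min (d / 4) (M^-1 / 4))).
    by rewrite !lt_min !divr_gt0 ?invr_gt0.
  set s := Num.min _ _.
  have : s <= Num.min (1 / 2) (Num.min (d / 4) (M^-1 / 4)) by [].
  rewrite !le_min => /and3P[h1 h2 h3].
  have : s * M <= M^-1 / 4 * M by rewrite ler_wpM2r// ltW.
  rewrite mulrAC mulVf ?gt_eqF// => h4.
  by split; lra.
have ns0 : - s != 0 by rewrite oppr_eq0 gt_eqF.
have ps0 : s != 0 by rewrite gt_eqF.
(* Four rectangles avoiding 0 are cut off in turn: left, right, bottom and top. *)
have inner : rectint G (- s) s (- s) s = 0.
  have g (a b c e : R) : -1 <= a -> a <= b -> b <= 1 -> -1 <= c -> c <= e -> e <= 1 ->
      (b < 0 \/ 0 < a) \/ (e < 0 \/ 0 < c) -> rectint G a b c e = 0.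
    move=> h1 h2 h3 h4 h5 h6 h7; apply: goursat => // x y hx hy.
    apply: dG; [lra|lra|]; apply: nz.
    case: h7 => [h7|h7]; [left|right]; apply/eqP => z0; move: hx hy; rewrite z0; lra.
  have n1 : (-1 : R) != 0 by rewrite oppr_eq0 oner_eq0.
  have := outer.
  rewrite (@rectint_vsplit _ G (-1) (- s) 1 (-1) 1); last 3 first.
  - by lra.
  - by apply: hG => //; lra.
  - by apply: hG => //; rewrite ?oner_eq0//; lra.
  rewrite (g (-1) (- s)) ?add0r; last first.
  - by left; left; lra.
  1-6: by lra.
  rewrite (@rectint_vsplit _ G (- s) s 1 (-1) 1); last 3 first.
  - by lra.
  - by apply: hG => //; lra.
  - by apply: hG => //; rewrite ?oner_eq0//; lra.
  rewrite (g s 1) ?addr0; last first.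
  - by left; right; lra.
  1-6: by lra.
  rewrite (@rectint_hsplit _ G (- s) s (-1) (- s) 1); last 3 first.
  - by lra.
  - by apply: vG => //; lra.
  - by apply: vG => //; lra.
  rewrite (g (- s) s (-1) (- s)) ?add0r; last first.
  - by right; left; lra.
  1-6: by lra.
  rewrite (@rectint_hsplit _ G (- s) s (- s) s 1); last 3 first.
  - by lra.
  - by apply: vG => //; lra.
  - by apply: vG => //; lra.
  rewrite (g (- s) s s 1) ?addr0; last first.
  - by right; right; lra.
  1-6: by lra.
  by [].
have est x y : -s <= x <= s -> -s <= y <= s -> x +i* y != 0 ->
    normc (G (x +i* y) - (- 'i) / (x +i* y)) <= M.
  move=> hx hy z0; rewrite /G -mulrBl opprK normcM.
  have n0 : 0 < normc (x +i* y) by rewrite normc_gt0.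
  have -> : normc (x +i* y)^-1 = (normc (x +i* y))^-1.
    by apply: (mulfI (lt0r_neq0 n0)); rewrite -normcM mulfV// normc1 mulfV// gt_eqF.
  rewrite ler_pdivrMr//; apply: hM; apply: le_lt_trans (normc_le _) _ => /=.
  have : `|x| <= s by rewrite ler_norml.
  have : `|y| <= s by rewrite ler_norml.
  lra.
have quot (x y : R) : x ^+ 2 + y ^+ 2 != 0 ->
    (- 'i) / (x +i* y) = (- y / (x ^+ 2 + y ^+ 2)) +i* (- x / (x ^+ 2 + y ^+ 2)).
  move=> q0; have z0 : x +i* y != 0.
    by apply: nz; apply/orP; rewrite -negb_and; apply: contraNN q0 => /andP[/eqP-> /eqP->];
       rewrite expr0n addr0.
  apply: (mulIf z0); rewrite divfK//.
  by apply/eqP; rewrite eq_complex /=; apply/andP; split; apply/eqP; field.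
(* Up to sign, s / (x^2 + s^2) is the real part of -i/z on the horizontal sides of the small square
   and the imaginary part on the vertical ones. The signs are such that the four sides add up. *)
have big (x y : R) : -s <= x <= s -> (2 * s)^-1 <= s / (x ^+ 2 + s ^+ 2).
  move=> hx; have x2 : x ^+ 2 <= s ^+ 2 by rewrite -ler_sqrt ?sqr_ge0// !sqrtr_sqr (gtr0_norm s0) ler_norml.
  have s2 : 0 < s ^+ 2 by rewrite exprn_gt0.
  have q0 : 0 < x ^+ 2 + s ^+ 2 by rewrite ltr_wpDl ?sqr_ge0.
  rewrite ler_pdivlMr// mulrC ler_pdivrMr ?mulr_gt0//; nra.
pose K := (2 * s)^-1 - M.
have K0 : 0 < K.
  by rewrite subr_gt0 -(ltr_pM2l (mulr_gt0 (ltr0Sn R 1) s0)) mulfV// mulf_neq0.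
have is1 : -s <= -s <= s by lra.
have is2 : -s <= s <= s by lra.
have ss : -s <= s by lra.
have ms1 : -1 <= -s by lra.
have ls1 : s <= 1 by lra.
have js1 : -1 <= -s <= 1 by lra.
have js2 : -1 <= s <= 1 by lra.
have q2 (x : R) : x ^+ 2 + s ^+ 2 != 0 by rewrite gt_eqF// ltr_wpDl ?sqr_ge0// exprn_gt0.
have q3 (x : R) : s ^+ 2 + x ^+ 2 != 0 by rewrite addrC q2.
have Lb : K * (s - - s) <= segint (- s) s (fun x => Re (G (x +i* (- s)))).
  apply: segint_ge => //; first by have [] := hdiff_segcont (hG _ _ _ ms1 ls1 js1 ns0).
  move=> x hx; have := est x (- s) hx is1 (nz _ _ (or_intror ns0)).
  move=> /(le_trans (normc_Re _)); rewrite quot sqrrN// opprK raddfB /= ler_norml /K.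
  by have := big x 0 hx; lra.
have Lt : segint (- s) s (fun x => Re (G (x +i* s))) <= (- K) * (s - - s).
  apply: segint_le => //; first by have [] := hdiff_segcont (hG _ _ _ ms1 ls1 js2 ps0).
  move=> x hx; have := est x s hx is2 (nz _ _ (or_intror ps0)).
  move=> /(le_trans (normc_Re _)); rewrite quot// raddfB /= mulNr ler_norml /K.
  by have := big x 0 hx; lra.
have Lr : segint (- s) s (fun y => Im (G (s +i* y))) <= (- K) * (s - - s).
  apply: segint_le => //; first by have [] := vdiff_segcont (vG _ _ _ ms1 ls1 js2 ps0).
  move=> x hx; have := est s x is2 hx (nz _ _ (or_introl ps0)).
  move=> /(le_trans (normc_Im _)); rewrite quot// raddfB /= mulNr ler_norml /K addrC.
  by have := big x 0 hx; rewrite [s ^+ 2 + _]addrC; lra.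
have Ll : K * (s - - s) <= segint (- s) s (fun y => Im (G ((- s) +i* y))).
  apply: segint_ge => //; first by have [] := vdiff_segcont (vG _ _ _ ms1 ls1 js1 ns0).
  move=> x hx; have := est (- s) x is1 hx (nz _ _ (or_introl ns0)).
  move=> /(le_trans (normc_Im _)); rewrite quot sqrrN// opprK raddfB /= ler_norml /K.
  by have := big x 0 hx; rewrite [s ^+ 2 + _]addrC; lra.
have Ks : 0 < K * (s - - s) by rewrite mulr_gt0//; lra.
move: inner; rewrite /rectint; lra.
Qed.


(* The product of the four rotations of F vanishes on the whole boundary. *)
Lemma square_side_eq0 F :
    (forall x y, -1 <= x <= 1 -> -1 <= y <= 1 -> cdiff F (x +i* y)) ->
    (forall t, -1 <= t <= 1 -> F (t +i* (-1)) = 0) ->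
  F 0 = 0.
Proof.
move=> hF hb.
pose P z := F z * F ((-1) * z + 0) * (F ('i * z + 0) * F (- 'i * z + 0)).
have e1 (x y : R) : (-1) * (x +i* y) + 0 = (- x) +i* (- y).
  by apply/eqP; rewrite eq_complex /=; apply/andP; split; apply/eqP; ring.
have e2 (x y : R) : 'i * (x +i* y) + 0 = (- y) +i* x.
  by apply/eqP; rewrite eq_complex /=; apply/andP; split; apply/eqP; ring.
have e3 (x y : R) : - 'i * (x +i* y) + 0 = y +i* (- x).
  by apply/eqP; rewrite eq_complex /=; apply/andP; split; apply/eqP; ring.
have : P 0 = 0.
  apply: square_boundary_eq0.
    move=> x y hx hy; apply: cdiffM; apply: cdiffM.
    - exact: hF.
    - by apply: (@cdiff_affine _ F); rewrite e1; apply: hF; lra.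
    - by apply: (@cdiff_affine _ F); rewrite e2; apply: hF; lra.
    - by apply: (@cdiff_affine _ F); rewrite e3; apply: hF; lra.
  move=> t ht; split.
  - by rewrite /P hb// !mul0r.
  - by rewrite /P e1 hb ?mulr0 ?mul0r//; lra.
  - by rewrite /P e2 hb ?mulr0 ?mul0r ?mulr0//; lra.
  - by rewrite /P e3 hb ?mulr0//.
rewrite /P !mulr0 !addr0 => /eqP; rewrite !mulf_eq0 => /orP[/orP[]|/orP[]] /eqP //.
Qed.

End square.

(** * Spreading of zeros from a segment *)

Section growth.
Variable R : realType.
Implicit Types (F : R[i] -> R[i]) (x y p q s : R).

(** Multiplication by p + i q scales and rotates the square of [square_side_eq0], so the side
    carrying the zeros may face any direction. *)
Lemma tilted_square_side_eq0 F x y p q :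
    (forall u v, -1 <= u <= 1 -> -1 <= v <= 1 ->
       cdiff F ((x + p * u - q * v) +i* (y + q * u + p * v))) ->
    (forall t, -1 <= t <= 1 -> F ((x + p * t + q) +i* (y + q * t - p)) = 0) ->
  F (x +i* y) = 0.
Proof.
move=> hF hb; have e u v : (p +i* q) * (u +i* v) + (x +i* y) =
    (x + p * u - q * v) +i* (y + q * u + p * v).
  by apply/eqP; rewrite eq_complex /=; apply/andP; split; apply/eqP; ring.
have := @square_side_eq0 _ (fun z => F ((p +i* q) * z + (x +i* y))).
rewrite mulr0 add0r; apply.
  by move=> u v hu hv; apply: cdiff_affine; rewrite e; exact: hF.
move=> t ht; rewrite e.
rewrite (_ : x + p * t - q * -1 = x + p * t + q); last by ring.
rewrite (_ : y + q * t + p * -1 = y + q * t - p); last by ring.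
exact: hb.
Qed.

(* The zero set spreads from the segment [-s, s] to the square on it as a
   diagonal, then to the square [-s, s]^2, then to the segment [-2s, 2s]. *)
Lemma zero_segment_doubles F s : 0 < s ->
    (forall x y, `|x| <= 3 * s -> `|y| <= 3 * s -> cdiff F (x +i* y)) ->
    (forall x, `|x| <= s -> F (x +i* 0) = 0) ->
  forall x, `|x| <= 2 * s -> F (x +i* 0) = 0.
Proof.
move=> s0 hF h0.
have bnd (d t : R) : -1 <= t <= 1 -> - `|d| <= d * t <= `|d|.
  move=> ht; rewrite -ler_norml normrM ler_piMr// ler_norml; lra.
have diamond x y : `|x| + `|y| <= s -> F (x +i* y) = 0.
  move=> xy; have nx := normr_ge0 x; have ny := normr_ge0 y.
  have ax : - `|x| <= x <= `|x| by rewrite -ler_norml.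
  have ay : - `|y| <= y <= `|y| by rewrite -ler_norml.
  (* The square centred at x + i y with a side on the real axis; that side lies in [-s, s]. *)
  apply: (@tilted_square_side_eq0 _ _ _ y 0) => [u v hu hv|t ht].
    have yu := bnd y u hu; have yv := bnd y v hv.
    by apply: hF; rewrite ler_norml; lra.
  rewrite (_ : y + 0 * t - y = 0); last by ring.
  have yt := bnd y t ht; rewrite addr0; apply: h0; rewrite ler_norml; lra.
have square x y : `|x| <= s -> `|y| <= s -> F (x +i* y) = 0.
  move=> xs ys; have [/diamond//|xy] := leP (`|x| + `|y|) s.
  (* Half of the excess over s: in each quadrant the square tilted by 45 degrees has a side on the
     edge |x| + |y| = s of the diamond. *)
  pose d := (`|x| + `|y| - s) / 2.
  have d0 : 0 <= d by rewrite divr_ge0// subr_ge0 ltW.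
  have bd (t : R) : -1 <= t <= 1 -> - d <= d * t <= d.
    by move=> ht; have := bnd d t ht; rewrite ger0_norm.
  have ed : 2 * d = `|x| + `|y| - s by rewrite /d; field.
  move: d d0 bd ed => d d0 bd ed.
  have [x0|x0] := leP 0 x; have [y0|y0] := leP 0 y;
    rewrite ?(ger0_norm x0) ?(ger0_norm y0) ?(ltr0_norm x0) ?(ltr0_norm y0) in xs ys xy ed.
  - apply: (@tilted_square_side_eq0 _ _ _ d (- d)) => [u v /bd hu /bd hv|t /bd ht].
      by apply: hF; rewrite ler_norml mulNr; lra.
    by apply: diamond; rewrite mulNr !ger0_norm; lra.
  - apply: (@tilted_square_side_eq0 _ _ _ (- d) (- d)) => [u v /bd hu /bd hv|t /bd ht].
      by apply: hF; rewrite ler_norml !mulNr; lra.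
    by apply: diamond; rewrite !mulNr (ger0_norm (x := x + _ - _)) ?(ler0_norm (x := y + _ - _)); lra.
  - apply: (@tilted_square_side_eq0 _ _ _ d d) => [u v /bd hu /bd hv|t /bd ht].
      by apply: hF; rewrite ler_norml; lra.
    by apply: diamond; rewrite (ler0_norm (x := x + _ + _)) ?(ger0_norm (x := y + _ - _)); lra.
  - apply: (@tilted_square_side_eq0 _ _ _ (- d) d) => [u v /bd hu /bd hv|t /bd ht].
      by apply: hF; rewrite ler_norml !mulNr; lra.
    by apply: diamond; rewrite !mulNr !ler0_norm; lra.
move=> x x2; have [/h0//|xs] := leP `|x| s.
(* The upright square centred at x has its near side on the vertical line through s or -s; its
   half-side |x| - s is at most s, so this side lies in the square already covered. *)
have [x0|x0] := leP 0 x; rewrite ?(ger0_norm x0) ?(ltr0_norm x0) in x2 xs.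
  have bd (t : R) : -1 <= t <= 1 -> - (x - s) <= (x - s) * t <= x - s.
    by move=> ht; have := bnd (x - s) t ht; rewrite ger0_norm// subr_ge0 ltW.
  apply: (@tilted_square_side_eq0 _ _ _ 0 (- (x - s))) => [u v /bd hu /bd hv|t /bd ht].
    by apply: hF; rewrite ler_norml; lra.
  by apply: square; rewrite ler_norml; lra.
have bd (t : R) : -1 <= t <= 1 -> - (- x - s) <= (- x - s) * t <= - x - s.
  by move=> ht; have := bnd (- x - s) t ht; rewrite ger0_norm// subr_ge0 ltW.
apply: (@tilted_square_side_eq0 _ _ _ 0 (- x - s)) => [u v /bd hu /bd hv|t /bd ht].
  by apply: hF; rewrite ler_norml; lra.
by apply: square; rewrite ler_norml; lra.
Qed.

End growth.

Section holomorphic.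
Variable R : realType.

(** A positive element of R[i] has zero imaginary part, so balls of complex radius are balls for
    [normc]. *)
Lemma ball_normc (z w : R[i]^o) (d : R[i]) : 0 < d ->
  exists2 r : R, 0 < r & forall w, normc (w - z) < r -> ball z d w.
Proof.
case: d => p q; rewrite ltcE /= => /andP[/eqP -> p0]; exists p => // t.
move=> h; rewrite /ball /= distrC.
have : (normc (t - z))%:C < p%:C :> R[i] by rewrite ltcR.
by [].
Qed.

Lemma open_normc (U : set R[i]^o) (z : R[i]^o) : open U -> U z ->
  exists2 r : R, 0 < r & forall w : R[i], normc (w - z) < r -> U w.
Proof.
move=> oU Uz; have /nbhs_ballP[d /= d0 hd] := open_nbhs_nbhs (conj oU Uz).
by have [r r0 hr] := ball_normc z z d0; exists r => // w /hr/hd.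
Qed.

Lemma derivable_cdiff (F : R[i]^o -> R[i]^o) (z : R[i]^o) : derivable F z 1 -> @cdiff R F z.
Proof.
move=> /cvg_ex[l /= /cvgrPdist_le hl]; exists l => e e0.
have eC : 0 < e%:C :> R[i] by rewrite ltcR.
have := hl _ eC; rewrite near_withinE => /nbhs_ballP[d /= d0 hd].
have [r r0 hr] := ball_normc 0 0 d0; exists r => // h hh.
have [->|h0] := eqVneq h 0.
  by rewrite addr0 subrr mulr0 subr0 normc0 mulr0.
have := hd h; rewrite /= => /(_ _ h0).
have : ball (0 : R[i]^o) d h by apply: hr; rewrite subr0.
move=> hb /(_ hb).
have -> : l - h^-1 *: (F (h *: 1 + z) - F z) = - ((F (z + h) - F z - l * h) * h^-1).
  have -> : h *: 1 + z = z + h by rewrite -[h *: 1]/(h * 1) mulr1; exact: addrC.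
  rewrite -[h^-1 *: _]/(h^-1 * _); move: (F (z + h)) (F z) => a b.
  by rewrite mulrC [in RHS]mulrBl mulfK// opprB.
rewrite normrN => hb'.
have {hb'} : (normc ((F (z + h) - F z - l * h) * h^-1))%:C <= e%:C :> R[i] by [].
rewrite lecR => hb'; rewrite -[X in normc X](mulfVK h0) normcM.
by apply: ler_wpM2r => //; exact: normc_ge0.
Qed.

(** Let b be the supremum of the points up to which F vanishes from m on. Doubling a segment of
    zeros just to the left of b reaches beyond b. *)
Lemma holomorphic_zero_right (U : set R[i]^o) (F : R[i]^o -> R[i]^o) (u v : R) :
    open U -> (forall x : R, U x%:C) -> holomorphic_on U F -> u < v ->
    (forall x : R, u < x < v -> F x%:C = 0) ->
  forall x : R, u < x -> F x%:C = 0.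
Proof.
move=> oU UR hF uv h0 x1 ux1; apply/eqP; apply: contrapT => /negP Fx1.
pose m := (u + v) / 2.
have mu : u < m < v by rewrite midf_lt// midf_lt.
have xv : v <= x1 by rewrite leNgt; apply/negP => x1v; move/negP: Fx1; apply; rewrite h0// ux1.
pose S := [set y : R | m <= y /\ forall t : R, m <= t <= y -> F t%:C = 0].
have ubS y : S y -> y <= x1.
  move=> [my hy]; rewrite leNgt; apply/negP => x1y; move/negP: Fx1; apply.
  by rewrite hy//; lra.
have Sy : S ((m + v) / 2).
  by split=> [|t ht]; [lra|apply: h0; lra].
have Ssup : has_sup S by split; [exists ((m + v) / 2)|exists x1].
pose b := sup S.
have mb : (m + v) / 2 <= b by exact: (ub_le_sup (proj2 Ssup) Sy).
have zb t : m <= t < b -> F t%:C = 0.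
  move=> /andP[mt tb]; have [y [my hy] ty] := sup_gt (proj1 Ssup) tb.
  by apply: hy; rewrite mt ltW.
have [r r0 hr] := open_normc oU (UR b).
have [s s0 [sr sm]] : exists2 s : R, 0 < s & 8 * s < r /\ 3 * s < b - m.
  exists (Num.min (r / 9) ((b - m) / 4)); first by rewrite lt_min; apply/andP; split; lra.
  set s := Num.min _ _.
  have : s <= Num.min (r / 9) ((b - m) / 4) by [].
  by rewrite le_min => /andP[h1 h2]; split; lra.
(* The segment of half-length s about [p] ends at b - s/2; doubled, it reaches b + s/2. The square
   of half-side 3s about [p] stays within distance 8s < r of b, inside U. *)
pose p := b - 3 / 2 * s.
have eC (x : R) : (x%:C : R[i]) = x +i* 0 by [].
have key := @zero_segment_doubles R (fun z => F (1 * z + p%:C)) s s0.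
have eP (x y : R) : 1 * (x +i* y) + p%:C = (x + p) +i* y.
  by apply/eqP; rewrite eq_complex /=; apply/andP; split; apply/eqP; ring.
have : S (b + s / 2).
  split=> [|t /andP[mt tb]]; first by lra.
  have [tlt|tge] := ltP t b; first by apply: zb; rewrite mt.
  have := key _ _ (t - p); rewrite eP subrK; apply; last first.
  - rewrite /p ler_norml; lra.
  - move=> x; rewrite ler_norml => hx; rewrite eP; apply: zb; rewrite /p; lra.
  - move=> x y; rewrite !ler_norml => hx hy; apply: cdiff_affine; rewrite eP.
    apply: derivable_cdiff; apply: hF; apply: hr.
    apply: (le_lt_trans (normc_le _)).
    rewrite /= subr0.
    have : `|x + p - b| <= 5 * s by rewrite ler_norml /p; lra.
    have : `|y| <= 3 * s by rewrite ler_norml; lra.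
    lra.
move=> /(ub_le_sup (proj2 Ssup)); rewrite -/b; lra.
Qed.

End holomorphic.

(** * The four cases *)

Section positive_version.
Variables (R : realType) (f : R -> R).
Hypothesis fi : integrableR f.
Hypothesis f_ge0 : {ae leb, forall t : R, 0 <= f t}.

(** Nonnegativity holds only almost everywhere, while Tonelli's theorem and the tail estimates are
    applied with pointwise signs. The replacement changes f on a null set only, so its transform is
    the same, and so is its deck at every point, translates of null sets being null. *)
Definition pos_version (h : R -> R) (t : R) := Num.max (h t) 0.
Local Notation fp := (pos_version f).

Lemma pos_version_ge0 t : 0 <= fp t.
Proof. by rewrite /pos_version le_max lexx orbT. Qed.

Lemma pos_version_ae : {ae leb, forall t, fp t = f t}.
Proof.
case: f_ge0 => N [mN N0 hN]; exists N; split => // t /= nt; apply: hN => /= ft0; apply: nt.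
exact/max_idPl.
Qed.

Let mf : measurable_fun setT f.
Proof. by apply/measurable_EFinP; move/measurable_int: fi. Qed.

Let mfp : measurable_fun setT fp.
Proof. exact: measurable_maxr. Qed.

Lemma pos_version_integrable : leb.-integrable setT (fun t => (fp t)%:E).
Proof.
apply: le_integrable fi => //; first exact/measurable_EFinP.
move=> t _; rewrite /= lee_fin /pos_version; have [h|h] := leP (f t) 0 => //.
by rewrite normr0.
Qed.

Lemma integral_pos_version (D : set R) (h : R -> R -> R) : measurable D ->
    measurable_fun setT (fun t => h t (f t)) -> measurable_fun setT (fun t => h t (fp t)) ->
  (\int[leb]_(t in D) (h t (fp t))%:E = \int[leb]_(t in D) (h t (f t))%:E)%E.
Proof.
move=> mD m1 m2; apply: ae_eq_integral => //.
- by apply: measurable_funTS; exact/measurable_EFinP.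
- by apply: measurable_funTS; exact/measurable_EFinP.
case: pos_version_ae => N [mN N0 hN]; exists N; split => // t /= nt; apply: hN => /= e.
by apply: nt => _; rewrite e.
Qed.

Lemma deck3_pos_version x : deck3 fp x = deck3 f x.
Proof.
have shift (h : R -> R) (a : R) : measurable_fun setT h -> measurable_fun setT (fun t : R => h (t + a)).
  by move=> mh; exact: (measurableT_comp mh (@measurable_shiftr R a)).
apply: ae_eq_integral => //.
- by apply/measurable_EFinP; do 2 (apply: measurable_funM; last exact: shift).
- by apply/measurable_EFinP; do 2 (apply: measurable_funM; last exact: shift).
move: pos_version_ae (ae_shift x.1 pos_version_ae) (ae_shift x.2 pos_version_ae).
apply: (@filterS3 _ _ (ae_filter_ringOfSetsType _)) => t h1 h2 h3 _.
by rewrite h1 h2 h3.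
Qed.

Lemma fourier_pos_version xi : fourier fp xi = fourier f xi.
Proof.
have e (u p q : R) : Re (u%:C * (p +i* q)) = u * p /\ Im (u%:C * (p +i* q)) = u * q.
  by split=> /=; ring.
have mc : measurable_fun setT (fun t : R => - (2 * pi * t * xi)).
  by apply: measurable_funN; apply: measurable_funM => //; exact: measurable_funM.
have [m1 m2] := cmeasurable_cis mc.
rewrite /fourier /complex_integral /Rintegral /cis; congr (fine _ +i* fine _).
  under eq_integral do rewrite (e _ _ _).1.
  under [RHS]eq_integral do rewrite (e _ _ _).1.
  by apply: (integral_pos_version (h := fun t u => u * cos (- (2 * pi * t * xi)))) => //;
    exact: measurable_funM.
under eq_integral do rewrite (e _ _ _).2.
under [RHS]eq_integral do rewrite (e _ _ _).2.
by apply: (integral_pos_version (h := fun t u => u * sin (- (2 * pi * t * xi)))) => //;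
  exact: measurable_funM.
Qed.

Lemma integral_pos_version_le (D : set R) (mD : measurable D) :
  (\int[leb]_(t in D) (fp t)%:E <= charge_total_variation (induced_charge fi) D)%E.
Proof.
rewrite (integral_pos_version (h := fun _ u => u))//.
apply: (le_trans (lee_abs _)); exact: abse_charge_variation.
Qed.

End positive_version.

(** * Absence of spectral gaps *)

Section density.
Variable R : realType.
Implicit Types (f : R -> R).

Lemma fourier_ft f xi : fourier f xi = ft f (- (2 * pi * xi)).
Proof.
by congr complex_integral; apply/funext => t; congr (_ * cis _); ring.
Qed.

Lemma fourierN f xi : integrableR f ->
  fourier f (- xi) = conjc (fourier f xi).
Proof. by move=> fi; rewrite !fourier_ft -ftN// mulrN. Qed.

Lemma fourier_oppr f xi : integrableR f ->
  fourier (fun t => f (- t)) xi = fourier f (- xi).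
Proof.
move=> fi; rewrite !fourier_ft mulrN opprK.
have [i1 i2] := ft_cintegrable (2 * pi * xi) fi.
rewrite /ft /complex_integral /Rintegral; congr (fine _ +i* fine _).
  by rewrite -(integral_oppr (measurable_int _ i1)); apply: eq_integral => t _; rewrite mulNr mulrN.
by rewrite -(integral_oppr (measurable_int _ i2)); apply: eq_integral => t _; rewrite mulNr mulrN.
Qed.

Lemma ft_dense f :
    (forall u v, u < v -> exists2 xi, u < xi < v & fourier f xi != 0) ->
  forall u v, u < v -> exists2 x, u < x < v & ft f x != 0.
Proof.
move=> dense u v uv; have p0 : 0 < 2 * pi :> R by rewrite mulr_gt0// pi_gt0.
have [|xi /andP[h1 h2] n] := dense (- v / (2 * pi)) (- u / (2 * pi)).
  by rewrite ltr_pM2r ?invr_gt0// ltrN2.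
exists (- (2 * pi * xi)); last by rewrite -fourier_ft.
rewrite ltr_pdivrMr// in h1; rewrite ltr_pdivlMr// in h2.
by lra.
Qed.

Lemma fourier_dense_tail f : integrableR f ->
    (forall t, 0 <= f t) -> 0 < Rintegral leb setT f -> tail_diverges f ->
  forall u v, u < v -> exists2 xi, u < xi < v & fourier f xi != 0.
Proof.
move=> fi f0 If tf u v uv; apply: contrapT => nex.
have : {ae leb, forall t, f t = 0}.
  apply: (fourier_gap_eq0 fi f0 tf uv) => xi hxi.
  by apply/eqP; apply: contrapT => /negP n; apply: nex; exists xi.
move=> [N [mN N0 hN]]; move: If; rewrite /Rintegral.
rewrite (ae_eq_integral (cst 0%E)) ?integral0 ?ltxx//.
  by move/measurable_int : fi.
by exists N; split => // t /= nt; apply: hN => /= e; apply: nt => _; rewrite e.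
Qed.

Lemma fourier_dense_oppr f : integrableR f ->
    (forall u v, u < v -> exists2 xi, u < xi < v & fourier (fun t => f (- t)) xi != 0) ->
  forall u v, u < v -> exists2 xi, u < xi < v & fourier f xi != 0.
Proof.
move=> fi h u v uv; have [|xi /andP[h1 h2] n] := h (- v) (- u); first by rewrite ltrN2.
by exists (- xi); rewrite -?fourier_oppr// ltrNr h2 ltrNl h1.
Qed.

(** Zeros are propagated to the right only: a gap starting left of 0 reaches 0, where the transform
    is the positive integral of f. Any other gap is first reflected by the conjugation symmetry. *)
Lemma fourier_dense_analytic f : integrableR f ->
    0 < Rintegral leb setT f -> analytic_near_real_line (fourier f) ->
  forall u v, u < v -> exists2 xi, u < xi < v & fourier f xi != 0.
Proof.
move=> fi If [U [F [oU UR hF FE]]] u v uv; apply: contrapT => nex.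
have gap xi : u < xi < v -> fourier f xi = 0.
  by move=> hxi; apply/eqP; apply: contrapT => /negP n; apply: nex; exists xi.
have key u' v' : u' < v' -> u' < 0 -> (forall xi, u' < xi < v' -> fourier f xi = 0) -> False.
  move=> uv' u0 gap'.
  have := holomorphic_zero_right oU UR hF uv' (fun x hx => etrans (FE x) (gap' x hx)) u0.
  rewrite FE fourier_ft mulr0 oppr0 ft0 => /complexI e.
  by move: If; rewrite e ltxx.
have [u0|u0] := ltP u 0; first exact: (key u v).
apply: (key (- v) (- u)); rewrite ?ltrN2//.
  by rewrite oppr_lt0; exact: le_lt_trans uv.
move=> xi hxi; rewrite -[xi]opprK fourierN// gap ?conjc0//.
by rewrite ltrNr ltrNl andbC.
Qed.

End density.

Section conditions.
Variable R : realType.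
Implicit Types (f : R -> R).

Lemma integral_oppr_ray (h : R -> \bar R) (x : R) : measurable_fun setT h ->
  (\int[leb]_(t in `[x, +oo[) h (- t)%R = \int[leb]_(t in `]-oo, (- x)%R]) h t)%E.
Proof.
move=> mh; rewrite integral_mkcond [RHS]integral_mkcond.
rewrite -(@integral_oppr _ (h \_ `]-oo, (- x)])); last first.
  by apply/(measurable_restrictT _ (measurable_itv _)); exact: measurable_funTS.
apply: eq_integral => t _; rewrite !patchE !mem_setE /= !in_itv /= andbT.
by rewrite lerN2.
Qed.

Lemma tail_le_integral f x : integrableR f ->
  (forall t, 0 <= f t) -> ((tail f x)%:E <= \int[leb]_(t in `[x, +oo[) (f t)%:E)%E.
Proof.
move=> fi f0; have ti := tail_integrable_real x fi.
rewrite /tail /Rintegral fineK ?integrable_fin_num// [leRHS]integral_mkcond.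
apply: ge0_le_integral => //.
- by move=> t _; rewrite lee_fin; case: ifP.
- exact: measurable_int ti.
- by apply/(measurable_restrictT _ (measurable_itv _)); apply: measurable_funTS; exact: measurable_int fi.
move=> t _; rewrite patchE mem_setE /= in_itv /= andbT.
by case: (leP t x) => [tx|/ltW ->]; [case: ifP => _; rewrite lee_fin|].
Qed.

Lemma measurable_lne_EFin (h : R -> R) : measurable_fun setT h ->
  measurable_fun setT (fun x => lne (h x)%:E).
Proof.
move=> mh; rewrite /lne; apply: measurable_fun_ifT => //.
  exact: measurable_fun_ler.
by apply/measurable_EFinP; exact: measurableT_comp.
Qed.

(** The variation of ]-oo, x] is monotone in x. Measurability serves to reflect the left logarithmic
    integral by a change of variables. *)
Lemma charge_variation_ray_measurable (nu : {charge set (measurableTypeR R) -> \bar R}) :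
  measurable_fun setT (fun x : R => - lne (charge_total_variation nu `]-oo, x]))%E.
Proof.
pose mu := charge_variation (svalP (cid (svalP (cid (Hahn_decomposition nu))))).
have mr (x : R) : measurable (`]-oo, x] : set (measurableTypeR R)) by [].
have fin (x : R) : charge_total_variation nu `]-oo, x] \is a fin_num.
  exact: fin_num_measure.
apply: measurableT_comp => //.
under eq_fun do rewrite -(fineK (fin _)).
apply: measurable_lne_EFin; apply: nondecreasing_measurable => // x y xy.
rewrite fine_le//; apply: le_measure; rewrite ?inE//.
by apply: subset_itv; rewrite ?bnd_simp.
Qed.

End conditions.

Section cases.
Variables (R : realType) (f : R -> R).
Hypothesis fi : integrableR f.
Hypothesis f_ge0 : {ae leb, forall t : R, 0 <= f t}.
Local Notation fp := (pos_version f).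

Let mfp : measurable_fun setT fp.
Proof. by apply/measurable_EFinP; move/measurable_int: (pos_version_integrable fi). Qed.

Let mexp (M : R) : measurable_fun setT (fun x : R => expR (M * `|x|)).
Proof.
by apply: measurableT_comp => //; apply: measurable_funM => //; exact: measurable_normr.
Qed.

Lemma compact_support_exp_moment : compactly_supported f ->
  (\int[leb]_x (fp x * expR (1 * `|x|))%:E < +oo)%E.
Proof.
move=> [K [cK hK]]; have [M [_ hM]] := compact_bounded cK.
have bK x : K x -> `|x| <= `|M| + 1.
  by move=> Kx; apply: hM => //; rewrite ltr_pwDr// ler_norm.
have fpi := pos_version_integrable fi.
have Ci : leb.-integrable setT (fun x => (fp x * expR (`|M| + 1))%:E).
  by under eq_fun do rewrite EFinM; apply: integrableZr.
apply: (@le_lt_trans _ _ (\int[leb]_x (fp x * expR (`|M| + 1))%:E)%E).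
  apply: ae_ge0_le_integral => //.
  - by move=> x _; rewrite lee_fin mulr_ge0 ?pos_version_ge0 ?expR_ge0.
  - by apply/measurable_EFinP; exact: (measurable_funM mfp (mexp 1)).
  - by move=> x _; rewrite lee_fin mulr_ge0 ?pos_version_ge0 ?expR_ge0.
  - exact: measurable_int Ci.
  move: hK; apply: (@filterS _ _ (ae_filter_ringOfSetsType _)) => x hx _.
  rewrite lee_fin; have [Kx|nK] := pselect (K x).
    by rewrite ler_wpM2l ?pos_version_ge0// ler_expR mul1r bK.
  by rewrite /pos_version hx// maxxx !mul0r.
rewrite -ge0_fin_numE; first exact: integrable_fin_num.
by apply: integral_ge0 => x _; rewrite lee_fin mulr_ge0 ?pos_version_ge0 ?expR_ge0.
Qed.

Lemma exp_moment_pos_version (M : R) :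
  (\int[leb]_x (`|f x| * expR (M * `|x|))%:E < +oo)%E ->
  (\int[leb]_x (fp x * expR (M * `|x|))%:E < +oo)%E.
Proof.
apply: le_lt_trans; apply: integral_le_ge0 => x _.
  by rewrite lee_fin mulr_ge0 ?expR_ge0.
rewrite lee_fin ler_wpM2r ?expR_ge0//.
by rewrite /pos_version ge_max normr_ge0 ler_norm.
Qed.

Lemma Rintegral_pos_version_gt0 : (\int[leb]_t (f t)%:E)%E <> 0%E -> 0 < Rintegral leb setT fp.
Proof.
move=> f_neq0; rewrite lt0r; apply/andP; split; last first.
  by apply: Rintegral_ge0 => t _; exact: pos_version_ge0.
apply/eqP => I0; apply: f_neq0.
rewrite -(integral_pos_version f_ge0 (h := fun _ u => u))//; last first.
  by apply/measurable_EFinP; move/measurable_int: fi.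
rewrite -[LHS]fineK; last exact: (integrable_fin_num measurableT (pos_version_integrable fi)).
by rewrite -[fine _]/(Rintegral leb setT fp) I0.
Qed.

(** Tails are measured on the right only, so divergence on the left is carried over by t -> -t; a
    gap of f corresponds to a gap of the reflected function. *)
Lemma divergent_log_integral_tail : divergent_log_integral (induced_charge fi) ->
  tail_diverges fp \/ tail_diverges (fun t => fp (- t)).
Proof.
have fpi := pos_version_integrable fi; have fp0 := pos_version_ge0 f.
move=> [left_div|right_div]; [right|left]; last first.
  apply: (tail_diverges_log fpi fp0 _ right_div) => x.
  apply: (le_trans (tail_le_integral x fpi fp0)).
  exact: (integral_pos_version_le fi f_ge0 (measurable_itv _)).
pose F x := charge_total_variation (induced_charge fi) `]-oo, (- x)%R].
have fpni : leb.-integrable setT (fun t => (fp (- t))%:E) := integrable_oppr fpi.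
apply: (@tail_diverges_log _ _ F fpni (fun t => fp0 (- t))) => [x|].
  apply: (le_trans (tail_le_integral x fpni (fun t => fp0 (- t)))).
  rewrite (integral_oppr_ray x (measurable_int _ fpi)).
  exact: (integral_pos_version_le fi f_ge0 (measurable_itv _)).
pose h x : \bar R := (- lne (charge_total_variation (induced_charge fi) `]-oo, x]) *
  ((1 + x ^+ 2)^-1)%:E)%E.
have mh : measurable_fun setT h.
  apply: emeasurable_funM; first exact: charge_variation_ray_measurable.
  apply/measurable_EFinP.
  exact: (continuous_measurable_fun continuous_oneDsqrV).
rewrite -left_div -[X in `]-oo, X]]oppr0 -(integral_oppr_ray 0 mh).
by apply: eq_integral => x _; rewrite /h /F sqrrN.
Qed.

Lemma fourier_dense (f_neq0 : (\int[leb]_t (f t)%:E)%E <> 0%E)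
  (f_cond :
    [\/ compactly_supported f,
        exists2 M : R, 0 < M &
          (\int[leb]_x (`|f x| * expR (M * `|x|))%:E < +oo)%E,
        analytic_near_real_line (fourier f) |
        divergent_log_integral (induced_charge fi)]) (u v : R) :
  u < v -> exists2 xi, u < xi < v & fourier fp xi != 0.
Proof.
have fpi := pos_version_integrable fi; have fp0 := pos_version_ge0 f.
have If := Rintegral_pos_version_gt0 f_neq0.
have expd (M : R) : 0 < M -> (\int[leb]_x (fp x * expR (M * `|x|))%:E < +oo)%E ->
    forall u v, u < v -> exists2 xi, u < xi < v & fourier fp xi != 0.
  by move=> M0 fM; apply: fourier_dense_tail => //; exact: tail_diverges_exp fM.
case: f_cond => [/compact_support_exp_moment cs|[M M0 fM]|an|dl].
- exact: (expd 1 ltr01 cs).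
- exact: (expd M M0 (exp_moment_pos_version fM)).
- apply: fourier_dense_analytic => //.
  have -> : fourier fp = fourier f.
    by apply/funext => xi; exact: fourier_pos_version.
  exact: an.
case: (divergent_log_integral_tail dl) => [td|td].
  exact: (fourier_dense_tail fpi fp0 If td).
apply: fourier_dense_oppr => //; apply: fourier_dense_tail => //.
- exact: (integrable_oppr fpi).
- rewrite /Rintegral; rewrite (integral_oppr (measurable_int _ fpi)); exact: If.
Qed.

End cases.

Theorem theorem2p2 (R : realType) (f : R -> R)
  (f_L1 : leb.-integrable setT (fun t => (f t)%:E))
  (f_ge0 : {ae leb, forall t : R, 0 <= f t})
  (f_neq0 : (\int[leb]_t (f t)%:E)%E <> 0%E)
  (f_cond :
    [\/ compactly_supported f,
        exists2 M : R, 0 < M &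
          (\int[leb]_x (`|f x| * expR (M * `|x|))%:E < +oo)%E,
        analytic_near_real_line (fourier f) |
        divergent_log_integral (induced_charge f_L1)])
  (g : R -> R)
  (g_L1 : leb.-integrable setT (fun t => (g t)%:E))
  (g_ge0 : {ae leb, forall t : R, 0 <= g t})
  (deck_eq : {ae (leb \x leb)%E, forall x : R * R, deck3 g x = deck3 f x}) :
  exists a : R, {ae leb, forall x : R, g x = f (x - a)}.
Proof.
have [|a ha] := @deck3_translate R (pos_version f) (pos_version g)
  (pos_version_integrable f_L1) (pos_version_ge0 f) (Rintegral_pos_version_gt0 f_L1 f_ge0 f_neq0)
  (pos_version_integrable g_L1) (pos_version_ge0 g) _ 
  (ft_dense (fourier_dense f_ge0 f_neq0 f_cond)).
  by move: deck_eq; apply: (@filterS _ _ (ae_filter_ringOfSetsType _)) => x;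
    rewrite !deck3_pos_version.
exists a; move: ha (pos_version_ae g_ge0) (ae_shift (- a) (pos_version_ae f_ge0)).
by apply: (@filterS3 _ _ (ae_filter_ringOfSetsType _)) => x h1 h2 h3; rewrite -h2 h1 h3.
Qed.
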